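(* Let $\Omega\subset\mathbb{R}^2$ be a bounded open set, piecewise smooth in the sense defined in the context, with boundary $\Gamma$. Let $0<\alpha<\pi$ and let $y\in\Gamma$ be such that $\Omega\sim U_\alpha$ near $y$. Then $C_y:=-\Lambda(U_\alpha;1)$ is given by $$C_y=\begin{cases}1,&\text{if }\alpha\ge\pi/2,\\ \sin^{-2}\alpha,&\text{if }\alpha\le\pi/2.\end{cases}$$
   Context: For an open set $D\subset\mathbb{R}^2$ (possibly unbounded) and $\gamma>0$, $$\Lambda(D;\gamma):=\inf_{v\in H^1(D),\,v\not\equiv0}\frac{\int_D|\nabla v|^2\,dx-\gamma\int_{\partial D}|v|^2\,ds}{\int_D|v|^2\,dx},$$ with the value $-\infty$ allowed for unbounded $D$. $U_\alpha:=\{z=x+iy\in\mathbb{C}:|\arg z|<\alpha\}$ is the planar angle of size $2\alpha$, with $\mathbb{C}$ identified with $\mathbb{R}^2$. Piecewise smooth: for each $y\in\Gamma=\partial\Omega$ there exists an infinite model cone $K_y$ with vertex $0$ such that for a small enough $r>0$ there exists an infinitely smooth diffeomorphism $f_y:K_y\cap B(0,r)\to\Omega\cap B(y,r)$ with $f_y(0)=y$ and derivative of $f_y$ at $0$ equal to the identity matrix; one writes $\Omega\sim K_y$ near $y$, and defines $C_y:=-\Lambda(K_y;1)$. Here $\Omega\sim U_\alpha$ near $y$ means that $K_y=U_\alpha$ in suitable Cartesian coordinates. *)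

(* Defs.v *)
From HB Require Import structures.
From mathcomp Require Import all_boot all_order all_algebra.
From mathcomp Require Import all_classical all_reals all_analysis.

Set Implicit Arguments.
Unset Strict Implicit.
Unset Printing Implicit Defensive.

Import Order.TTheory GRing.Theory Num.Theory.
Import numFieldNormedType.Exports.

Local Open Scope classical_set_scope.
Local Open Scope ring_scope.

(* The plane is R * R. The library norm on a product is the max norm: it is
   used only through the topology, boundedness and differentiability, which do
   not depend on the norm. Lengths and balls below are Euclidean. *)

Section EuclideanPlane.
Context {R : realType}.
Implicit Types (x y : R * R) (A : set (R * R)).

Definition dot x y : R := x.1 * y.1 + x.2 * y.2.

Definition edist x y : R := Num.sqrt (dot (x - y) (x - y)).

Definition disc x (r : R) : set (R * R) := [set z | edist x z < r].

Definition frontier A : set (R * R) := closure A `\` A°.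

Definition area : set (R * R) -> \bar R :=
  (lebesgue_measure \x lebesgue_measure)%E.

(* 0 is added to the set so that the diameter of the empty set is 0. *)
Definition diam A : \bar R :=
  ereal_sup (0%E |` [set (edist p.1 p.2)%:E | p in A `*` A]).

(* One-dimensional Hausdorff measure, that is, arc length on curves. It is an
   outer measure; the library's integral only evaluates it on Borel sets. *)
Definition hausdorff1_pre (delta : R) A : \bar R :=
  ereal_inf [set (\sum_(0 <= n <oo) diam (F n))%E |
    F in [set F : nat -> set (R * R) |
      A `<=` \bigcup_n F n /\ forall n, (diam (F n) <= delta%:E)%E]].

Definition hausdorff1 A : \bar R :=
  ereal_sup [set hausdorff1_pre delta A | delta in [set d : R | 0 < d]].

End EuclideanPlane.

Section Smoothness.
Context {R : realType} {W : normedModType R}.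

(* For open A: f is infinitely differentiable on A, i.e. all its iterated
   directional derivatives are differentiable at every point of A. *)
Definition smooth_on (A : set (R * R)) (f : R * R -> W) : Prop :=
  forall (s : seq (R * R)) (x : R * R), A x ->
    differentiable (foldr (fun (e : R * R) (g : R * R -> W) => 'D_e g) f s) x.

End Smoothness.

Section Sobolev.
Context {R : realType}.
Implicit Types (D : set (R * R)) (mu : set (R * R) -> \bar R).
Implicit Types (v g phi : R * R -> R) (p : (R * R -> R) * (R * R -> R)).

Definition test_function D phi : Prop :=
  smooth_on setT phi /\
  exists K : set (R * R),
    [/\ compact K, K `<=` D & forall x, ~ K x -> phi x = 0].

Definition partial1 phi : R * R -> R := 'D_((1, 0) : R * R) phi.
Definition partial2 phi : R * R -> R := 'D_((0, 1) : R * R) phi.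

Definition sqint mu D v : \bar R := (\int[mu]_(x in D) ((v x) ^+ 2)%:E)%E.

Definition L2 mu D v : Prop := measurable_fun D v /\ (sqint mu D v < +oo)%E.

Definition area_integral D v : R :=
  \int[(lebesgue_measure \x lebesgue_measure)%E]_(x in D) v x.

Definition weak_gradient D v p : Prop :=
  forall phi, test_function D phi ->
    area_integral D (fun x => v x * partial1 phi x)
      = - area_integral D (fun x => p.1 x * phi x) /\
    area_integral D (fun x => v x * partial2 phi x)
      = - area_integral D (fun x => p.2 x * phi x).

(* v belongs to H^1(D) and p is its gradient. *)
Definition H1 D v p : Prop :=
  [/\ L2 area D v, L2 area D p.1, L2 area D p.2 & weak_gradient D v p].

(* g is the boundary trace of v, where grad v = p: the continuous extension to
   H^1(D) of the restriction of smooth functions to the boundary of D. For D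
   with Lipschitz boundary, in particular for planar angles, the trace of every
   v in H^1(D) exists and is unique up to arc length null sets. *)
Definition trace D v p g : Prop :=
  L2 hausdorff1 (frontier D) g /\
  exists phi : nat -> R * R -> R,
    [/\ forall n, test_function setT (phi n),
        (fun n => sqint area D (phi n \- v)) @ \oo --> 0%E,
        (fun n => sqint area D (partial1 (phi n) \- p.1)) @ \oo --> 0%E,
        (fun n => sqint area D (partial2 (phi n) \- p.2)) @ \oo --> 0%E &
        (fun n => sqint hausdorff1 (frontier D) (phi n \- g)) @ \oo --> 0%E].

(* All the integrals below are finite when H1 D v p and trace D v p g hold. *)
Definition robin_quotient D (gamma : R) v p g : R :=
  (fine (sqint area D p.1) + fine (sqint area D p.2)
     - gamma * fine (sqint hausdorff1 (frontier D) g))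
  / fine (sqint area D v).

Definition Lambda D (gamma : R) : \bar R :=
  ereal_inf [set q | exists v p g,
    [/\ H1 D v p, trace D v p g,
        ~ {ae (lebesgue_measure \x lebesgue_measure)%E,
             forall x, D x -> v x = 0} &
        q = (robin_quotient D gamma v p g)%:E]].

End Sobolev.

Section PiecewiseSmooth.
Context {R : realType}.
Implicit Types (Omega K W V : set (R * R)).

Definition model_cone K : Prop :=
  [/\ open K, K !=set0 & forall (t : R) x, 0 < t -> K x -> K (t *: x)].

Definition diffeomorphism W V (f : R * R -> R * R) : Prop :=
  exists g : R * R -> R * R,
    [/\ smooth_on W f, smooth_on V g,
        forall x, W x -> V (f x) /\ g (f x) = x &
        forall z, V z -> W (g z) /\ f (g z) = z].

(* "Omega ~ K near y". The vertex 0 is not a point of the open set K, so f is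
   required to be a diffeomorphism between open sets W and V, where W contains
   both 0 and the part of K in the disc; this gives f 0 and the derivative of f
   at 0 a meaning. *)
Definition similar_near Omega K (y : R * R) : Prop :=
  exists2 r0 : R, 0 < r0 & forall r : R, 0 < r < r0 ->
    exists W V (f : R * R -> R * R),
      [/\ [/\ open W, open V, W 0 & K `&` disc 0 r `<=` W],
          diffeomorphism W V f,
          f @` (K `&` disc 0 r) = Omega `&` disc y r,
          f 0 = y &
          forall h : R * R, 'd f (0 : R * R) h = h].

(* K assigns to each boundary point y of Omega its model cone K_y. *)
Definition piecewise_smooth Omega (K : R * R -> set (R * R)) : Prop :=
  forall y, frontier Omega y ->
    model_cone (K y) /\ similar_near Omega (K y) y.

Definition cone_constant K : \bar R := (- Lambda K 1)%E.

(* In polar coordinates, theta = arg z. *)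
Definition angle (alpha : R) : set (R * R) :=
  [set z | exists r theta : R,
    [/\ 0 < r, - pi < theta <= pi, `|theta| < alpha &
        z = (r * cos theta, r * sin theta)]].

(* K is the set A in some Cartesian coordinate system with origin 0: the
   coordinates of x are its products with an orthonormal basis (e1, e2). *)
Definition in_cartesian_coordinates K (A : set (R * R)) : Prop :=
  exists e1 e2 : R * R,
    [/\ dot e1 e1 = 1, dot e2 e2 = 1, dot e1 e2 = 0 &
        K = [set x | A (dot x e1, dot x e2)]].

End PiecewiseSmooth.

(* Main.v *)
Require Import Defs.
From HB Require Import structures.
From mathcomp Require Import all_boot all_order all_algebra.
From mathcomp Require Import all_classical all_reals all_analysis.
From mathcomp Require Import measurable_realfun.
From mathcomp Require Import ring lra.
Set Implicit Arguments.
Unset Strict Implicit.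
Unset Printing Implicit Defensive.
Import Order.TTheory GRing.Theory Num.Theory.
Import numFieldNormedType.Exports.
Local Open Scope classical_set_scope.
Local Open Scope ring_scope.

(* Let c = 1/sin(min(alpha, pi/2)). On a half-line with endpoint 0,
     int f'^2 + c^2 f^2 = c f(0)^2 + int (f' + c f)^2.
   Let p, q be unit vectors with |p x q| = 1/c and q' a unit vector orthogonal to q.
   Applying this identity along the half-lines {s p + t q : t > 0} and integrating
   over s > 0 gives, on the cone spanned by p and q,
     int |grad phi|^2 + c^2 phi^2
       = int_0^oo phi(s p)^2 ds + int (D_q phi + c phi)^2 + (D_q' phi)^2.
   The angle contains two disjoint cones of this kind, where p spans one of its two
   sides: q is the bisector when alpha <= pi/2, and the inner normal to the side when
   alpha >= pi/2. Adding up the two identities, the boundary integral is at most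
   int |grad phi|^2 + c^2 phi^2, that is Lambda >= -c^2. The remainder vanishes for
   phi = exp(-c q.x), so that cutting off this function at distance N gives equality
   as N tends to infinity. For alpha >= pi/2 the cut-off also localizes the function
   near one side, far from the vertex. *)

(** Three points shape the proof. The boundary term is an integral against [hausdorff1], which is
    only an outer measure; on the two sides of the angle it is therefore replaced by a measure [nu],
    the sum of two copies of Lebesgue measure on the half-line. A trace is by definition a limit of
    test functions, so the inequality is proved for test functions and carried over to H^1 with
    Young's inequality. For the upper bound, the gradient of a cut-off at scale N is of order 1/N on
    an area of order N^2, so the cut-off error is merely bounded and a second effect has to beat it.
    For alpha < pi/2 both cones have the same direction q, one exponential serves both of them, and
    it decays like exp(-c N cos alpha) where the cut-off acts. For alpha >= pi/2 this decay fails
    and the two normals need not agree; but the mass of the exponential along one side grows like N,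
    and the quotient divides by it. There the two cones need not fill the angle, so the cut-off also
    has to vanish in the rest of it. *)

Section PlaneMeasure.
Context {R : realType}.
Implicit Types (x p q : R * R) (D : set (R * R)).
Local Notation mu := (@lebesgue_measure R).

Definition cross p q : R := p.1 * q.2 - p.2 * q.1.

(** [R * R] carries the product sigma-algebra, so measurability of open sets rests on second
    countability: an open set is the union of the squares with rational centre and radius 1/(n+1)
    that it contains. *)
Lemma plane_open_measurable D : open D -> measurable D.
Proof.
move=> oD.
pose box (i : (rat * rat) * nat) : set (R * R) :=
  ball (ratr i.1.1 : R) (i.2.+1%:R^-1) `*` ball (ratr i.1.2 : R) (i.2.+1%:R^-1).
have -> : D = \bigcup_(i in [set i | box i `<=` D]) box i.
  apply/seteqP; split => [x Dx|x [i /= iD xi]]; last exact: iD.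
  have /nbhs_ballP[e /= e0 xe] : nbhs x D by exact: open_nbhs_nbhs.
  have [k ke] : exists k : nat, (2 * k.+1%:R^-1 < e :> R).
    have [k _ ke] := near_infty_natSinv_lt (PosNum (divr_gt0 e0 (ltr0n R 2))).
    exists k; have /= := ke k (leqnn k); by rewrite ltr_pdivlMr// mulrC.
  have k0 : 0 < k.+1%:R^-1 :> R by rewrite invr_gt0.
  have rat_near (a : R) : exists r : rat, ball (ratr r : R) k.+1%:R^-1 a.
    have /rat_in_itvoo[r] : a - k.+1%:R^-1 < a + k.+1%:R^-1.
      by rewrite ltrBlDr -addrA ltrDl addr_gt0.
    rewrite in_itv/= => /andP[ra ar]; exists r.
    rewrite -ball_normE /= ltr_norml; apply/andP; split.
      by rewrite ltrBrDl.
    by rewrite ltrBlDl.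
  have [r1 x1] := rat_near x.1; have [r2 x2] := rat_near x.2.
  exists ((r1, r2), k) => //= -[y1 y2] [/= yr1 yr2]; apply: xe; split => /=.
    apply: (@le_ball _ _ _ (k.+1%:R^-1 + k.+1%:R^-1)).
      by rewrite (_ : _ + _ = 2 / k.+1%:R) ?ltW//; ring.
    exact: ball_triangle (ball_sym x1) yr1.
  apply: (@le_ball _ _ _ (k.+1%:R^-1 + k.+1%:R^-1)).
    by rewrite (_ : _ + _ = 2 / k.+1%:R) ?ltW//; ring.
  exact: ball_triangle (ball_sym x2) yr2.
rewrite bigcup_mkcond; apply: countable_bigcupT_measurable => // i.
case: ifP => _; last exact: measurable0.
by apply: measurableX; exact: open_measurable (ball_open _ _).
Qed.

Lemma plane_continuous_measurable (f : R * R -> R) :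
  continuous f -> measurable_fun setT f.
Proof.
move=> /continuousP cf; apply: (measurability _ (RGenOpens.measurableE R)).
move=> _ [_ [a [b ->] <-]]; rewrite setTI; apply: plane_open_measurable.
exact/cf/interval_open.
Qed.

(** By uniqueness of Lebesgue measure: [|a|] times its image under z -> a z + b gives every interval
    []u, v]] its length. For a < 0 the preimage is closed on the left instead, which does not change
    its length. *)
Lemma ge0_integral_affine (a b : R) (f : R -> \bar R) : a != 0 ->
  measurable_fun [set: R] f -> (forall r, 0 <= f r)%E ->
  (\int[mu]_x f x = `|a|%:E * \int[mu]_x f (a * x + b)%R)%E.
Proof.
move=> a0 mf f0.
pose phi : measurableTypeR R -> measurableTypeR R := fun z => a * z + b.
have mphi : measurable_fun [set: measurableTypeR R] phi.
  apply: continuous_measurable_fun => z.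
  by apply: cvgD; [apply: cvgM; [exact: cvg_cst|exact: cvg_id]|exact: cvg_cst].
have na : 0 <= `|a| by exact: normr_ge0.
unshelve epose (nu := mscale (NngNum na) (pushforward mu phi) :
  {measure set (measurableTypeR R) -> \bar R}); first exact mphi.
have -> : (`|a|%:E * \int[mu]_x f (a * x + b)%R = \int[nu]_x f x)%E.
  by rewrite ge0_integral_mscale//= ge0_integral_pushforward.
apply: eq_measure_integral => A mA _; apply: lebesgue_measure_unique => //.
move=> _ [[u v] _ <-]; change (mu `]u, v] = `|a|%:E * mu (phi @^-1` `]u, v]))%E.
have [a_gt0|a_lt0|] := ltgtP 0 a; last by move=> /esym/eqP; rewrite (negPf a0).
- have -> : phi @^-1` `]u, v] = `](u - b) / a, (v - b) / a]%classic.
    apply/seteqP; split=> z /=; rewrite !in_itv/= /phi ltr_pdivrMr// ler_pdivlMr//.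
      by move=> /andP[? ?]; apply/andP; split; lra.
    by move=> /andP[? ?]; apply/andP; split; lra.
  rewrite !lebesgue_measure_itv/= !lte_fin gtr0_norm//.
  rewrite ltr_pM2r ?invr_gt0// ltrD2r; case: ifPn => _; last by rewrite mule0.
  by rewrite -EFinM; congr EFin; field.
- have -> : phi @^-1` `]u, v] = `[(v - b) / a, (u - b) / a[%classic.
    apply/seteqP; split=> z /=; rewrite !in_itv/= /phi ltr_ndivlMr// ler_ndivrMr//.
      by move=> /andP[? ?]; apply/andP; split; lra.
    by move=> /andP[? ?]; apply/andP; split; lra.
  rewrite !lebesgue_measure_itv/= !lte_fin ltr0_norm//.
  rewrite ltr_nM2r ?invr_lt0// ltrD2r; case: ifPn => _; last by rewrite mule0.
  by rewrite -EFinM; congr EFin; field.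
Qed.

Lemma tonelli_swap (H : R -> R -> \bar R) :
  measurable_fun [set: R * R] (fun z : R * R => H z.1 z.2) ->
  (forall s t, 0 <= H s t)%E ->
  (\int[mu]_s \int[mu]_t H s t = \int[mu]_t \int[mu]_s H s t)%E.
Proof.
move=> mH H0.
exact: (fubini_tonelli (m1 := mu) (m2 := mu) (fun z => H z.1 z.2)).
Qed.

Lemma tonelli_measurable1 (H : R -> R -> \bar R) :
  measurable_fun [set: R * R] (fun z : R * R => H z.1 z.2) ->
  (forall s t, 0 <= H s t)%E ->
  measurable_fun [set: R] (fun s => \int[mu]_t H s t)%E.
Proof.
move=> mH H0.
exact: (measurable_fun_fubini_tonelli_F (m2 := mu) (fun z => H z.1 z.2)).
Qed.

Lemma tonelli_measurable2 (H : R -> R -> \bar R) :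
  measurable_fun [set: R * R] (fun z : R * R => H z.1 z.2) ->
  (forall s t, 0 <= H s t)%E ->
  measurable_fun [set: R] (fun t => \int[mu]_s H s t)%E.
Proof.
move=> mH H0.
exact: (measurable_fun_fubini_tonelli_G (m1 := mu) (fun z => H z.1 z.2)).
Qed.

(** One step of Gaussian elimination: for p.1 != 0 the substitution in s has factor p.1 and leaves a
    substitution in t with factor [cross p q] / p.1, so two affine changes of variable suffice. *)
Lemma ge0_integral_linear_change p q (F : R * R -> \bar R) : cross p q != 0 ->
  measurable_fun [set: R * R] F -> (forall x, 0 <= F x)%E ->
  (\int[(mu \x mu)%E]_x F x =
   `|cross p q|%:E * \int[mu]_s \int[mu]_t F (s *: p + t *: q)%R)%E.
Proof.
have aff_meas a b : measurable_fun [set: R] (fun z : R => a * z + b).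
  apply: continuous_measurable_fun => z.
  by apply: cvgD; [apply: cvgM; [exact: cvg_cst|exact: cvg_id]|exact: cvg_cst].
have aff2_meas a b : measurable_fun [set: R * R] (fun z : R * R => a * z.1 + b * z.2).
  apply: plane_continuous_measurable => z; apply: cvgD; apply: cvgM;
    [exact: cvg_cst|exact: cvg_fst|exact: cvg_cst|exact: cvg_snd].
have lin_meas (G : R * R -> \bar R) a b c d : measurable_fun [set: R * R] G ->
    measurable_fun [set: R * R] (fun z : R * R => G (a * z.1 + b * z.2, c * z.1 + d * z.2)).
  move=> mG; apply: (measurableT_comp mG); exact: measurable_fun_pair.
have main (p1 p2 q1 q2 : R) (G : R * R -> \bar R) : p1 != 0 -> p1 * q2 - p2 * q1 != 0 ->
  measurable_fun [set: R * R] G -> (forall x, 0 <= G x)%E ->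
  (\int[(mu \x mu)%E]_x G x =
   `|p1 * q2 - p2 * q1|%:E *
     \int[mu]_s \int[mu]_t G (p1 * s + q1 * t, p2 * s + q2 * t)%R)%E.
  move=> p10 d0 mG G0.
  pose d := p1 * q2 - p2 * q1.
  rewrite (@tonelli_swap (fun s t => G (p1 * s + q1 * t, p2 * s + q2 * t)))//; last exact: lin_meas.
  have inner t : (\int[mu]_s G (p1 * s + q1 * t, p2 * s + q2 * t)%R =
     `|p1|^-1%:E * \int[mu]_s G (s, p2 / p1 * s + d / p1 * t)%R)%E.
    rewrite (@ge0_integral_affine p1 (q1 * t) (fun s => G (s, p2 / p1 * s + d / p1 * t)%R))//; last first.
      apply: (measurableT_comp mG); apply: measurable_fun_pair => //; exact: aff_meas.
    rewrite muleA -EFinM mulVf ?normr_eq0// mul1e.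
    by apply: eq_integral => s _; congr (G (_, _)); rewrite /d; field.
  under [X in (_ * X)%E]eq_integral do rewrite inner.
  rewrite ge0_integralZl//; last 2 first.
  - apply: (@tonelli_measurable2 (fun s t => G (s, p2 / p1 * s + d / p1 * t)))%R => //.
    have := lin_meas G 1 0 (p2 / p1) (d / p1) mG.
    by under eq_fun do rewrite mul1r mul0r addr0.
  - by move=> t _; exact: integral_ge0.
  rewrite -(@tonelli_swap (fun s t => G (s, p2 / p1 * s + d / p1 * t)%R))//; last first.
    have := lin_meas G 1 0 (p2 / p1) (d / p1) mG.
    by under eq_fun do rewrite mul1r mul0r addr0.
  have inner2 s : (\int[mu]_t G (s, p2 / p1 * s + d / p1 * t)%R =
     `|d / p1|^-1%:E * \int[mu]_t G (s, t))%E.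
    rewrite (@ge0_integral_affine (d / p1) (p2 / p1 * s) (fun t => G (s, t)))//.
    + rewrite muleA -EFinM mulVf ?mul1e; last by rewrite normr_eq0 mulf_neq0// invr_eq0.
      by apply: eq_integral => t _; congr (G (_, _)); rewrite addrC.
    + by rewrite mulf_neq0// invr_eq0.
    + exact: measurable_fun_pair2.
  under [X in (_ * (_ * X))%E]eq_integral do rewrite inner2.
  rewrite ge0_integralZl//; last 2 first.
  - apply: (@tonelli_measurable1 (fun s t => G (s, t))) => //.
    by under eq_fun do rewrite -surjective_pairing.
  - by move=> t _; exact: integral_ge0.
  rewrite !muleA -!EFinM -/d normrM normfV invfM invrK.
  rewrite (_ : `|d| / `|p1| * (`|d|^-1 * `|p1|) = 1) ?mul1e ?fubini_tonelli1//.
  by field; rewrite !normr_eq0 p10 d0.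
move=> d0 mF F0.
have Fpq s t : F (s *: p + t *: q) = F (p.1 * s + q.1 * t, p.2 * s + q.2 * t).
  by congr F; case: p q {d0} => [p1 p2] [q1 q2]; rewrite /= ![_ * s]mulrC ![_ * t]mulrC.
under [X in (_ * X)%E]eq_integral do under eq_integral do rewrite Fpq.
(* If p.1 = 0 then q.1 != 0, and exchanging p and q only changes the sign of the determinant. *)
have [p10|p10] := eqVneq p.1 0; last exact: main.
have q10 : q.1 != 0.
  by apply: contraNneq d0 => q10; rewrite /cross p10 q10 !(mul0r,mulr0) subrr.
have dE : q.1 * p.2 - q.2 * p.1 = - cross p q by rewrite /cross; ring.
have dE0 : q.1 * p.2 - q.2 * p.1 != 0 by rewrite dE oppr_eq0.
have E := main q.1 q.2 p.1 p.2 F q10 dE0 mF F0.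
rewrite E dE normrN; apply: (congr1 (fun z => `|cross p q|%:E * z)%E).
have S := @tonelli_swap (fun s t => F (q.1 * s + p.1 * t, q.2 * s + p.2 * t))
  (lin_meas _ _ _ _ _ mF) (fun _ _ => F0 _).
rewrite S; apply: eq_integral => s _; apply: eq_integral => t _.
by rewrite [q.1 * _ + _]addrC [q.2 * _ + _]addrC.
Qed.

End PlaneMeasure.

(** * Arc length on two rays *)

Section Hausdorff.
Context {R : realType}.
Local Notation mu := (@lebesgue_measure R).

(** The covers that define [hausdorff1] consist of arbitrary sets, whose traces on a ray may fail to
    be measurable; [mu] is therefore used here as an outer measure. *)
Lemma lebesgue_outer_le (A B : set R) : A `<=` B -> (mu A <= mu B)%E.
Proof. exact: (le_mu_ext (wlength idfun)). Qed.

Lemma lebesgue_outer_subadditive (F : nat -> set R) :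
  (mu (\bigcup_n F n) <= \sum_(0 <= n <oo) mu (F n))%E.
Proof. exact: (mu_ext_sigma_subadditive (measure_ge0 (wlength idfun))). Qed.

Lemma lebesgue_outer_diam (E : set R) (d : R) : 0 <= d ->
  (forall s t, E s -> E t -> t - s <= d) -> (mu E <= d%:E)%E.
Proof.
move=> d0 Ed; have [->|/set0P[s0 Es0]] := eqVneq E set0; first by rewrite measure0.
have lbE : has_lbound E by exists (s0 - d) => t Et; have := Ed _ _ Et Es0; lra.
have infE : has_inf E by split => //; exists s0.
apply: (@le_trans _ _ (mu `[inf E, inf E + d])).
  apply: lebesgue_outer_le => t Et /=; rewrite in_itv/= ge_inf//=.
  rewrite -lerBlDr; apply: lb_le_inf; first by exists s0.
  by move=> s Es; have := Ed _ _ Es Et; lra.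
rewrite lebesgue_measure_itv/=; case: ifPn => _ //.
by rewrite -EFinD lee_fin; lra.
Qed.

Lemma diam_ge0 (A : set (R * R)) : (0 <= diam A)%E.
Proof. by apply: ereal_sup_ubound; left. Qed.

Lemma edist_le_diam (A : set (R * R)) x y : A x -> A y -> ((Defs.edist x y)%:E <= diam A)%E.
Proof. by move=> Ax Ay; apply: ereal_sup_ubound; right; exists (x, y). Qed.

Lemma diam_le (A : set (R * R)) (d : R) : 0 <= d ->
  (forall x y, A x -> A y -> Defs.edist x y <= d) -> (diam A <= d%:E)%E.
Proof.
move=> d0 Ad; apply: ge_ereal_sup => _ [->|[[x y] /= [Ax Ay] <-]]; rewrite lee_fin//.
exact: Ad.
Qed.

(* The covering construction of the library only uses covers by measurable
   sets, whence the sigma-algebra of all sets. *)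
Let allsets := g_sigma_algebraType (@setT (set (R * R))).

(** Giving weight [+oo] to the sets of diameter greater than [delta] moves the constraint on the
    covers into the weight, so that [hausdorff1_pre] becomes an instance of [mu_ext] and inherits
    its countable subadditivity. *)
Let size_upto (delta : R) (A : set allsets) : \bar R :=
  if (diam (A : set (R * R)) <= delta%:E)%E then diam (A : set (R * R)) else +oo%E.

Let size_upto_ge0 delta A : (0 <= size_upto delta A)%E.
Proof. by rewrite /size_upto; case: ifP => // _; exact: diam_ge0. Qed.

Let hausdorff1_preE delta A : hausdorff1_pre delta A = mu_ext (size_upto delta) A.
Proof.
apply/eqP; rewrite eq_le; apply/andP; split.
  apply: le_ereal_inf_tmp => _ [F [mF AF] <-].
  have [Fd|] := pselect (forall n, (diam (F n : set (R * R)) <= delta%:E)%E).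
    apply: ereal_inf_lbound; exists F => //.
    by apply: eq_eseriesr => n _; rewrite /size_upto Fd.
  move=> /existsNP[n /negP Fn].
  by rewrite (@nneseries_pinfty _ _ _ n) ?leey// /size_upto (negPf Fn).
apply: le_ereal_inf_tmp => _ [F [AF Fd] <-].
apply: ereal_inf_lbound; exists F.
  by split => // n; exact: sub_sigma_algebra.
by apply: eq_eseriesr => n _; rewrite /size_upto Fd.
Qed.

Lemma hausdorff1_pre_le delta (A B : set (R * R)) : A `<=` B ->
  (hausdorff1_pre delta A <= hausdorff1_pre delta B)%E.
Proof. by rewrite !hausdorff1_preE; exact: (le_mu_ext (size_upto delta)). Qed.

Lemma hausdorff1_pre_subadditive delta (F : nat -> set (R * R)) :
  (hausdorff1_pre delta (\bigcup_n F n) <= \sum_(0 <= n <oo) hausdorff1_pre delta (F n))%E.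
Proof.
rewrite hausdorff1_preE; under eq_eseriesr do rewrite hausdorff1_preE.
exact: mu_ext_sigma_subadditive (size_upto_ge0 delta) F.
Qed.

Lemma diam0 : diam (@set0 (R * R)) = 0%E.
Proof.
apply/eqP; rewrite eq_le diam_ge0 andbT.
by apply: diam_le.
Qed.

Lemma hausdorff1_pre_ge0 delta (A : set (R * R)) : (0 <= hausdorff1_pre delta A)%E.
Proof. by rewrite hausdorff1_preE; exact: mu_ext_ge0 (size_upto_ge0 _) _. Qed.

Lemma hausdorff1_pre_diam (delta : R) (A : set (R * R)) : 0 <= delta ->
  (diam A <= delta%:E)%E -> (hausdorff1_pre delta A <= diam A)%E.
Proof.
move=> d0 Ad; apply: ereal_inf_lbound; exists (fun n => if n == 0%N then A else set0).
  split; first by move=> x Ax; exists 0%N.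
  by case=> [|n]//=; rewrite diam0.
rewrite nneseries_recl//; last by move=> k _; exact: diam_ge0.
by rewrite eseries0 ?adde0// => -[|k]//= _ _; rewrite diam0.
Qed.

Lemma hausdorff1_preU (delta : R) (A B : set (R * R)) : 0 <= delta ->
  (hausdorff1_pre delta (A `|` B) <= hausdorff1_pre delta A + hausdorff1_pre delta B)%E.
Proof.
move=> d0; rewrite -bigcup2E; apply: (le_trans (hausdorff1_pre_subadditive _ _)).
rewrite nneseries_recl//; last by move=> k _; exact: hausdorff1_pre_ge0.
apply: leeD => //=.
rewrite -(@nneseries_addn _ (fun k => hausdorff1_pre delta (bigcup2 A B k)) 1%N); last first.
  by move=> k; exact: hausdorff1_pre_ge0.
rewrite nneseries_recl//; last by move=> k _; exact: hausdorff1_pre_ge0.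
rewrite /= eseries0 ?adde0// => -[|k]//= _ _.
apply/eqP; rewrite eq_le hausdorff1_pre_ge0 andbT.
by rewrite addn1/= -[leRHS]diam0; apply: hausdorff1_pre_diam => //; rewrite diam0.
Qed.

End Hausdorff.

Lemma fst_lin {R : realType} (s t : R) (a b : R * R) :
  (s *: a - t *: b).1 = s * a.1 - t * b.1.
Proof. by []. Qed.

Lemma snd_lin {R : realType} (s t : R) (a b : R * R) :
  (s *: a - t *: b).2 = s * a.2 - t * b.2.
Proof. by []. Qed.

Section Ray.
Context {R : realType}.
Local Notation mu := (@lebesgue_measure R).
Variables (a : R * R).
Hypothesis a1 : dot a a = 1.

Lemma edist_ray (s t : R) : Defs.edist (s *: a) (t *: a) = `|s - t|.
Proof.
rewrite /Defs.edist (_ : dot _ _ = (s - t) ^+ 2) ?sqrtr_sqr//.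
rewrite -[RHS]mulr1 -a1 /dot !fst_lin !snd_lin; ring.
Qed.

(** The segment is cut into pieces of length at most [delta]; along a unit vector the diameter of a
    piece is at most its length, and the lengths add up. The induction is on the number N of
    pieces. *)
Lemma hausdorff1_pre_segment (delta u v : R) : 0 < delta -> u <= v ->
  (hausdorff1_pre delta ((fun s => s *: a) @` `]u, v]) <= (v - u)%:E)%E.
Proof.
move=> d0 uv; have [N vN] : exists N : nat, v - u <= N%:R * delta.
  exists (Num.bound ((v - u) / delta)); rewrite -ler_pdivrMr//.
  by apply/ltW/archi_boundP/divr_ge0; [lra|exact: ltW].
have short s t : s <= t -> t - s <= delta ->
    (hausdorff1_pre delta ((fun s => s *: a) @` `]s, t]) <= (t - s)%:E)%E.
  move=> st std; have dst : (diam ((fun s => s *: a) @` `]s, t]) <= (t - s)%:E)%E.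
    apply: diam_le; first lra.
    move=> _ _ [x /= + <-] [y /= + <-]; rewrite edist_ray !in_itv/=.
    by move=> /andP[sx xt] /andP[sy yt]; rewrite ler_norml; apply/andP; split; lra.
  apply: (le_trans _ dst); apply: hausdorff1_pre_diam; first exact: ltW.
  by apply: (le_trans dst); rewrite lee_fin.
elim: N u uv vN => [|N IH] u uv vN.
  by apply: short => //; move: vN; rewrite mul0r; lra.
have [vd|vd] := leP (v - u) delta; first exact: short.
have uvE : `]u, v]%classic = `]u, u + delta] `|` `]u + delta, v].
  apply/seteqP; split => x /=; rewrite !in_itv/=.
    by move=> /andP[ux xv]; have [xd|xd] := leP x (u + delta); [left|right]; lra.
  by move=> [|] /andP[? ?]; apply/andP; split; lra.
rewrite uvE image_setU; apply: (le_trans (hausdorff1_preU _ _ (ltW d0))).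
rewrite (_ : v - u = (u + delta - u) + (v - (u + delta))); last ring.
rewrite EFinD; apply: leeD; first by apply: short; lra.
by apply: IH; [lra|move: vN; rewrite -natr1 mulrDl mul1r; lra].
Qed.

(** Lebesgue measure is an infimum over covers by half-open intervals, and the image of such a cover
    is a union of segments to which the previous bound applies. *)
Lemma hausdorff1_pre_ray_le (delta : R) (X : set R) : 0 < delta ->
  (hausdorff1_pre delta ((fun s => s *: a) @` X) <= mu X)%E.
Proof.
move=> d0; apply: le_ereal_inf_tmp => _ [M [mM XM] <-].
apply: (@le_trans _ _ (\sum_(0 <= n <oo) hausdorff1_pre delta ((fun s => s *: a) @` M n))%E).
  apply: le_trans (hausdorff1_pre_subadditive _ _); apply: hausdorff1_pre_le.
  by move=> _ [s Xs <-]; have [n _ Mns] := XM _ Xs; exists n => //; exists s.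
apply: lee_nneseries => [n _ _|n _]; first exact: hausdorff1_pre_ge0.
have /ocitvP[->|[[u v] /= uv ->]] := mM n.
  apply: le_trans (wlength_ge0 idfun set0); rewrite image_set0 -[leRHS]diam0.
  by apply: hausdorff1_pre_diam; [exact: ltW|rewrite diam0 lee_fin ltW].
have -> : wlength idfun `]u, v] = (v - u)%:E by exact: (wlength_itv_bnd idfun _ _ (ltW uv)).
by apply: hausdorff1_pre_segment => //; exact: ltW.
Qed.

End Ray.

Section SetFunctionIntegral.
Import HBNNSimple.

(** A simple function below f extended by 0 outside D has its nonzero level sets inside D, so the
    integral only sees measurable subsets of D. No additivity is assumed of [m1] and [m2], which
    allows an outer measure to be exchanged for a measure. *)
Lemma eq_set_function_integral d (T : measurableType d) (R : realType)
    (m1 m2 : set T -> \bar R) (D : set T) (f : T -> \bar R) :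
  (forall A, measurable A -> A `<=` D -> m1 A = m2 A) ->
  (\int[m1]_(x in D) f x = \int[m2]_(x in D) f x)%E.
Proof.
move=> m12.
have eqs (g : T -> \bar R) (h : {nnsfun T >-> R}) : (forall x, ~ D x -> g x = 0%E) ->
    (forall x, (h x)%:E <= g x)%E -> sintegral m1 h = sintegral m2 h.
  move=> g0 hg; apply: eq_fsbigr => r _; have [->|r0] := eqVneq r 0; first by rewrite !mul0e.
  congr (_ * _)%E; apply: m12; first exact: measurable_sfunP.
  move=> x /= hxr; apply: contrapT => nDx; move/eqP: r0; apply.
  apply/eqP; rewrite eq_le -hxr; apply/andP; split; last exact: fun_ge0.
  by have := hg x; rewrite (g0 _ nDx) lee_fin.
rewrite /integral; congr (ereal_sup _ - ereal_sup _)%E;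
  apply/seteqP; split => _ [h hg <-]; exists h => //;
  first [apply: eqs hg|apply/esym; apply: eqs hg] => x nDx;
  by rewrite ?funeposE ?funenegE patchE memNset// ?oppe0 maxxx.
Qed.

End SetFunctionIntegral.

Section TwoRays.
Context {R : realType}.
Local Notation mu := (@lebesgue_measure R).
Variables (a b : R * R).
Hypotheses (a1 : dot a a = 1) (b1 : dot b b = 1) (ab : dot a b < 1).

(** The parameters below [eta] are left out because near the vertex a small set can meet both rays
    at once. *)
Definition part_from (c : R * R) (eta : R) (A : set (R * R)) : set R :=
  [set s | eta <= s /\ A (s *: c)].

Lemma part_from_measurable (c : R * R) (e : R) (A : set (R * R)) :
  measurable A -> measurable (part_from c e A).
Proof.
move=> mA; rewrite (_ : part_from c e A = `[e, +oo[ `&` ((fun s => s *: c) @^-1` A)).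
  apply: measurableI => //; rewrite -[X in measurable X]setTI.
  have mc : measurable_fun [set: R] (fun s : R => s *: c : R * R).
    have mM (k : R) : measurable_fun [set: R] (fun s : R => s * k).
      by apply: continuous_measurable_fun => z; apply: cvgM; [exact: cvg_id|exact: cvg_cst].
    exact: (measurable_fun_pair (mM c.1) (mM c.2)).
  exact: mc.
by apply/seteqP; split => s /=; rewrite in_itv/= andbT.
Qed.

(** Beyond distance [eta] from the vertex the two rays are more than [delta] apart, so a covering
    set of diameter at most [delta] meets only one of them. Its diameter then bounds the sum of its
    two traces, one of which is empty. *)
Lemma hausdorff1_ge_part (eta : R) (A : set (R * R)) : 0 < eta ->
  (mu (part_from a eta A) + mu (part_from b eta A) <= hausdorff1 A)%E.
Proof.
(* For unit vectors, |s a - t b|^2 = (s - t)^2 + 2 s t (1 - a.b), which for s, t >= eta is at least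
   2 eta^2 (1 - a.b), twice the square of [delta]. *)
move=> eta0; pose delta := eta * Num.sqrt (1 - dot a b).
have delta0 : 0 < delta by rewrite mulr_gt0// sqrtr_gt0 subr_gt0.
have far s t : eta <= s -> eta <= t -> delta < Defs.edist (s *: a) (t *: b).
  move=> es et; pose S := (s - t) ^+ 2 + 2 * (s * t) * (1 - dot a b).
  have SE : dot (s *: a - t *: b) (s *: a - t *: b) = S.
    transitivity (s ^+ 2 * dot a a + t ^+ 2 * dot b b - 2 * (s * t) * dot a b).
      rewrite /dot !fst_lin !snd_lin /=; ring.
    by rewrite a1 b1 /S; ring.
  have st : eta ^+ 2 <= s * t by rewrite expr2; apply: ler_pM => //; exact: ltW.
  have ab0 : 0 < 1 - dot a b by rewrite subr_gt0.
  have e2 : 0 < eta ^+ 2 * (1 - dot a b) by rewrite mulr_gt0// exprn_gt0.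
  have e3 : eta ^+ 2 * (1 - dot a b) <= s * t * (1 - dot a b) by rewrite ler_wpM2r// ltW.
  have deltaS : delta ^+ 2 < S.
    rewrite exprMn sqr_sqrtr /S; last exact: ltW.
    have := sqr_ge0 (s - t); rewrite -mulrA; lra.
  rewrite /Defs.edist SE -[delta]gtr0_norm// -sqrtr_sqr ltr_sqrt//.
  by apply: le_lt_trans deltaS; exact: sqr_ge0.
apply: (@le_trans _ _ (hausdorff1_pre delta A)); last first.
  by apply: ereal_sup_ubound; exists delta.
apply: le_ereal_inf_tmp => _ [F [AF Fd] <-].
apply: (@le_trans _ _ (\sum_(0 <= n <oo) mu (part_from a eta (F n)) +
                       \sum_(0 <= n <oo) mu (part_from b eta (F n)))%E).
  have cover c : (mu (part_from c eta A) <= \sum_(0 <= n <oo) mu (part_from c eta (F n)))%E.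
    apply: le_trans (lebesgue_outer_subadditive _); apply: lebesgue_outer_le.
    by move=> s [es /AF[n _ Fns]]; exists n.
  by apply: leeD; exact: cover.
have mu0 c n : (0 <= mu (part_from c eta (F n)))%E.
  rewrite -(measure0 mu); exact: lebesgue_outer_le.
rewrite -nneseriesD//; apply: lee_nneseries => [n _ _|n _]; first exact: adde_ge0.
have Fn_fin : diam (F n) \is a fin_num.
  by rewrite ge0_fin_numE ?diam_ge0//; apply: le_lt_trans (Fd n) _; rewrite ltry.
have d0 : 0 <= fine (diam (F n)) by apply/fine_ge0/diam_ge0.
have one c : dot c c = 1 -> (mu (part_from c eta (F n)) <= diam (F n))%E.
  move=> c1; rewrite -(fineK Fn_fin); apply: lebesgue_outer_diam => // s t [_ Fs] [_ Ft].
  rewrite -lee_fin fineK//; apply: le_trans (edist_le_diam Ft Fs).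
  by rewrite (edist_ray c1) lee_fin ler_norm.
have [Ea|/set0P[s [es Fs]]] := eqVneq (part_from a eta (F n)) set0.
  by rewrite Ea measure0 add0e one.
have [Eb|/set0P[t [et Ft]]] := eqVneq (part_from b eta (F n)) set0.
  by rewrite Eb measure0 adde0 one.
have := le_trans (edist_le_diam Fs Ft) (Fd n).
by rewrite lee_fin leNgt far.
Qed.

(** The upper bound is subadditivity. The lower bound is the limit of [hausdorff1_ge_part] as [eta]
    tends to 0. The vertex, which belongs to both rays, has measure zero. *)
Lemma hausdorff1_two_rays (A : set (R * R)) : measurable A ->
  A `<=` (fun s => s *: a) @` [set s | 0 <= s] `|` (fun s => s *: b) @` [set s | 0 <= s] ->
  hausdorff1 A = (mu (part_from a 0 A) + mu (part_from b 0 A))%E.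
Proof.
move=> mA Arays; apply/eqP; rewrite eq_le; apply/andP; split.
  apply: ge_ereal_sup => _ [delta /= d0 <-].
  apply: (@le_trans _ _ (hausdorff1_pre delta ((fun s => s *: a) @` (part_from a 0 A) `|`
       (fun s => s *: b) @` (part_from b 0 A)))).
    apply: hausdorff1_pre_le => x Ax.
    by case: (Arays _ Ax) => -[s /= s0 sx]; [left|right]; exists s => //; rewrite /part_from/= sx.
  apply: (le_trans (hausdorff1_preU _ _ (ltW d0))).
  by apply: leeD; exact: hausdorff1_pre_ray_le.
(* Continuity from below with eta = 1/(n+1): the increasing union misses at most the parameter 0 of
   [part_from c 0 A], a null set. *)
have part_cvg c : mu (part_from c n.+1%:R^-1 A) @[n --> \oo] --> mu (part_from c 0 A).
  have -> : mu (part_from c 0 A) = mu (\bigcup_n part_from c n.+1%:R^-1 A).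
    apply/eqP; rewrite eq_le; apply/andP; split; last first.
      apply: lebesgue_outer_le => s [n _ [ns As]]; split => //.
      by apply: le_trans ns; rewrite invr_ge0.
    apply: (@le_trans _ _ (mu ([set 0] `|` \bigcup_n part_from c n.+1%:R^-1 A))).
      apply: lebesgue_outer_le => s [+ As]; rewrite le_eqVlt => /predU1P[<-|s0]; first by left.
      right; have [n _ ns] := near_infty_natSinv_lt (PosNum s0).
      exists n => //; split => //; apply/ltW; exact: ns (leqnn n).
    apply: le_trans (measureU2 _ _ _) _; first exact: measurable_set1.
      apply: bigcupT_measurable => n; exact: part_from_measurable.
    by move: (lebesgue_measure_set1 (0 : R)) => /= ->; rewrite add0e.
  apply: nondecreasing_cvg_mu => [n||m n mn].
  - exact: part_from_measurable.
  - by apply: bigcupT_measurable => n; exact: part_from_measurable.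
  - apply/subsetPset => s [ms As]; split => //; apply: le_trans ms.
    by rewrite lef_pV2 ?posrE// ler_nat ltnS.
have := cvgeD (ge0_adde_def _ _) (part_cvg a) (part_cvg b).
rewrite !inE !measure_ge0 => /(_ _ isT isT) ab_cvg.
by apply: (cvge_to_le ab_cvg); apply: nearW => n; exact: hausdorff1_ge_part.
Qed.

Lemma integral_mrestr (D : set R) (mD : measurable D) (f : R -> \bar R) :
  measurable_fun [set: R] f -> (forall x, 0 <= f x)%E ->
  (\int[mrestr mu mD]_x f x = \int[mu]_(x in D) f x)%E.
Proof.
move=> mf f0; rewrite -(setUCr D).
rewrite (@ge0_integral_setU _ _ _ (mrestr mu mD) D (~` D))//; last 3 first.
- exact: measurableC.
- by rewrite setUCr.
- exact/disj_set2P/setICr.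
rewrite [X in (_ + X)%E](_ : _ = 0%E) ?adde0.
  apply: (eq_measure_integral mu) => A mA AD.
  by rewrite /= /mrestr setIidl.
transitivity (\int[(mzero : set (measurableTypeR R) -> \bar R)]_(x in ~` D) f x)%E;
  last exact: integral_measure_zero.
apply: eq_set_function_integral => A mA AD.
by rewrite /= /mrestr (_ : A `&` D = set0) ?measure0//; apply/disjoints_subset.
Qed.

Definition two_rays : set (R * R) :=
  (fun s => s *: a) @` [set s | 0 <= s] `|` (fun s => s *: b) @` [set s | 0 <= s].

(** [nu] is the sum of the images of Lebesgue measure on the half-line under the two arc length
    parametrizations. Through it, linearity, monotonicity and Young's inequality become available
    for integrals against [hausdorff1]. *)
Lemma hausdorff1_two_rays_measure : measurable two_rays ->
  exists nu : {measure set (R * R) -> \bar R},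
    (forall f : R * R -> \bar R,
      \int[hausdorff1]_(x in two_rays) f x = \int[nu]_(x in two_rays) f x)%E /\
    (forall f : R * R -> \bar R, measurable_fun two_rays f ->
      (forall x, two_rays x -> 0 <= f x)%E ->
      (\int[nu]_(x in two_rays) f x =
       \int[mu]_(s in `[0%R, +oo[) f (s *: a)%R +
       \int[mu]_(s in `[0%R, +oo[) f (s *: b)%R)%E).
Proof.
move=> mF.
have mray (c : R * R) : measurable_fun [set: measurableTypeR R] (fun s : measurableTypeR R => s *: c : R * R).
  have mM (k : R) : measurable_fun [set: R] (fun s : R => s * k).
    by apply: continuous_measurable_fun => z; apply: cvgM; [exact: cvg_id|exact: cvg_cst].
  exact: (measurable_fun_pair (mM c.1) (mM c.2)).
have m0 : measurable (`[0, +oo[ : set (measurableTypeR R)) by exact: measurable_itv.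
pose lam := mrestr mu m0.
unshelve epose (nu (c : R * R) :=
  pushforward lam (fun s : measurableTypeR R => s *: c : R * R) :
  {measure set (R * R) -> \bar R}); first exact: mray.
exists (measure_add (nu a) (nu b)); split => [f|f mf f0].
  apply: eq_set_function_integral => A mA AF.
  rewrite hausdorff1_two_rays//.
  transitivity (nu a A + nu b A)%E; last exact/esym/(measure_addE (nu a) (nu b)).
  congr (_ + _)%E; rewrite /nu /pushforward /= /lam /mrestr; congr mu;
  by apply/seteqP; split => s /=; rewrite /part_from/= in_itv/= andbT => -[].
rewrite ge0_integral_measure_add//.
have one c : (forall s, 0 <= s -> two_rays (s *: c)) ->
  (\int[nu c]_(x in two_rays) f x = \int[mu]_(s in `[0%R, +oo[) f (s *: c)%R)%E.
  move=> Fc; rewrite integral_mkcond ge0_integral_pushforward//; last 2 first.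
  - exact/(measurable_restrictT _ _).1.
  - by move=> x _; apply: erestrict_ge0.
  rewrite preimage_setT integral_mrestr//; last 2 first.
  - apply: (measurableT_comp (f := f \_ two_rays)); last exact: mray.
    exact/(measurable_restrictT _ _).1.
  - by move=> s; apply: erestrict_ge0.
  apply: eq_integral => s; rewrite inE/= in_itv/= andbT => s0.
  by rewrite patchE mem_set//; exact: Fc.
by congr (_ + _)%E; apply: one => s s0; [left|right]; exists s.
Qed.

End TwoRays.

(** * Completing the square on cones *)

Section HalfLine.
Context {R : realType}.
Local Notation mu := (@lebesgue_measure R).

(** This brings the integrals to a compact interval, where the fundamental theorem of calculus
    applies. *)
Lemma ge0_integral_halfline_support (g : R -> R) (M : R) : 0 < M ->
  continuous g -> (forall t, 0 <= g t) -> (forall t, M <= t -> g t = 0) ->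
  (\int[mu]_(t in `]0%R, +oo[) (g t)%:E = \int[mu]_(t in `[0%R, M]) (g t)%:E)%E.
Proof.
move=> M0 cg g0 gM; rewrite integral_itv_obnd_cbnd; last first.
  by apply/measurable_EFinP; apply: measurable_funTS; exact: continuous_measurable_fun.
rewrite (_ : `[0%R, M]%classic = `[0%R, +oo[ `&` `]-oo, M]); last first.
  by apply/seteqP; split => t /=; rewrite !in_itv/= ?andbT; [move=> /andP[]|move=> [-> ->]].
rewrite integral_mkcondr; apply: eq_integral => t _.
rewrite patchE; case: ifPn => //; rewrite notin_setE/= in_itv/= => /negP.
by rewrite -ltNge => /ltW Mt; rewrite gM.
Qed.

(** The cross term 2 c f f' of the square is the derivative of c f^2, whose increment over [[0, M]]
    is - c f(0)^2. *)
Lemma halfline_square_identity (f f' : R -> R) (c M : R) : 0 < M ->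
  (forall t, is_derive t (1 : R) f (f' t)) -> continuous f' ->
  (forall t, M <= t -> f t = 0 /\ f' t = 0) ->
  (\int[mu]_(t in `]0%R, +oo[) ((f' t) ^+ 2 + c ^+ 2 * (f t) ^+ 2)%:E =
   (c * (f 0) ^+ 2)%:E + \int[mu]_(t in `]0%R, +oo[) ((f' t + c * f t) ^+ 2)%:E)%E.
Proof.
move=> M0 df cf' fM.
have cf : continuous f.
  by move=> t; apply: differentiable_continuous; apply/derivable1_diffP; case: (df t).
pose A t := (f' t) ^+ 2 + c ^+ 2 * (f t) ^+ 2.
pose B t := c * (2 * f t * f' t).
have csq (h : R -> R) : continuous h -> continuous (fun t => (h t) ^+ 2).
  by move=> ch t; exact: (cvgM (ch t) (ch t)).
have cA : continuous A.
  move=> t; apply: cvgD; first exact: csq.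
  by apply: cvgM; [exact: cvg_cst|exact: csq].
have cB : continuous B.
  move=> t; apply: cvgM; first exact: cvg_cst.
  by apply: cvgM; [apply: cvgM; [exact: cvg_cst|exact: cf]|exact: cf'].
have cfc : continuous (fun t => f' t + c * f t).
  move=> t; apply: cvgD; first exact: cf'.
  by apply: cvgM; [exact: cvg_cst|exact: cf].
have ABE t : (f' t + c * f t) ^+ 2 = A t + B t by rewrite /A /B; ring.
rewrite !(@ge0_integral_halfline_support _ M)//; last first.
- by move=> t /fM[-> ->]; rewrite expr0n mulr0 addr0.
- by move=> t; apply: addr_ge0; [exact: sqr_ge0|apply: mulr_ge0; exact: sqr_ge0].
- by move=> t /fM[-> ->]; rewrite mulr0 addr0 expr0n.
- by move=> t; exact: sqr_ge0.
- exact: csq.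
have intC (h : R -> R) : continuous h -> mu.-integrable `[0%R, M] (EFin \o h).
  move=> ch; apply: continuous_compact_integrable; first exact: segment_compact.
  exact: continuous_subspaceT.
have -> : (\int[mu]_(t in `[0%R, M]) ((f' t + c * f t) ^+ 2)%:E =
    \int[mu]_(t in `[0%R, M]) (A t)%:E + \int[mu]_(t in `[0%R, M]) (B t)%:E)%E.
  under eq_integral do rewrite ABE EFinD.
  by rewrite integralD//; [exact: intC cA|exact: intC cB].
have dF t : is_derive t (1 : R) (fun t => c * f t ^+ 2) (B t).
  have dft := df t.
  apply: is_derive_eq.
  by rewrite /B /GRing.scale /=; ring.
have -> : (\int[mu]_(t in `[0%R, M]) (B t)%:E = (c * f M ^+ 2)%:E - (c * f 0 ^+ 2)%:E)%E.
  apply: (@continuous_FTC2 _ B (fun t => c * f t ^+ 2)) => //.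
  - exact: continuous_subspaceT.
  - have cF : continuous (fun t => c * f t ^+ 2).
      by move=> t; apply: cvgM; [exact: cvg_cst|exact: csq].
    split; first by move=> t _; case: (dF t).
      by apply: cvg_at_right_filter; exact: cF.
    by apply: cvg_at_left_filter; exact: cF.
  - by move=> t _; rewrite derive1E; case: (dF t).
have [-> _] := fM M (lexx M).
(* Finiteness turns the remaining cancellation in the extended reals into one between real
   numbers. *)
have finA : (\int[mu]_(t in `[0%R, M]) (A t)%:E \is a fin_num)%E.
  by apply: integrable_fin_num => //; exact: intC.
rewrite -/A -(fineK finA) -!EFinB -!EFinD; congr EFin; ring.
Qed.

End HalfLine.

Section TestFunctions.
Context {R : realType}.
Implicit Types (phi : R * R -> R) (x e p q : R * R).

Lemma test_differentiable D phi x : test_function D phi -> differentiable phi x.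
Proof. by move=> [sphi _]; exact: (sphi [::] x I). Qed.

Lemma test_derive_differentiable D phi e x :
  test_function D phi -> differentiable ('D_e phi) x.
Proof. by move=> [sphi _]; exact: (sphi [:: e] x I). Qed.

Lemma test_continuous D phi : test_function D phi -> continuous phi.
Proof. by move=> tphi x; apply: differentiable_continuous; exact: test_differentiable tphi. Qed.

Lemma test_derive_continuous D phi e : test_function D phi -> continuous ('D_e phi).
Proof.
by move=> tphi x; apply: differentiable_continuous; exact: test_derive_differentiable tphi.
Qed.

Lemma derive_near0 phi e x : (\forall y \near x, phi y = 0) -> 'D_e phi x = 0.
Proof.
move=> phi0; rewrite (_ : 'D_e phi x = 'D_e (cst 0 : R * R -> R) x).
  by rewrite derive_cst.
by apply: near_eq_derive => //; near do rewrite (near phi0 _).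
Unshelve. all: by end_near. Qed.

Lemma test_support D phi : test_function D phi ->
  exists K : set (R * R), [/\ compact K, K `<=` D &
    forall x, ~ K x -> phi x = 0 /\ forall e, 'D_e phi x = 0].
Proof.
move=> [_ [K [cK KD K0]]]; exists K; split => // x Kx; split; first exact: K0.
move=> e; apply: derive_near0.
have oK : open (~` K) by apply: closed_openC; apply: compact_closed => //; exact: norm_hausdorff.
by apply: filterS (open_nbhs_nbhs (conj oK Kx)) => y; exact: K0.
Qed.

Lemma test_bound D phi : test_function D phi ->
  exists2 M : R, 0 < M & forall x, M <= `|x.1| \/ M <= `|x.2| ->
    phi x = 0 /\ forall e, 'D_e phi x = 0.
Proof.
move=> /test_support[K [/compact_bounded [M [Mreal MK]] _ K0]].
exists (`|M| + 1); first by rewrite ltr_wpDl.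
move=> x xM; apply: K0 => Kx.
have MM : M < `|M| + 2^-1 by rewrite (le_lt_trans (ler_norm _))// ltrDl invr_gt0.
have := MK _ MM _ Kx; rewrite /= prod_normE ge_max => /andP[x1 x2].
by case: xM; lra.
Qed.

Lemma fst_comb (s t : R) p q : (s *: p + t *: q).1 = s * p.1 + t * q.1.
Proof. by []. Qed.

Lemma snd_comb (s t : R) p q : (s *: p + t *: q).2 = s * p.2 + t * q.2.
Proof. by []. Qed.

Lemma is_derive_along phi p q (s t : R) : differentiable phi (s *: p + t *: q) ->
  is_derive t (1 : R) (fun t => phi (s *: p + t *: q)) ('D_q phi (s *: p + t *: q)).
Proof.
move=> dphi; have dq := @diff_derivable _ _ _ phi (s *: p + t *: q) q dphi.
have E : (fun h : R => h^-1 *: (phi (s *: p + (h *: (1 : R) + t) *: q) - phi (s *: p + t *: q))) =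
   (fun h : R => h^-1 *: (phi (h *: q + (s *: p + t *: q)) - phi (s *: p + t *: q))).
  apply/funext => h; congr (_ *: (phi _ - _)).
  by rewrite scalerDl addrCA -[h *: (1 : R)]/(h * 1) mulr1.
split; first by rewrite /derivable; move: dq; rewrite /derivable /= -E.
by rewrite /derive; under eq_fun do rewrite /= ; rewrite -E.
Qed.

Lemma derive_combination phi x e : differentiable phi x ->
  'D_e phi x = e.1 * partial1 phi x + e.2 * partial2 phi x.
Proof.
move=> dphi; rewrite /partial1 /partial2 !deriveE//.
rewrite {1}(_ : e = e.1 *: (1, 0) + e.2 *: (0, 1)).
  by rewrite linearD !linearZ.
by rewrite [RHS]surjective_pairing fst_comb snd_comb /= !mulr1 !mulr0 addr0 add0r -surjective_pairing.
Qed.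

(** [sigma] is the cross product of p and q; its square is 1 by Lagrange's identity (p x q)^2 =
    |p|^2 |q|^2 - (p.q)^2. *)
Lemma orthonormal_perp p q : dot p p = 1 -> dot q q = 1 -> dot p q = 0 ->
  exists2 sigma : R, sigma ^+ 2 = 1 & q = (- sigma * p.2, sigma * p.1).
Proof.
case: p q => [p1 p2] [q1 q2]; rewrite /dot/= => pp qq pq.
exists (p1 * q2 - p2 * q1).
  transitivity ((p1 * p1 + p2 * p2) * (q1 * q1 + q2 * q2) - (p1 * q1 + p2 * q2) ^+ 2); first ring.
  by rewrite pp qq pq; ring.
congr pair.
  transitivity (q1 * (p1 * p1 + p2 * p2) - p1 * (p1 * q1 + p2 * q2)); last ring.
  by rewrite pp pq; ring.
transitivity (q2 * (p1 * p1 + p2 * p2) - p2 * (p1 * q1 + p2 * q2)); last ring.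
by rewrite pp pq; ring.
Qed.

Lemma gradient_sqr_orthonormal phi x p q : differentiable phi x ->
  dot p p = 1 -> dot q q = 1 -> dot p q = 0 ->
  ('D_p phi x) ^+ 2 + ('D_q phi x) ^+ 2 = (partial1 phi x) ^+ 2 + (partial2 phi x) ^+ 2.
Proof.
move=> dphi pp qq pq; have [g g2 ->] := orthonormal_perp pp qq pq.
rewrite !derive_combination//= .
set a := partial1 _ _; set b := partial2 _ _.
transitivity ((p.1 * a + p.2 * b) ^+ 2 + g ^+ 2 * (- p.2 * a + p.1 * b) ^+ 2); first ring.
rewrite g2 mul1r; transitivity (dot p p * (a ^+ 2 + b ^+ 2)); first by rewrite /dot; ring.
by rewrite pp mul1r.
Qed.

End TestFunctions.

Section Cones.
Context {R : realType}.
Implicit Types (J : set R).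
Local Notation mu := (@lebesgue_measure R).

(** The two quotients are the coordinates of x in the basis (p, q), by Cramer's rule. The set J is
    kept as a parameter so that two adjacent cones can be made disjoint, one with a closed and one
    with an open half-line. *)
Definition cone J (p q : R * R) : set (R * R) :=
  [set x | J (cross x q / cross p q) /\ 0 < cross p x / cross p q].

Lemma plane_linear_measurable (a b : R) :
  measurable_fun [set: R * R] (fun z : R * R => a * z.1 + b * z.2).
Proof.
apply: plane_continuous_measurable => z; apply: cvgD; apply: cvgM;
  [exact: cvg_cst|exact: cvg_fst|exact: cvg_cst|exact: cvg_snd].
Qed.

Lemma cone_measurable J (p q : R * R) : measurable J -> measurable (cone J p q).
Proof.
move=> mJ; pose u (x : R * R) := cross x q / cross p q.
pose v (x : R * R) := cross p x / cross p q.
have mu_ : measurable_fun [set: R * R] u.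
  rewrite (_ : u = fun z : R * R => (q.2 / cross p q) * z.1 + (- q.1 / cross p q) * z.2).
    exact: plane_linear_measurable.
  by apply/funext => z; rewrite /u {1}/cross; ring.
have mv_ : measurable_fun [set: R * R] v.
  rewrite (_ : v = fun z : R * R => (- p.2 / cross p q) * z.1 + (p.1 / cross p q) * z.2).
    exact: plane_linear_measurable.
  by apply/funext => z; rewrite /v {1}/cross; ring.
rewrite (_ : cone J p q = (setT `&` u @^-1` J) `&` (setT `&` v @^-1` `]0, +oo[)).
  by apply: measurableI; [exact: mu_|exact: mv_].
by apply/seteqP; split => x; rewrite /cone/= in_itv/= andbT; [move=> [? ?]|move=> [[_ ?] [_ ?]]].
Qed.

Lemma cone_comb J (p q : R * R) (s t : R) : cross p q != 0 ->
  cone J p q (s *: p + t *: q) <-> J s /\ 0 < t.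
Proof.
move=> d0; rewrite /cone/=.
have -> : cross (s *: p + t *: q) q = s * cross p q.
  by rewrite /cross fst_comb snd_comb; ring.
have -> : cross p (s *: p + t *: q) = t * cross p q.
  by rewrite /cross fst_comb snd_comb; ring.
by rewrite !mulfK.
Qed.

Lemma cross_decomposition (p q x : R * R) : cross p q != 0 ->
  x = (cross x q / cross p q) *: p + (cross p x / cross p q) *: q.
Proof.
move=> d0; rewrite [LHS]surjective_pairing [RHS]surjective_pairing fst_comb snd_comb.
by congr pair; move: d0; rewrite /cross => d0; field.
Qed.

Lemma coneP J (p q x : R * R) : cross p q != 0 ->
  cone J p q x <-> exists s t, [/\ J s, 0 < t & x = s *: p + t *: q].
Proof.
move=> d0; split => [[Js t0]|[s [t [Js t0 ->]]]]; last exact/cone_comb.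
by exists (cross x q / cross p q), (cross p x / cross p q); split => //; exact: cross_decomposition.
Qed.

Lemma ge0_integral_cone J (p q : R * R) (F : R * R -> \bar R) : cross p q != 0 ->
  measurable J -> measurable_fun [set: R * R] F -> (forall x, 0 <= F x)%E ->
  (\int[(mu \x mu)%E]_(x in cone J p q) F x =
   `|cross p q|%:E * \int[mu]_(s in J) \int[mu]_(t in `]0%R, +oo[) F (s *: p + t *: q)%R)%E.
Proof.
move=> d0 mJ mF F0; rewrite integral_mkcond (ge0_integral_linear_change d0); first last.
- by move=> x; apply: erestrict_ge0.
- apply/(measurable_restrictT _ _).1; first exact: cone_measurable.
  exact: measurable_funTS.
congr (_ * _)%E; rewrite [RHS]integral_mkcond; apply: eq_integral => s _.
rewrite [RHS]patchE; case: ifPn => [|]; rewrite ?inE ?notin_setE => Js.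
  rewrite [RHS]integral_mkcond; apply: eq_integral => t _.
  rewrite !patchE; apply: (congr1 (fun b : bool => if b then _ else _)).
  by apply/idP/idP; rewrite !inE /= in_itv/= andbT cone_comb// => -[].
rewrite integral0_eq// => t _; rewrite patchE memNset//.
by rewrite cone_comb// => -[].
Qed.

Lemma continuous_line (phi : R * R -> R) (p q : R * R) (s : R) :
  continuous phi -> continuous (fun t : R => phi (s *: p + t *: q)).
Proof.
move=> cphi t; apply: continuous_comp; last exact: cphi.
apply: cvgD; first exact: cvg_cst.
by apply: cvgZr_tmp; exact: cvg_id.
Qed.

Lemma plane_comb_measurable (F : R * R -> \bar R) (p q : R * R) :
  measurable_fun [set: R * R] F ->
  measurable_fun [set: R * R] (fun z : R * R => F (z.1 *: p + z.2 *: q)).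
Proof.
move=> mF.
have m := measurable_fun_pair (plane_linear_measurable p.1 q.1) (plane_linear_measurable p.2 q.2).
apply: (eq_measurable_fun _ _ (measurableT_comp mF m)) => z _ /=; congr F.
by rewrite [RHS]surjective_pairing fst_comb snd_comb ![_ * z.1]mulrC ![_ * z.2]mulrC.
Qed.

Lemma cone_fiber_measurable (F : R * R -> \bar R) (p q : R * R) :
  measurable_fun [set: R * R] F -> (forall x, 0 <= F x)%E ->
  measurable_fun [set: R] (fun s => \int[mu]_(t in `]0%R, +oo[) F (s *: p + t *: q)%R)%E.
Proof.
move=> mF F0; pose E : set (R * R) := setT `*` `]0%R, +oo[.
pose G := (fun z : R * R => F (z.1 *: p + z.2 *: q)) \_ E.
have mG : measurable_fun [set: R * R] G.
  apply/(measurable_restrictT _ _).1; first by apply: measurableX.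
  by apply: measurable_funTS; exact: plane_comb_measurable.
have G0 z : (0 <= G z)%E by apply: erestrict_ge0.
have := @tonelli_measurable1 _ (fun s t => G (s, t)).
have -> : (fun z : R * R => G (z.1, z.2)) = G by apply/funext => -[].
move=> /(_ mG (fun s t => G0 _)); apply: eq_measurable_fun => s _.
rewrite [RHS]integral_mkcond; apply: eq_integral => t _; rewrite /G !patchE.
by apply: (congr1 (fun b : bool => if b then _ else _)); apply/idP/idP; rewrite !inE => -[].
Qed.

(* On each half-line parallel to q, the identity is the one-dimensional one,
   where the boundary term comes from integrating the derivative of phi^2. *)
Lemma cone_identity (D : set (R * R)) (phi : R * R -> R) J (p q q' : R * R) (c : R) :
  test_function D phi -> measurable J -> cross p q != 0 ->
  dot q q = 1 -> dot q' q' = 1 -> dot q q' = 0 -> c = `|cross p q|^-1 ->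
  (\int[(mu \x mu)%E]_(x in cone J p q)
      ((partial1 phi x) ^+ 2 + (partial2 phi x) ^+ 2 + c ^+ 2 * (phi x) ^+ 2)%:E =
   \int[mu]_(s in J) ((phi (s *: p)) ^+ 2)%:E +
   \int[(mu \x mu)%E]_(x in cone J p q)
      (('D_q phi x + c * phi x) ^+ 2 + ('D_q' phi x) ^+ 2)%:E)%E.
Proof.
move=> tphi mJ d0 qq qq' q0 cE.
have mcone : measurable (cone J p q) by exact: cone_measurable.
have cphi := test_continuous tphi.
have csq (h : R * R -> R) : continuous h -> continuous (fun x => (h x) ^+ 2).
  by move=> ch x; exact: (cvgM (ch x) (ch x)).
have meas (h : R * R -> R) : continuous h -> measurable_fun [set: R * R] (fun x => (h x)%:E).
  by move=> ch; apply/measurable_EFinP; exact: plane_continuous_measurable.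
pose Dq : R * R -> R := 'D_q phi.
pose Dq' : R * R -> R := 'D_q' phi.
have cDq : continuous Dq by exact: test_derive_continuous tphi.
have cDq' : continuous Dq' by exact: test_derive_continuous tphi.
pose A (x : R * R) : R := (Dq x) ^+ 2 + c ^+ 2 * (phi x) ^+ 2.
pose B (x : R * R) : R := (Dq x + c * phi x) ^+ 2.
pose C (x : R * R) : R := (Dq' x) ^+ 2.
have cA : continuous A.
  move=> x; apply: cvgD; first exact: csq.
  by apply: cvgM; [exact: cvg_cst|exact: csq].
have cB : continuous B.
  apply: csq => x; apply: cvgD; first exact: cDq.
  by apply: cvgM; [exact: cvg_cst|exact: cphi].
have cC : continuous C by exact: csq.
have A0 x : 0 <= A x by apply: addr_ge0; [exact: sqr_ge0|apply: mulr_ge0; exact: sqr_ge0].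
have B0 x : 0 <= B x by exact: sqr_ge0.
have C0 x : 0 <= C x by exact: sqr_ge0.
have -> : (\int[(mu \x mu)%E]_(x in cone J p q)
   ((partial1 phi x) ^+ 2 + (partial2 phi x) ^+ 2 + c ^+ 2 * (phi x) ^+ 2)%:E =
   \int[(mu \x mu)%E]_(x in cone J p q) (A x)%:E +
   \int[(mu \x mu)%E]_(x in cone J p q) (C x)%:E)%E.
  rewrite -ge0_integralD//; first last.
  - by apply: measurable_funTS; exact: meas.
  - by move=> x _; rewrite lee_fin.
  - by apply: measurable_funTS; exact: meas.
  - by move=> x _; rewrite lee_fin.
  apply: eq_integral => x _; rewrite -EFinD; congr EFin.
  rewrite -(gradient_sqr_orthonormal (test_differentiable x tphi) qq qq' q0) /A /C /Dq /Dq'.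
  by rewrite addrAC.
have -> : (\int[(mu \x mu)%E]_(x in cone J p q)
   (('D_q phi x + c * phi x) ^+ 2 + ('D_q' phi x) ^+ 2)%:E =
   \int[(mu \x mu)%E]_(x in cone J p q) (B x)%:E +
   \int[(mu \x mu)%E]_(x in cone J p q) (C x)%:E)%E.
  rewrite -ge0_integralD//.
  - by move=> x _; rewrite lee_fin.
  - by apply: measurable_funTS; exact: meas.
  - by move=> x _; rewrite lee_fin.
  - by apply: measurable_funTS; exact: meas.
rewrite addeA; congr (_ + _)%E.
rewrite !ge0_integral_cone//; first last.
- exact: meas.
- exact: meas.
have q_n0 : q != 0.
  by apply: contra_eq_neq qq => ->; rewrite /dot/= !mulr0 addr0 eq_sym oner_neq0.
have inner s : (\int[mu]_(t in `]0%R, +oo[) (A (s *: p + t *: q))%:E =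
   (c * (phi (s *: p)) ^+ 2)%:E + \int[mu]_(t in `]0%R, +oo[) (B (s *: p + t *: q))%:E)%E.
  have [M M0 phiM] := test_bound tphi.
  (* Some coordinate of q has absolute value at least m > 0. For t >= N / m the same coordinate of s
     p + t q has absolute value at least M, hence the point is outside the support of [phi]. *)
  pose N := M + `|s * p.1| + `|s * p.2|.
  have N0 : 0 < N by rewrite /N; have := normr_ge0 (s * p.1); have := normr_ge0 (s * p.2); lra.
  have qm : exists2 m : R, 0 < m & m <= `|q.1| \/ m <= `|q.2|.
    have [q10|q10] := eqVneq q.1 0; last by exists `|q.1|; [rewrite normr_gt0|left].
    exists `|q.2|; last by right.
    rewrite normr_gt0; apply: contra_neq q_n0 => q20.
    by rewrite [q]surjective_pairing q10 q20.
  have [m m0 mq] := qm.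
  have := @halfline_square_identity _ (fun t => phi (s *: p + t *: q))
    (fun t => Dq (s *: p + t *: q)) c (N / m) (divr_gt0 N0 m0).
  rewrite scale0r addr0; apply.
  - by move=> t; apply: is_derive_along; exact: test_differentiable tphi.
  - exact: (@continuous_line Dq).
  - move=> t; rewrite ler_pdivrMr// => Nt.
    have t0 : 0 < t by rewrite -(pmulr_lgt0 _ m0) (lt_le_trans N0).
    have big (u w : R) : m <= `|w| -> M + `|u| <= N -> M <= `|u + t * w|.
      move=> mw uN; have : t * m <= `|t * w| by rewrite normrM gtr0_norm// ler_wpM2l// ltW.
      have : `|t * w| <= `|u + t * w| + `|u|.
        by rewrite -{1}[t * w](addKr u) (le_trans (ler_normD _ _))// normrN addrC.
      lra.
    have [-> Dphi0] : phi (s *: p + t *: q) = 0 /\ forall e, 'D_e phi (s *: p + t *: q) = 0.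
      apply: phiM; rewrite fst_comb snd_comb.
      have := normr_ge0 (s * p.1); have := normr_ge0 (s * p.2).
      by case: mq => mq ? ?; [left|right]; apply: big => //; rewrite /N; lra.
    by rewrite /Dq Dphi0.
have c_ge0 : 0 <= c by rewrite cE invr_ge0.
have mp : measurable_fun [set: R] (fun s : R => ((phi (s *: p)) ^+ 2)%:E).
  apply/measurable_EFinP; apply: continuous_measurable_fun => s.
  have := @continuous_line _ p p 0 (csq _ cphi) s.
  by under eq_fun do rewrite scale0r add0r.
rewrite (_ : (\int[mu]_(s in J) _)%E = (c%:E * \int[mu]_(s in J) ((phi (s *: p)) ^+ 2)%:E +
   \int[mu]_(s in J) \int[mu]_(t in `]0%R, +oo[) (B (s *: p + t *: q))%:E)%E).
  rewrite ge0_muleDr; first last.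
  - by apply: integral_ge0 => s _; apply: integral_ge0 => t _; rewrite lee_fin.
  - by rewrite mule_ge0// integral_ge0// => s _; rewrite lee_fin sqr_ge0.
  (* Here the choice of c enters: the Jacobian |p x q| of the oblique coordinates cancels the factor
     c of the boundary term. *)
  by rewrite muleA -EFinM cE mulfV ?normr_eq0// mul1e.
rewrite -ge0_integralZl//; first last.
- by move=> s _; rewrite lee_fin sqr_ge0.
- exact: measurable_funTS.
rewrite -ge0_integralD//.
- by apply: eq_integral => s _; rewrite inner EFinM.
- by move=> s _; rewrite mule_ge0// lee_fin sqr_ge0.
- by apply: measurable_funeM; exact: measurable_funTS.
- by move=> s _; apply: integral_ge0 => t _; rewrite lee_fin.
- apply: measurable_funTS; apply: (@cone_fiber_measurable (EFin \o B)) => [|x]; first exact: meas.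
  by rewrite lee_fin.
Qed.

End Cones.

(** * Geometry of angles *)

Section Frames.
Context {R : realType}.
Implicit Types (x e p q : R * R).

Definition orthonormal (e1 e2 : R * R) := [/\ dot e1 e1 = 1, dot e2 e2 = 1 & dot e1 e2 = 0].

Definition enorm x : R := Num.sqrt (dot x x).

Lemma dotC p q : dot p q = dot q p. Proof. by rewrite /dot mulrC [p.2 * _]mulrC. Qed.

Lemma dot_combl (u v : R) p q x : dot (u *: p + v *: q) x = u * dot p x + v * dot q x.
Proof. by rewrite /dot fst_comb snd_comb; ring. Qed.

Lemma dot_ge0 x : 0 <= dot x x.
Proof. by rewrite /dot -!expr2 addr_ge0 ?sqr_ge0. Qed.

Lemma enorm_ge0 x : 0 <= enorm x. Proof. exact: sqrtr_ge0. Qed.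

Lemma enorm_sqr x : enorm x ^+ 2 = dot x x.
Proof. by rewrite sqr_sqrtr// dot_ge0. Qed.

Lemma cross_combination (u v u' v' : R) p q :
  cross (u *: p + v *: q) (u' *: p + v' *: q) = (u * v' - v * u') * cross p q.
Proof. by rewrite /cross !fst_comb !snd_comb; ring. Qed.

Lemma orthonormal_cross e1 e2 : orthonormal e1 e2 -> `|cross e1 e2| = 1.
Proof.
case=> e11 e22 e12; apply/eqP; rewrite -(@pexpr_eq1 _ _ 2)// -normrX ger0_norm ?sqr_ge0//.
have -> : cross e1 e2 ^+ 2 = dot e1 e1 * dot e2 e2 - dot e1 e2 ^+ 2.
  by rewrite /cross /dot; ring.
by rewrite e11 e22 e12 mulr1 expr0n subr0.
Qed.

Lemma orthonormal_decomposition e1 e2 x : orthonormal e1 e2 ->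
  x = dot x e1 *: e1 + dot x e2 *: e2.
Proof.
move=> oe; have [e11 e22 e12] := oe.
have d0 : cross e1 e2 != 0 by rewrite -normr_eq0 orthonormal_cross// oner_neq0.
have [u [v ->]] : exists u v, x = u *: e1 + v *: e2.
  by exists (cross x e2 / cross e1 e2), (cross e1 x / cross e1 e2); exact: cross_decomposition.
by rewrite !dot_combl e11 e22 e12 [dot e2 e1]dotC e12 !mulr1 !mulr0 addr0 add0r.
Qed.

Lemma orthonormal_dotE e1 e2 x : orthonormal e1 e2 ->
  dot x x = dot x e1 ^+ 2 + dot x e2 ^+ 2.
Proof.
move=> oe; have [e11 e22 e12] := oe.
rewrite {2}(orthonormal_decomposition x oe) dotC dot_combl.
by rewrite [dot e1 x]dotC [dot e2 x]dotC -!expr2.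
Qed.

Lemma dot_combE e1 e2 (u v : R) : orthonormal e1 e2 ->
  dot (u *: e1 + v *: e2) e1 = u /\ dot (u *: e1 + v *: e2) e2 = v.
Proof.
by case=> e11 e22 e12; rewrite !dot_combl e11 e22 e12 [dot e2 e1]dotC e12; split; ring.
Qed.

Lemma continuous_dot e : continuous (fun x => dot x e).
Proof.
move=> x; apply: cvgD; apply: cvgM; [exact: cvg_fst|exact: cvg_cst|exact: cvg_snd|exact: cvg_cst].
Qed.

Lemma continuous_enorm : continuous enorm.
Proof.
move=> x; apply: continuous_comp; last exact: sqrt_continuous.
by apply: cvgD; apply: cvgM; [exact: cvg_fst|exact: cvg_fst|exact: cvg_snd|exact: cvg_snd].
Qed.

Lemma abs_dot_le_enorm e1 e2 x : orthonormal e1 e2 -> `|dot x e1| <= enorm x.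
Proof.
move=> oe; rewrite -sqrtr_sqr ler_sqrt ?dot_ge0//.
by rewrite (orthonormal_dotE x oe) lerDl sqr_ge0.
Qed.

Lemma enorm_shift e1 e2 x (eps : R) : orthonormal e1 e2 -> 0 < eps ->
  `|enorm (x + eps *: e1) - enorm x| <= eps.
Proof.
move=> oe eps0; have [e11 e22 e12] := oe.
have := abs_dot_le_enorm x oe; rewrite ler_norml => /andP[X1 X2].
have N0 := enorm_ge0 x; have N0' := enorm_ge0 (x + eps *: e1).
have E : enorm (x + eps *: e1) ^+ 2 = enorm x ^+ 2 + 2 * eps * dot x e1 + eps ^+ 2.
  rewrite !enorm_sqr; transitivity (dot x x + 2 * eps * dot x e1 + eps ^+ 2 * dot e1 e1).
    by rewrite -{1 2}[x]scale1r /dot !fst_comb !snd_comb; ring.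
  by rewrite e11 mulr1.
rewrite ler_norml; apply/andP; split.
  rewrite lerBrDr addrC; have [Ne|Ne] := leP (enorm x) eps; first lra.
  rewrite -(@ler_pXn2r _ 2) ?nnegrE//; last lra.
  have : eps * - enorm x <= eps * dot x e1 by rewrite ler_wpM2l// ltW.
  rewrite E; lra.
rewrite lerBlDr -(@ler_pXn2r _ 2) ?nnegrE//; last lra.
have : eps * dot x e1 <= eps * enorm x by rewrite ler_wpM2l// ltW.
rewrite E; lra.
Qed.

End Frames.

Section AngleGeometry.
Context {R : realType}.
Implicit Types (x e p q : R * R).

(** Cosine is decreasing on [0, pi], so |theta| < alpha becomes one inequality between cosines, for
    acute and obtuse alpha alike. Being strict, it excludes the vertex. Conversely theta is acos (x
    / r) with the sign of y. *)
Lemma angleP (alpha : R) (z : R * R) : 0 < alpha -> alpha < pi ->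
  angle alpha z <-> cos alpha * Num.sqrt (z.1 ^+ 2 + z.2 ^+ 2) < z.1.
Proof.
move=> a0 api; have aI : alpha \in `[0, pi] by rewrite in_itv/= !ltW.
split.
  move=> [r [theta [r0 _ ta ->]]] /=.
  have -> : (r * cos theta) ^+ 2 + (r * sin theta) ^+ 2 = r ^+ 2.
    by rewrite !exprMn -mulrDr cos2Dsin2 mulr1.
  rewrite sqrtr_sqr gtr0_norm// mulrC ltr_pM2l// -[cos theta]cos_norm ltr_cos//.
  by rewrite in_itv/= normr_ge0/=; apply/ltW/(lt_trans ta).
case: z => x y /=; set r := Num.sqrt _ => rx.
have r2 : r ^+ 2 = x ^+ 2 + y ^+ 2 by rewrite sqr_sqrtr// addr_ge0 ?sqr_ge0.
have r0 : 0 < r.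
  rewrite lt0r sqrtr_ge0 andbT; apply/eqP => r0; move: rx r2; rewrite r0 mulr0 expr0n/=.
  move=> x0 /esym/eqP; rewrite paddr_eq0 ?sqr_ge0// => /andP[].
  by rewrite sqrf_eq0 => /eqP xx; rewrite xx ltxx in x0.
have u1 : -1 <= x / r <= 1.
  rewrite -ler_norml normrM normfV (gtr0_norm r0) ler_pdivrMr// mul1r.
  by rewrite -sqrtr_sqr ler_sqrt ?addr_ge0 ?sqr_ge0// lerDl sqr_ge0.
clearbody r.
have uI : x / r \in `[-1, 1] by rewrite in_itv.
have tpi : acos (x / r) \in `[0, pi] by rewrite in_itv/= acos_ge0//= acos_lepi.
have ta : acos (x / r) < alpha by rewrite -ltr_cos// acosK// ltr_pdivlMr.
have s_acos : r * sin (acos (x / r)) = `|y|.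
  rewrite sin_acos// -[RHS]sqrtr_sqr -[LHS]ger0_norm ?mulr_ge0 ?sqrtr_ge0 ?(ltW r0)//.
  rewrite -sqrtr_sqr exprMn sqr_sqrtr; last first.
    by rewrite subr_ge0 -[leRHS](expr1n _ 2) -ler_sqrt ?sqr_ge0// !sqrtr_sqr normr1 ler_norml.
  congr Num.sqrt; rewrite mulrBr mulr1 {1}r2.
  by rewrite expr_div_n mulrCA mulfV ?mulr1 ?sqrf_eq0 ?gt_eqF//; ring.
have xE : x = r * cos (acos (x / r)) by rewrite acosK// mulrCA mulfV ?mulr1// gt_eqF.
have t0 : 0 <= acos (x / r) by rewrite acos_ge0.
have [y0|y0] := leP 0 y.
  exists r, (acos (x / r)); split => //.
  - by apply/andP; split; [rewrite (lt_le_trans _ t0)// oppr_lt0 pi_gt0|rewrite acos_lepi].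
  - by rewrite ger0_norm.
  - by rewrite -xE s_acos ger0_norm.
exists r, (- acos (x / r)); split => //.
- apply/andP; split; first by rewrite ltrN2 (lt_trans ta).
  by rewrite (@le_trans _ _ 0) ?oppr_le0// pi_ge0.
- by rewrite normrN ger0_norm.
- by rewrite cosN sinN -xE mulrN s_acos ltr0_norm// opprK.
Qed.

Lemma angle_in_coordinatesP (K : set (R * R)) (alpha : R) e1 e2 : 0 < alpha -> alpha < pi ->
  orthonormal e1 e2 -> K = [set x | angle alpha (dot x e1, dot x e2)] ->
  K = [set x | cos alpha * enorm x < dot x e1].
Proof.
move=> a0 api oe ->; apply/seteqP; split => x /=; rewrite angleP//=;
  by rewrite /enorm (orthonormal_dotE x oe).
Qed.

Lemma cos_abs_lt1 (alpha : R) : 0 < alpha -> alpha < pi -> `|cos alpha| < 1.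
Proof.
move=> a0 api; have s0 : 0 < sin alpha by apply: sin_gt0_pi; rewrite a0 api.
rewrite -(@ltr_pXn2r _ 2) ?nnegrE// expr1n -normrX ger0_norm ?sqr_ge0//.
by rewrite cos2sin2 ltrBlDr ltrDl exprn_gt0.
Qed.

(** The boundary is the level set x.e1 = cos alpha |x|. Such a point is a limit of points of the
    angle: moving it by m along e1 raises x.e1 by m but |x| by at most m, and |cos alpha| < 1. *)
Lemma frontier_angle (alpha : R) e1 e2 : 0 < alpha -> alpha < pi -> orthonormal e1 e2 ->
  open [set x | cos alpha * enorm x < dot x e1] /\
  frontier [set x | cos alpha * enorm x < dot x e1] =
    two_rays (cos alpha *: e1 + sin alpha *: e2) (cos alpha *: e1 - sin alpha *: e2).
Proof.
move=> a0 api oe; have [e11 e22 e12] := oe; set D := [set x | _].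
pose h x := dot x e1 - cos alpha * enorm x.
have ch : continuous h.
  move=> x; apply: cvgB; first exact: continuous_dot.
  by apply: cvgM; [exact: cvg_cst|exact: continuous_enorm].
have DE : D = h @^-1` `]0, +oo[.
  by apply/seteqP; split => x /=; rewrite in_itv/= andbT /h subr_gt0.
have oD : open D.
  rewrite DE; apply: open_comp; last exact: interval_open.
  by move=> x _; exact: ch.
split => //.
have s0 : 0 < sin alpha by apply: sin_gt0_pi; rewrite a0 api.
have c1 := cos_abs_lt1 a0 api.
rewrite /frontier (_ : D° = D); last exact/interior_id.
have frP x : (closure D `\` D) x <-> dot x e1 = cos alpha * enorm x.
  split.
    move=> [clx /negP]; rewrite -leNgt => Dx.
    apply/eqP; rewrite eq_le Dx/= -subr_ge0 -/(h x).
    have : closure D `<=` h @^-1` `[0, +oo[.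
      rewrite closureE; apply: smallest_sub.
        apply: preimage_closed; last exact: interval_closed.
        by move=> y _; exact: ch.
      by rewrite DE => y /=; rewrite !in_itv/= !andbT => /ltW.
    by move=> /(_ _ clx); rewrite /= in_itv/= andbT.
  move=> xE; split; last by rewrite /D/= xE ltxx.
  move=> B /nbhs_ballP[eps /= eps0 xB].
  (* Neighbourhoods are balls of the max norm, in which the unit vector e1 need not have length 1;
     hence the division by 1 + [|e1|]. *)
  pose m := eps / (1 + `|e1|) / 2.
  have m0 : 0 < m by rewrite !divr_gt0// ltr_pwDl.
  exists (x + m *: e1); split.
    rewrite /D/=; have := enorm_shift x oe m0.
    set N' := enorm (x + _); set N := enorm x => NN.
    have -> : dot (x + m *: e1) e1 = cos alpha * N + m.
      by rewrite -[x]scale1r dot_combl mul1r e11 mulr1 -xE.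
    rewrite -ltrBlDl -mulrBr (le_lt_trans (ler_norm _))// normrM.
    apply: (@le_lt_trans _ _ (`|cos alpha| * m)); first by rewrite ler_wpM2l.
    by rewrite gtr_pMl.
  apply: xB; rewrite -ball_normE /= opprD addNKr normrN normrZ gtr0_norm//.
  have n0 : 0 <= `|e1| by exact: normr_ge0.
  rewrite (_ : m * `|e1| = eps * (`|e1| / (2 * (1 + `|e1|)))).
    rewrite gtr_pMr// ltr_pdivrMr ?mulr_gt0//; lra.
  by rewrite /m; field; rewrite gt_eqF// ltr_pwDl.
apply/seteqP; split => x.
  move=> /frP xE; pose s := enorm x.
  have Y2 : dot x e2 ^+ 2 = (s * sin alpha) ^+ 2.
    have := orthonormal_dotE x oe; rewrite -enorm_sqr -/s xE -/s exprMn => sE.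
    by rewrite exprMn sin2cos2 mulrBr mulr1 {1}sE mulrC; ring.
  have /orP[/eqP Y|/eqP Y] : (dot x e2 == s * sin alpha) || (dot x e2 == - (s * sin alpha)).
    by rewrite -eqf_sqr Y2.
  - left; exists s; first exact: enorm_ge0.
    by rewrite [RHS](orthonormal_decomposition x oe) xE Y scalerDr !scalerA mulrC.
  - right; exists s; first exact: enorm_ge0.
    by rewrite [RHS](orthonormal_decomposition x oe) xE Y scalerBr !scalerA mulrC scaleNr.
have ray (sg : R) (s : R) : sg ^+ 2 = 1 -> 0 <= s ->
    dot (s *: (cos alpha *: e1 + (sg * sin alpha) *: e2)) e1 =
    cos alpha * enorm (s *: (cos alpha *: e1 + (sg * sin alpha) *: e2)).
  move=> sg1 s_ge0; rewrite scalerDr !scalerA.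
  have [d1 d2] := dot_combE (s * cos alpha) (s * (sg * sin alpha)) oe.
  rewrite /enorm (orthonormal_dotE _ oe) d1 d2.
  rewrite (_ : _ + _ = s ^+ 2); first by rewrite sqrtr_sqr ger0_norm// mulrC.
  by rewrite !exprMn sg1 mul1r -mulrDr cos2Dsin2 mulr1.
case=> -[s /= s_ge0 <-]; apply/frP.
  by have := ray 1 s (expr1n _ _) s_ge0; rewrite mul1r.
by have := ray (-1) s; rewrite mulN1r scaleNr sqrrN expr1n; apply.
Qed.

End AngleGeometry.

Section Wedge.
Context {R : realType}.
Implicit Types (x e p q : R * R).
Local Notation mu := (@lebesgue_measure R).

Definition wedge (alpha : R) e : set (R * R) := [set x | cos alpha * enorm x < dot x e].

Definition ray (alpha : R) (e1 e2 : R * R) := cos alpha *: e1 + sin alpha *: e2.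

Definition ray_neg (alpha : R) (e1 e2 : R * R) := cos alpha *: e1 - sin alpha *: e2.

Lemma ray_negE (alpha : R) e1 e2 : ray_neg alpha e1 e2 = cos alpha *: e1 + (- sin alpha) *: e2.
Proof. by rewrite /ray_neg scaleNr. Qed.

Lemma sqrt_lt_of_sqr (a b : R) : 0 <= b -> a ^+ 2 < b ^+ 2 -> a < b.
Proof.
move=> b0 ab; rewrite ltNge; apply/negP => ba; move: ab.
by rewrite ltNge => /negP; apply; rewrite ler_pXn2r ?nnegrE// (le_trans b0 ba).
Qed.

Lemma enorm_comb e1 e2 (u v : R) : orthonormal e1 e2 ->
  enorm (u *: e1 + v *: e2) = Num.sqrt (u ^+ 2 + v ^+ 2).
Proof.
by move=> oe; rewrite /enorm (orthonormal_dotE _ oe); have [-> ->] := dot_combE u v oe.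
Qed.

Lemma wedge_comb (alpha : R) e1 e2 (u v : R) : orthonormal e1 e2 ->
  wedge alpha e1 (u *: e1 + v *: e2) <-> cos alpha * Num.sqrt (u ^+ 2 + v ^+ 2) < u.
Proof.
by move=> oe; rewrite /wedge/= enorm_comb//; have [-> _] := dot_combE u v oe.
Qed.

Lemma comb_comb (u v s t s' t' : R) p q :
  u *: (s *: p + t *: q) + v *: (s' *: p + t' *: q) = (u * s + v * s') *: p + (u * t + v * t') *: q.
Proof. by rewrite !scalerDr !scalerA addrACA -!scalerDl. Qed.

Lemma unit_comb e1 e2 (u v : R) : orthonormal e1 e2 -> u ^+ 2 + v ^+ 2 = 1 ->
  dot (u *: e1 + v *: e2) (u *: e1 + v *: e2) = 1.
Proof.
by move=> oe uv; rewrite (orthonormal_dotE _ oe); have [-> ->] := dot_combE u v oe.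
Qed.

Lemma ray_unit (alpha : R) e1 e2 : orthonormal e1 e2 ->
  dot (ray alpha e1 e2) (ray alpha e1 e2) = 1.
Proof. by move=> oe; apply: unit_comb => //; exact: cos2Dsin2. Qed.

Lemma ray_neg_unit (alpha : R) e1 e2 : orthonormal e1 e2 ->
  dot (ray_neg alpha e1 e2) (ray_neg alpha e1 e2) = 1.
Proof. by move=> oe; rewrite ray_negE; apply: unit_comb => //; rewrite sqrrN cos2Dsin2. Qed.

(** The bisector cuts the angle into two halves, each spanned by a side and e1; the closed half-line
    assigns the bisector itself (s = 0) to the first. The cones lie in the angle because |s p + t
    e1| <= s + t and 0 <= cos alpha < 1, which give cos alpha |s p + t e1| < s cos alpha + t. *)
Lemma sharp_wedge_cones (alpha : R) e1 e2 : orthonormal e1 e2 -> 0 < sin alpha -> 0 <= cos alpha ->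
  [/\ wedge alpha e1 =
        cone `[0, +oo[ (ray alpha e1 e2) e1 `|` cone `]0, +oo[ (ray_neg alpha e1 e2) e1,
      cone `[0, +oo[ (ray alpha e1 e2) e1 `&` cone `]0, +oo[ (ray_neg alpha e1 e2) e1 = set0,
      `|cross (ray alpha e1 e2) e1| = sin alpha &
      `|cross (ray_neg alpha e1 e2) e1| = sin alpha].
Proof.
move=> oe s0 c0; have ce := orthonormal_cross oe.
have e1E : e1 = 1 *: e1 + 0 *: e2 by rewrite scale1r scale0r addr0.
have c1 : `|cross (ray alpha e1 e2) e1| = sin alpha.
  by rewrite /ray {2}e1E cross_combination mulr0 sub0r mulr1 normrM ce mulr1 normrN gtr0_norm.
have c2 : `|cross (ray_neg alpha e1 e2) e1| = sin alpha.
  by rewrite ray_negE {2}e1E cross_combination mulr0 sub0r mulr1 normrM ce mulr1 opprK gtr0_norm.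
have n1 : cross (ray alpha e1 e2) e1 != 0 by rewrite -normr_eq0 c1 gt_eqF.
have n2 : cross (ray_neg alpha e1 e2) e1 != 0 by rewrite -normr_eq0 c2 gt_eqF.
have comb1 s t : s *: ray alpha e1 e2 + t *: e1 = (s * cos alpha + t) *: e1 + (s * sin alpha) *: e2.
  by rewrite {2}e1E comb_comb mulr1 mulr0 addr0.
have comb2 s t : s *: ray_neg alpha e1 e2 + t *: e1 = (s * cos alpha + t) *: e1 + (- (s * sin alpha)) *: e2.
  by rewrite ray_negE {2}e1E comb_comb mulr1 mulr0 addr0 mulrN.
have ca1 : cos alpha < 1.
  rewrite lt_neqAle cos_le1 andbT; apply/eqP => c1'.
  by have := cos2Dsin2 alpha; rewrite c1' expr1n => /(canRL (addKr _))/eqP;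
    rewrite addNr sqrf_eq0 gt_eqF.
have inside (s t sg : R) : sg ^+ 2 = 1 -> 0 <= s -> 0 < t ->
    cos alpha * Num.sqrt ((s * cos alpha + t) ^+ 2 + (sg * (s * sin alpha)) ^+ 2) < s * cos alpha + t.
  move=> sg1 s_ge0 t0.
  have : Num.sqrt ((s * cos alpha + t) ^+ 2 + (sg * (s * sin alpha)) ^+ 2) <= s + t.
    have st0 : 0 <= s + t by rewrite addr_ge0// ltW.
    rewrite -[s + t]ger0_norm// -sqrtr_sqr ler_sqrt ?sqr_ge0//.
    rewrite !exprMn sg1 mul1r sin2cos2.
    have : s * t * cos alpha <= s * t * 1 by rewrite ler_wpM2l ?cos_le1// mulr_ge0// ltW.
    by rewrite !sqrrD; lra.
  move=> /(ler_wpM2l c0) h; apply: (le_lt_trans h); rewrite mulrDr mulrC ltrD2l.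
  by rewrite gtr_pMl.
split => //.
  apply/seteqP; split => x.
    rewrite (orthonormal_decomposition x oe); set X := dot x e1; set Y := dot x e2.
    rewrite wedge_comb// => XY.
    (* The e2 coordinate determines s; what remains along e1 is t = X - s cos alpha, positive
       precisely because the point is in the angle. *)
    pose s := `|Y| / sin alpha.
    have sY : s * sin alpha = `|Y| by rewrite /s divfK// gt_eqF.
    have s_ge0 : 0 <= s by rewrite /s divr_ge0// ltW.
    have X0 : 0 < X by apply: le_lt_trans XY; rewrite mulr_ge0// sqrtr_ge0.
    have t0 : 0 < X - s * cos alpha.
      rewrite subr_gt0; apply: sqrt_lt_of_sqr; first exact: ltW.
      have : (cos alpha * Num.sqrt (X ^+ 2 + Y ^+ 2)) ^+ 2 < X ^+ 2.
        by rewrite ltr_pXn2r ?nnegrE// ?(ltW X0)// mulr_ge0// sqrtr_ge0.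
      rewrite exprMn sqr_sqrtr ?addr_ge0 ?sqr_ge0// => h.
      have sY2 : s ^+ 2 * sin alpha ^+ 2 = Y ^+ 2 by rewrite -exprMn sY real_normK ?num_real.
      have s2 := exprn_gt0 2 s0.
      rewrite -(ltr_pM2r s2) exprMn [_ * cos alpha ^+ 2]mulrC -mulrA sY2.
      by move: h; rewrite sin2cos2; lra.
    have [Y0|Y0] := leP 0 Y.
      left; apply/coneP => //; exists s, (X - s * cos alpha); split => //; first by rewrite /= in_itv/= s_ge0.
      by rewrite comb1 sY ger0_norm// [_ + (X - _)]addrC subrK.
    right; apply/coneP => //; exists s, (X - s * cos alpha); split => //.
      by rewrite /= in_itv/= andbT /s divr_gt0// normr_gt0 lt_eqF.
    by rewrite comb2 sY ltr0_norm// opprK [_ + (X - _)]addrC subrK.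
  case => /coneP -/(_ _)[//|s [t [/= + t0 ->]]]; rewrite in_itv/= andbT => s_ge0.
    by rewrite comb1 wedge_comb//; have := @inside s t 1; rewrite mul1r expr1n; apply.
  rewrite comb2 wedge_comb//; have := @inside s t (-1); rewrite mulN1r sqrrN expr1n; apply => //.
  exact: ltW.
rewrite -subset0 => x [] /coneP -/(_ n1)[s [t [/= + t0 xE]]]; rewrite in_itv/= andbT => s_ge0.
move=> /coneP -/(_ n2)[s' [t' [/= + t0']]]; rewrite in_itv/= andbT => s_gt0.
rewrite xE comb1 comb2 => /(congr1 (dot^~ e2)).
have [_ ->] := dot_combE (s * cos alpha + t) (s * sin alpha) oe.
have [_ ->] := dot_combE (s' * cos alpha + t') (- (s' * sin alpha)) oe.
have : 0 <= s * sin alpha by rewrite mulr_ge0// ltW.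
have : 0 < s' * sin alpha by rewrite mulr_gt0.
lra.
Qed.

(** Here (p, q) is orthonormal and the cones are quarter-planes. They lie in the angle since s cos
    alpha + t sin alpha > s cos alpha >= cos alpha |x|, as cos alpha <= 0 and |x| >= s. The sign of
    the e2 coordinate separates them. *)
Lemma blunt_wedge_cones (alpha : R) e1 e2 (q1 := sin alpha *: e1 - cos alpha *: e2)
    (q2 := sin alpha *: e1 + cos alpha *: e2) :
  orthonormal e1 e2 -> 0 < sin alpha -> cos alpha <= 0 ->
  [/\ cone `[0, +oo[ (ray alpha e1 e2) q1 `|` cone `]0, +oo[ (ray_neg alpha e1 e2) q2
        `<=` wedge alpha e1,
      cone `[0, +oo[ (ray alpha e1 e2) q1 `&` cone `]0, +oo[ (ray_neg alpha e1 e2) q2 = set0,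
      `|cross (ray alpha e1 e2) q1| = 1 &
      `|cross (ray_neg alpha e1 e2) q2| = 1].
Proof.
move=> oe s0 c0; have ce := orthonormal_cross oe.
have q1E : q1 = sin alpha *: e1 + (- cos alpha) *: e2 by rewrite /q1 scaleNr.
have cs := cos2Dsin2 alpha.
have c1 : `|cross (ray alpha e1 e2) q1| = 1.
  rewrite /ray q1E cross_combination normrM ce mulr1 mulrN -opprD normrN -!expr2 cs normr1 //.
have c2 : `|cross (ray_neg alpha e1 e2) q2| = 1.
  by rewrite ray_negE /q2 cross_combination normrM ce mulr1 mulNr opprK -!expr2 cs normr1.
have n1 : cross (ray alpha e1 e2) q1 != 0 by rewrite -normr_eq0 c1 oner_neq0.
have n2 : cross (ray_neg alpha e1 e2) q2 != 0 by rewrite -normr_eq0 c2 oner_neq0.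
have comb1 s t : s *: ray alpha e1 e2 + t *: q1 =
    (s * cos alpha + t * sin alpha) *: e1 + (s * sin alpha - t * cos alpha) *: e2.
  by rewrite q1E comb_comb mulrN.
have comb2 s t : s *: ray_neg alpha e1 e2 + t *: q2 =
    (s * cos alpha + t * sin alpha) *: e1 + (- (s * sin alpha - t * cos alpha)) *: e2.
  by rewrite ray_negE /q2 comb_comb; congr (_ *: _ + _ *: _); ring.
have inside (s t sg : R) : sg ^+ 2 = 1 -> 0 <= s -> 0 < t ->
    cos alpha * Num.sqrt ((s * cos alpha + t * sin alpha) ^+ 2 + (sg * (s * sin alpha - t * cos alpha)) ^+ 2)
      < s * cos alpha + t * sin alpha.
  move=> sg1 s_ge0 t0; rewrite exprMn sg1 mul1r.
  rewrite (_ : _ + _ = (s ^+ 2 + t ^+ 2) * (cos alpha ^+ 2 + sin alpha ^+ 2)); last ring.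
  rewrite cs mulr1.
  have h : s <= Num.sqrt (s ^+ 2 + t ^+ 2).
    by rewrite -[leLHS]ger0_norm// -sqrtr_sqr ler_sqrt ?addr_ge0 ?sqr_ge0// lerDl sqr_ge0.
  apply: (@le_lt_trans _ _ (cos alpha * s)); first exact: ler_wnM2l.
  by rewrite mulrC ltrDl mulr_gt0.
split => //.
  move=> x; case => /coneP -/(_ _)[//|s [t [/= + t0 ->]]]; rewrite in_itv/= andbT => s_ge0.
    by rewrite comb1 wedge_comb//; have := @inside s t 1; rewrite mul1r expr1n; apply.
  rewrite comb2 wedge_comb//; have := @inside s t (-1); rewrite mulN1r sqrrN expr1n; apply => //.
  exact: ltW.
rewrite -subset0 => x [] /coneP -/(_ n1)[s [t [/= + t0 xE]]]; rewrite in_itv/= andbT => s_ge0.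
move=> /coneP -/(_ n2)[s' [t' [/= + t0']]]; rewrite in_itv/= andbT => s_gt0.
rewrite xE comb1 comb2 => /(congr1 (dot^~ e2)).
have [_ ->] := dot_combE (s * cos alpha + t * sin alpha) (s * sin alpha - t * cos alpha) oe.
have [_ ->] := dot_combE (s' * cos alpha + t' * sin alpha) (- (s' * sin alpha - t' * cos alpha)) oe.
have : 0 <= s * sin alpha by rewrite mulr_ge0// ltW.
have : 0 < s' * sin alpha by rewrite mulr_gt0.
have : t * cos alpha <= 0 by rewrite mulr_ge0_le0// ltW.
have : t' * cos alpha <= 0 by rewrite mulr_ge0_le0// ltW.
lra.
Qed.

End Wedge.

(** * The energy inequality and its limit on H1 *)

Section AreaMeasure.
Context {R : realType}.
Local Notation mu := (@lebesgue_measure R).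
Lemma area_set0 : @area R set0 = 0%E.
Proof. exact: (measure0 (mu \x mu)%E). Qed.
Lemma area_ge0 A : (0 <= @area R A)%E.
Proof. exact: (measure_ge0 (mu \x mu)%E). Qed.
Lemma area_sigma_additive : semi_sigma_additive (@area R).
Proof. exact: (@measure_semi_sigma_additive _ _ _ (mu \x mu)%E). Qed.
HB.instance Definition _ := isMeasure.Build _ _ _ (@area R) area_set0 area_ge0 area_sigma_additive.
(* The area is the product of measures on measurableTypeR R, whose display is not
   the one of the canonical structure on R * R: the identity map transports
   integrals between the two structures. *)
Lemma ge0_integral_areaE (D : set (R * R)) (f : R * R -> \bar R) : measurable D ->
  measurable_fun D f -> (forall x, D x -> 0 <= f x)%E ->
  (\int[area]_(x in D) f x = \int[(mu \x mu)%E]_(x in D) f x)%E.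
Proof.
move=> mD mf f0.
pose phi : (measurableTypeR R * measurableTypeR R)%type -> (R * R)%type := fun x => x.
have mphi : measurable_fun setT phi by move=> _ A mA; rewrite setTI.
have := @ge0_integral_pushforward _ _ _ _ _ phi mphi (mu \x mu)%E D f mD mf.
by apply => x; rewrite inE => /f0.
Qed.

End AreaMeasure.

Section SquareIntegrals.
Context {R : realType}.
Local Notation mu := (@lebesgue_measure R).

Lemma sqr_young (a b eps : R) : 0 < eps ->
  a ^+ 2 <= (1 + eps) * b ^+ 2 + (1 + eps^-1) * (a - b) ^+ 2.
Proof.
move=> e0; rewrite -subr_ge0.
rewrite (_ : _ - _ = eps^-1 * (eps * b - (a - b)) ^+ 2).
  by rewrite mulr_ge0 ?sqr_ge0// invr_ge0 ltW.
by field; rewrite gt_eqF.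
Qed.

(** This takes the place of the triangle inequality in L^2: it is linear in the squared norms, the
    quantities that enter the quotient. *)
Lemma sqint_young (m : {measure set (R * R) -> \bar R}) (D : set (R * R))
    (f h : R * R -> R) (eps : R) : 0 < eps -> measurable D ->
  measurable_fun D f -> measurable_fun D h ->
  (sqint m D f <= (1 + eps)%:E * sqint m D h + (1 + eps^-1)%:E * sqint m D (f \- h)%R)%E.
Proof.
move=> e0 mD mf mh; rewrite /sqint.
have e1 : (0 <= (1 + eps)%:E)%E by rewrite lee_fin addr_ge0// ltW.
have e2 : (0 <= (1 + eps^-1)%:E)%E by rewrite lee_fin addr_ge0// invr_ge0 ltW.
have msq (k : R * R -> R) : measurable_fun D k -> measurable_fun D (fun x => ((k x) ^+ 2)%:E).
  by move=> mk; apply/measurable_EFinP; exact: measurable_funX.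
have sq0 (k : R * R -> R) x : D x -> (0 <= ((k x) ^+ 2)%:E)%E by rewrite lee_fin sqr_ge0.
have mfh : measurable_fun D (f \- h) by exact: measurable_funB.
rewrite -!ge0_integralZl//; [|exact: msq|exact: sq0|exact: msq|exact: sq0].
rewrite -ge0_integralD//; last 4 first.
- by move=> x Dx; rewrite mule_ge0// sq0.
- by apply: measurable_funeM; exact: msq.
- by move=> x Dx; rewrite mule_ge0// sq0.
- by apply: measurable_funeM; exact: msq.
apply: ge0_le_integral => //.
- exact: sq0.
- exact: msq.
- by apply: emeasurable_funD; apply: measurable_funeM; exact: msq.
- by move=> x _; rewrite -!EFinM -EFinD lee_fin sqr_young.
Qed.

Lemma sqint_sym (m : set (R * R) -> \bar R) (D : set (R * R)) (f h : R * R -> R) :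
  sqint m D (f \- h) = sqint m D (h \- f).
Proof.
rewrite /sqint (_ : (fun x => _) = (fun x => (((h \- f) x) ^+ 2)%:E))//.
by apply/funext => x; rewrite /= -sqrrN opprB.
Qed.

End SquareIntegrals.

Section Energy.
Context {R : realType}.
Implicit Types (a b q : R * R) (D : set (R * R)) (phi : R * R -> R).
Local Notation mu := (@lebesgue_measure R).

Definition energy (c : R) D phi : \bar R :=
  (\int[area]_(x in D)
    ((partial1 phi x) ^+ 2 + (partial2 phi x) ^+ 2 + c ^+ 2 * (phi x) ^+ 2)%:E)%E.

Lemma test_sqr_measurable phi : test_function setT phi ->
  [/\ measurable_fun [set: R * R] phi, measurable_fun [set: R * R] (partial1 phi) &
      measurable_fun [set: R * R] (partial2 phi)].
Proof.
move=> tphi; split; apply: plane_continuous_measurable.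
- exact: test_continuous tphi.
- exact: test_derive_continuous tphi.
- exact: test_derive_continuous tphi.
Qed.

Lemma energyE (c : R) D phi : measurable D -> test_function setT phi ->
  energy c D phi = (sqint area D (partial1 phi) + sqint area D (partial2 phi)
    + (c ^+ 2)%:E * sqint area D phi)%E.
Proof.
move=> mD tphi; have [m0 m1 m2] := test_sqr_measurable tphi.
have msq (k : R * R -> R) : measurable_fun [set: R * R] k -> measurable_fun D (fun x => ((k x) ^+ 2)%:E).
  by move=> mk; apply/measurable_EFinP; apply: measurable_funX; exact: measurable_funTS.
have sq0 (k : R * R -> R) x : D x -> (0 <= ((k x) ^+ 2)%:E)%E by rewrite lee_fin sqr_ge0.
rewrite /sqint -(ge0_integralZl _ mD); [|exact: msq|exact: sq0|by rewrite lee_fin sqr_ge0].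
rewrite -ge0_integralD//; [|exact: sq0|exact: msq|exact: sq0|exact: msq].
rewrite -ge0_integralD//.
- by move=> x Dx; rewrite adde_ge0// sq0.
- by apply: emeasurable_funD; exact: msq.
- by move=> x Dx; rewrite mule_ge0// ?sq0// lee_fin sqr_ge0.
- by apply: measurable_funeM; exact: msq.
Qed.

Lemma energy_measurable (c : R) phi : test_function setT phi ->
  measurable_fun [set: R * R] (fun x : R * R =>
    ((partial1 phi x) ^+ 2 + (partial2 phi x) ^+ 2 + c ^+ 2 * (phi x) ^+ 2)%:E).
Proof.
move=> /test_sqr_measurable[m0 m1 m2]; apply/measurable_EFinP; apply: measurable_funD.
  by apply: measurable_funD; [exact: measurable_funX m1|exact: measurable_funX m2].
by apply: measurable_funM; [exact: measurable_cst|exact: measurable_funX m0].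
Qed.

Lemma energy_density_ge0 (c : R) phi (x : R * R) :
  (0 <= ((partial1 phi x) ^+ 2 + (partial2 phi x) ^+ 2 + c ^+ 2 * (phi x) ^+ 2)%:E)%E.
Proof.
by rewrite lee_fin; apply: addr_ge0; [apply: addr_ge0|apply: mulr_ge0]; exact: sqr_ge0.
Qed.

Lemma energy_cone (c : R) (J : set R) a q phi : test_function setT phi -> measurable J ->
  dot q q = 1 -> 0 < c -> c = `|cross a q|^-1 ->
  (\int[mu]_(s in J) ((phi (s *: a)) ^+ 2)%:E <= energy c (cone J a q) phi)%E.
Proof.
move=> tphi mJ qq c0 cE.
have d0 : cross a q != 0 by rewrite -normr_eq0 -invr_eq0 -cE gt_eqF.
pose q' : R * R := (- q.2, q.1).
have mC : measurable (cone J a q) by exact: cone_measurable.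
rewrite /energy ge0_integral_areaE//; last 2 first.
- by apply: measurable_funTS; exact: energy_measurable.
- by move=> x _; exact: energy_density_ge0.
rewrite (@cone_identity _ setT phi J a q q' c)//.
- by rewrite leeDl// integral_ge0// => x _; rewrite lee_fin addr_ge0 ?sqr_ge0.
- by rewrite -[RHS]qq /q' /dot/=; ring.
- by rewrite /q' /dot/=; ring.
Qed.

Lemma integral_ray_open (phi : R * R -> R) a : continuous phi ->
  (\int[mu]_(s in `]0%R, +oo[) ((phi (s *: a)) ^+ 2)%:E =
   \int[mu]_(s in `[0%R, +oo[) ((phi (s *: a)) ^+ 2)%:E)%E.
Proof.
move=> cphi; apply: integral_itv_obnd_cbnd; apply/measurable_EFinP; apply: measurable_funTS.
apply: continuous_measurable_fun => s.
have := @continuous_line _ phi a a 0 cphi s; under eq_fun do rewrite scale0r add0r.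
by move=> h; exact: (cvgM h h).
Qed.

Lemma energy_two_cones (c : R) D a b q1 q2 phi : test_function setT phi -> measurable D ->
  dot q1 q1 = 1 -> dot q2 q2 = 1 -> 0 < c ->
  c = `|cross a q1|^-1 -> c = `|cross b q2|^-1 ->
  cone `[0, +oo[ a q1 `|` cone `]0, +oo[ b q2 `<=` D ->
  cone `[0, +oo[ a q1 `&` cone `]0, +oo[ b q2 = set0 ->
  (\int[mu]_(s in `[0%R, +oo[) ((phi (s *: a)) ^+ 2)%:E +
   \int[mu]_(s in `[0%R, +oo[) ((phi (s *: b)) ^+ 2)%:E <= energy c D phi)%E.
Proof.
move=> tphi mD q11 q22 c0 c1 c2 sub disj.
have m1 : measurable (cone `[0, +oo[ a q1) by exact: cone_measurable.
have m2 : measurable (cone `]0, +oo[ b q2) by exact: cone_measurable.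
apply: (@le_trans _ _ (energy c (cone `[0, +oo[ a q1 `|` cone `]0, +oo[ b q2) phi)).
  rewrite /energy ge0_integral_setU//; last 3 first.
  - by apply: measurable_funTS; exact: energy_measurable.
  - by move=> x _; exact: energy_density_ge0.
  - exact/disj_set2P.
  rewrite -[X in (_ + X <= _)%E]integral_ray_open; last exact: test_continuous tphi.
  by apply: leeD; exact: energy_cone.
apply: ge0_subset_integral => //.
- exact: measurableU.
- by apply: measurable_funTS; exact: energy_measurable.
- by move=> x _; exact: energy_density_ge0.
Qed.

(** Young's inequality is applied twice around the inequality for a test function close to v: on the
    boundary from g to the test function, and inside from the test function to v and p. Each costs a
    factor 1 + eps and a small additive error. *)
Lemma trace_energy (c : R) D v p g (nu : {measure set (R * R) -> \bar R}) :
  measurable D -> measurable (frontier D) ->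
  (forall f : R * R -> \bar R,
    \int[hausdorff1]_(x in frontier D) f x = \int[nu]_(x in frontier D) f x)%E ->
  (forall phi, test_function setT phi -> (sqint nu (frontier D) phi <= energy c D phi)%E) ->
  H1 D v p -> trace D v p g ->
  fine (sqint hausdorff1 (frontier D) g) <=
    fine (sqint area D p.1) + fine (sqint area D p.2) + c ^+ 2 * fine (sqint area D v).
Proof.
move=> mD mF Hnu Enu [[mv v2] [mp1 p12] [mp2 p22] _] [[mg g2] [phi [tphi cv cp1 cp2 cg]]].
have HnuE f : sqint hausdorff1 (frontier D) f = sqint nu (frontier D) f by exact: Hnu.
rewrite HnuE in g2 *.
have sq_ge0 (m : {measure set (R * R) -> \bar R}) A f : (0 <= sqint m A f)%E.
  by apply: integral_ge0 => x _; rewrite lee_fin sqr_ge0.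
have fin (m : {measure set (R * R) -> \bar R}) A f : (sqint m A f < +oo)%E ->
    exists2 r : R, 0 <= r & sqint m A f = r%:E.
  move=> fy; exists (fine (sqint m A f)); first exact/fine_ge0.
  by rewrite fineK// ge0_fin_numE.
have [V V0 VE] := fin area D v v2.
have [P1 P10 P1E] := fin area D p.1 p12.
have [P2 P20 P2E] := fin area D p.2 p22.
have [G G0 GE] := fin nu (frontier D) g g2.
rewrite VE P1E P2E GE/=.
pose E := P1 + P2 + c ^+ 2 * V; rewrite -/E.
have E0 : 0 <= E by rewrite !addr_ge0// mulr_ge0// sqr_ge0.
have c20 : 0 <= c ^+ 2 by exact: sqr_ge0.
(* eps K bounds the total error: since eps <= 1, eps^2 and eps^3 are replaced by eps in (1 + eps) S
   + eps^2 + eps - E. *)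
pose K := 3 * E + 2 * (1 + 2 * (2 + c ^+ 2)) + 1.
have K0 : 0 < K by rewrite /K; lra.
apply/ler_addgt0Pr => e e0.
pose eps := Num.min 1 (e / K).
have eps0 : 0 < eps by rewrite lt_min ltr01 divr_gt0.
have eps1 : eps <= 1 by rewrite ge_min lexx.
have epsK : eps * K <= e by rewrite -ler_pdivlMr// ge_min lexx orbT.
(* The threshold is eps^2 because Young's inequality multiplies it by 1 + 1/eps, which leaves eps^2
   + eps. *)
have near_small (u : nat -> \bar R) : u @ \oo --> 0%E -> \forall n \near \oo, (u n <= (eps ^+ 2)%:E)%E.
  move=> u0; have /fine_cvgP[ufin /cvgrPdist_le] := u0.
  move=> /(_ (eps ^+ 2) (exprn_gt0 2 eps0)) usmall.
  near=> n; have : u n \is a fin_num by near: n.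
  move=> /fineK <-; rewrite lee_fin (le_trans (ler_norm _))//.
  have : `|0 - fine (u n)| <= eps ^+ 2 by near: n.
  by rewrite sub0r normrN.
have [n [dv dp1 dp2 dg]] : exists n, [/\ (sqint area D (phi n \- v)%R <= (eps ^+ 2)%:E)%E,
   (sqint area D (partial1 (phi n) \- p.1)%R <= (eps ^+ 2)%:E)%E,
   (sqint area D (partial2 (phi n) \- p.2)%R <= (eps ^+ 2)%:E)%E &
   (sqint hausdorff1 (frontier D) (phi n \- g)%R <= (eps ^+ 2)%:E)%E].
  have : \forall n \near \oo, [/\ (sqint area D (phi n \- v)%R <= (eps ^+ 2)%:E)%E,
   (sqint area D (partial1 (phi n) \- p.1)%R <= (eps ^+ 2)%:E)%E,
   (sqint area D (partial2 (phi n) \- p.2)%R <= (eps ^+ 2)%:E)%E &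
   (sqint hausdorff1 (frontier D) (phi n \- g)%R <= (eps ^+ 2)%:E)%E].
    near=> n; split; near: n; exact: near_small.
  by move=> [N _ /(_ N (leqnn N))]; exists N.
have [m0 m1 m2] := test_sqr_measurable (tphi n).
have young (m : {measure set (R * R) -> \bar R}) (A : set (R * R)) (f h : R * R -> R) (H : R) : measurable A ->
    measurable_fun A f -> measurable_fun A h -> sqint m A h = H%:E ->
    (sqint m A (f \- h)%R <= (eps ^+ 2)%:E)%E ->
    (sqint m A f <= ((1 + eps) * H + (eps ^+ 2 + eps))%:E)%E.
  move=> mA mf mh hE fh; apply: (le_trans (sqint_young m eps0 mA mf mh)).
  rewrite hE (EFinD ((1 + eps) * H)) (EFinM (1 + eps) H); apply: leeD => //.
  rewrite (_ : eps ^+ 2 + eps = (1 + eps^-1) * eps ^+ 2); last by field; rewrite gt_eqF.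
  by rewrite EFinM lee_wpmul2l// lee_fin addr_ge0// invr_ge0 ltW.
have yv := young area D (phi n) v V mD (measurable_funTS m0) mv VE dv.
have yp1 := young area D (partial1 (phi n)) p.1 P1 mD (measurable_funTS m1) mp1 P1E dp1.
have yp2 := young area D (partial2 (phi n)) p.2 P2 mD (measurable_funTS m2) mp2 P2E dp2.
pose S := (1 + eps) * E + (2 + c ^+ 2) * (eps ^+ 2 + eps).
have Ephi : (energy c D (phi n) <= S%:E)%E.
  rewrite energyE//.
  rewrite (_ : S = ((1 + eps) * P1 + (eps ^+ 2 + eps)) + ((1 + eps) * P2 + (eps ^+ 2 + eps))
     + c ^+ 2 * ((1 + eps) * V + (eps ^+ 2 + eps))); last by rewrite /S /E; ring.
  rewrite EFinD EFinD; apply: leeD; first exact: leeD.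
  by rewrite (EFinM (c ^+ 2)) lee_wpmul2l// lee_fin.
have gS : (sqint nu (frontier D) (phi n) <= S%:E)%E.
  exact: le_trans (Enu _ (tphi n)) Ephi.
have Gle : (G%:E <= ((1 + eps) * S + (eps ^+ 2 + eps))%:E)%E.
  rewrite -GE; apply: (le_trans (sqint_young nu eps0 mF mg (measurable_funTS m0))).
  rewrite sqint_sym (EFinD ((1 + eps) * S)) (EFinM (1 + eps) S); apply: leeD.
    by rewrite lee_wpmul2l// lee_fin addr_ge0// ltW.
  rewrite (_ : eps ^+ 2 + eps = (1 + eps^-1) * eps ^+ 2); last by field; rewrite gt_eqF.
  rewrite EFinM lee_wpmul2l//; last by rewrite -HnuE.
  by rewrite lee_fin addr_ge0// invr_ge0 ltW.
rewrite lee_fin in Gle; apply: (le_trans Gle).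
apply: (@le_trans _ _ (E + eps * K)); last by rewrite lerD2l.
have e2 : eps ^+ 2 <= eps by rewrite expr2 -[leRHS]mulr1 ler_wpM2l// ltW.
have eE : eps ^+ 2 * E <= eps * E by rewrite ler_wpM2r.
have ec : eps ^+ 2 * c ^+ 2 <= eps * c ^+ 2 by rewrite ler_wpM2r.
have e3 : eps ^+ 3 <= eps.
  by rewrite exprS (le_trans _ e2)// expr2 ler_wpM2l// ?(ltW eps0)// (le_trans e2).
have e3c : eps ^+ 3 * c ^+ 2 <= eps * c ^+ 2 by rewrite ler_wpM2r.
rewrite (_ : (1 + eps) * S + (eps ^+ 2 + eps) = E + 2 * (eps * E) + eps ^+ 2 * E
  + (2 * eps + 4 * eps ^+ 2 + 2 * eps ^+ 3 + eps * c ^+ 2 + 2 * (eps ^+ 2 * c ^+ 2) + eps ^+ 3 * c ^+ 2)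
  + eps ^+ 2 + eps); last by rewrite /S; ring.
rewrite (_ : E + eps * K = E + 3 * (eps * E) + 10 * eps + 4 * (eps * c ^+ 2) + eps); last by rewrite /K; ring.
lra.
Unshelve. all: by end_near. Qed.

End Energy.

(** * Compactly supported smooth functions *)

Section ElementaryFunctions.
Context {R : realType}.

(** The powers of 1/x are included to make the family stable under derivation up to linear
    combinations; n = 0 is the classical function exp(-1/x). *)
Definition flat (n : nat) (x : R) : R :=
  if 0 < x then x^-1 ^+ n * expR (- x^-1) else 0.

Lemma flat_pos n (x : R) : 0 < x -> flat n x = x^-1 ^+ n * expR (- x^-1).
Proof. by rewrite /flat => ->. Qed.

Lemma flat_npos n (x : R) : x <= 0 -> flat n x = 0.
Proof. by rewrite /flat leNgt => /negPf ->. Qed.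

Lemma flat_ge0 n (x : R) : 0 <= flat n x.
Proof.
rewrite /flat; case: ifPn => // x0.
by rewrite mulr_ge0 ?expR_ge0// exprn_ge0// invr_ge0 ltW.
Qed.

(** exp y is at least the term y^(n+1) / (n+1)! of its series. *)
Lemma expRN_le (n : nat) (y : R) : 0 < y -> y ^+ n * expR (- y) <= n.+1`!%:R / y.
Proof.
move=> y0; rewrite expRN ler_pdivlMr// mulrAC ler_pdivrMr ?expR_gt0// -exprSr.
have := expR_ge1Dxn n (ltW y0).
have F0 : 0 < n.+1`!%:R :> R by rewrite ltr0n fact_gt0.
move=> /(le_trans (ler_wpDl ler01 (lexx _))).
by rewrite ler_pdivrMr// mulrC.
Qed.

Lemma flat_le n (x : R) : 0 <= x -> flat n x <= n.+1`!%:R * x.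
Proof.
rewrite le_eqVlt => /predU1P[<-|x0]; first by rewrite flat_npos// mulr0.
by rewrite flat_pos// (le_trans (expRN_le _ _)) ?invr_gt0// invrK.
Qed.

Lemma is_derive_flat n (x : R) :
  is_derive x (1 : R) (flat n) (- n%:R * flat n.+1 x + flat n.+2 x).
Proof.
have [x0|x0|->] := ltgtP x 0.
- rewrite !flat_npos ?(ltW x0)// mulr0 addr0.
  apply: near_eq_is_derive (is_derive_cst 0 x 1).
  by near=> y; rewrite /= flat_npos//; apply/ltW; near: y; exact: lt_nbhsl.
- have xn0 : x != 0 by rewrite gt_eqF.
  have dinv : is_derive x (1 : R) (fun y : R => y^-1) (- x^-1 ^+ 2).
    apply: is_derive_eq (is_deriveV xn0 (is_derive_id x 1)) _.
    by rewrite /GRing.scale/= mulr1 exprVn.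
  have dexp : is_derive x (1 : R) (fun y : R => expR (- y^-1)) (expR (- x^-1) * x^-1 ^+ 2).
    have dN := @is_deriveN _ _ _ _ _ _ _ dinv.
    rewrite opprK in dN.
    have := @is_derive1_comp _ expR (fun y : R => - y^-1) x _ _ (is_derive_expR _) dN.
    by [].
  have dpow : is_derive x (1 : R) (fun y : R => y^-1 ^+ n) (- n%:R * x^-1 ^+ n.+1).
    have dX := is_deriveX n dinv; rewrite exprfctE in dX.
    apply: is_derive_eq dX _.
    rewrite /GRing.scale/=; case: n => [|m]; first by rewrite !mul0r oppr0 mul0r.
    by rewrite /= mulrN mulNr -mulrA -exprD addn2.
  have dprod := is_deriveM dpow dexp.
  rewrite !flat_pos//.
  apply: (@near_eq_is_derive _ _ _ (fun y : R => y^-1 ^+ n * expR (- y^-1))).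
    by near=> y; rewrite flat_pos//; near: y; exact: lt_nbhsr.
  apply: is_derive_eq dprod _; rewrite /GRing.scale/= !exprS; ring.
- rewrite !flat_npos// mulr0 addr0.
  (* For h > 0 the difference quotient of [flat n] at 0 is [flat n.+1 h], of order h by [flat_le];
     for h <= 0 it is 0. *)
  suff lim0 : (fun h : R => h^-1 *: (flat n (h *: (1 : R) + 0) - flat n 0)) @ 0^' --> (0 : R).
    by split; [apply/cvg_ex; exists 0|exact/cvg_lim].
  apply/cvgrPdist_le => e e0.
  have F0 : 0 < n.+2`!%:R :> R by rewrite ltr0n fact_gt0.
  near=> h.
  rewrite sub0r normrN (_ : h *: (1 : R) + 0 = h); last by rewrite addr0 /GRing.scale/= mulr1.
  rewrite (flat_npos n (lexx 0)) subr0 /GRing.scale/=.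
  have he : `|h| <= e / n.+2`!%:R.
    by near: h; apply: dnbhs0_le; rewrite divr_gt0.
  have [h0|h0] := ltP 0 h; last by rewrite flat_npos// mulr0 normr0 ltW.
  rewrite (_ : h^-1 * flat n h = flat n.+1 h); last by rewrite !flat_pos// exprS mulrA.
  rewrite ger0_norm ?flat_ge0// (le_trans (flat_le _ (ltW h0)))//.
  by rewrite mulrC -ler_pdivlMr// -[h]gtr0_norm.
Unshelve. all: by end_near. Qed.

(** A class that contains the trial functions and is stable under directional derivatives. Its
    members are differentiable, so smoothness follows by induction on the list of directions. *)
Inductive elementary : (R * R -> R) -> Prop :=
| elementary_cst (k : R) : elementary (fun=> k)
| elementary_fst : elementary fst
| elementary_snd : elementary snd
| elementary_add f g : elementary f -> elementary g -> elementary (fun x => f x + g x)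
| elementary_mul f g : elementary f -> elementary g -> elementary (fun x => f x * g x)
| elementary_expR f : elementary f -> elementary (fun x => expR (f x))
| elementary_flat n f : elementary f -> elementary (fun x => flat n (f x)).

Lemma derive_outer (g g' : R -> R) (f : R * R -> R) (x e : R * R) :
  (forall t, is_derive t (1 : R) g (g' t)) -> differentiable f x ->
  differentiable (fun x => g (f x)) x /\ 'D_e (fun x => g (f x)) x = g' (f x) * 'D_e f x.
Proof.
move=> dg df.
have dgf : differentiable g (f x) by apply/derivable1_diffP; case: (dg (f x)).
have dc : differentiable (g \o f) x by exact: differentiable_comp.
split => //; rewrite !deriveE// diff_comp// /= diff1E// /GRing.scale/= derive1E.
by rewrite mulrC; case: (dg (f x)) => _ ->.
Qed.

Lemma elementary_derive f : elementary f ->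
  (forall x, differentiable f x) /\ forall e, elementary ('D_e f).
Proof.
elim => {f}.
- move=> k; split => [x|e]; first exact: differentiable_cst.
  rewrite (_ : 'D_e _ = fun=> 0); first exact: elementary_cst.
  by apply/funext => x; rewrite derive_cst.
- have cf : continuous (fst : R * R -> R) by move=> x; exact: cvg_fst.
  split => [x|e]; first exact: linear_differentiable.
  rewrite (_ : 'D_e _ = fun=> e.1); first exact: elementary_cst.
  by apply/funext => x; rewrite deriveE ?diff_lin//; exact: linear_differentiable.
- have cf : continuous (snd : R * R -> R) by move=> x; exact: cvg_snd.
  split => [x|e]; first exact: linear_differentiable.
  rewrite (_ : 'D_e _ = fun=> e.2); first exact: elementary_cst.
  by apply/funext => x; rewrite deriveE ?diff_lin//; exact: linear_differentiable.
- move=> f g _ [df ef] _ [dg eg]; split => [x|e]; first exact: differentiableD.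
  rewrite (_ : 'D_e _ = fun x => 'D_e f x + 'D_e g x); first exact: elementary_add.
  by apply/funext => x; rewrite -deriveD//; exact: diff_derivable.
- move=> f g Ef [df ef] Eg [dg eg]; split => [x|e]; first exact: differentiableM.
  rewrite (_ : 'D_e _ = fun x => f x * 'D_e g x + g x * 'D_e f x).
    by apply: elementary_add; exact: elementary_mul.
  by apply/funext => x; rewrite (@deriveM _ _ f g)//; exact: diff_derivable.
- move=> f Ef [df ef]; have dexp e x := derive_outer e (@is_derive_expR R) (df x).
  split => [x|e]; first by case: (dexp (0, 0) x).
  rewrite (_ : 'D_e _ = fun x => expR (f x) * 'D_e f x).
    by apply: elementary_mul => //; exact: elementary_expR.
  by apply/funext => x; case: (dexp e x).
- move=> n f Ef [df ef]; have dexp e x := derive_outer e (is_derive_flat n) (df x).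
  split => [x|e]; first by case: (dexp (0, 0) x).
  rewrite (_ : 'D_e _ = fun x => (- n%:R * flat n.+1 (f x) + flat n.+2 (f x)) * 'D_e f x).
    apply: elementary_mul => //; apply: elementary_add; last exact: elementary_flat.
    by apply: elementary_mul; [exact: elementary_cst|exact: elementary_flat].
  by apply/funext => x; case: (dexp e x).
Qed.

Lemma elementary_smooth f : elementary f -> smooth_on setT f.
Proof.
move=> ef s x _; suff /elementary_derive[] : elementary
  (foldr (fun (e : R * R) (g : R * R -> R) => 'D_e g) f s) by [].
by elim: s => //= e s /elementary_derive[].
Qed.

End ElementaryFunctions.

Section Bump.
Context {R : realType}.

Let A : R := flat 0 2^-1.

(** Since [flat 0] is nondecreasing and A = [flat 0] (1/2), the argument A - [flat 0 t] is A for t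
    <= 0 and nonpositive for t >= 1/2. The step thus falls from a positive constant to 0 without any
    division; it is not normalized to 1. *)
Definition smooth_step (t : R) : R := flat 0 (A - flat 0 t).
Definition smooth_step' (t : R) : R := - flat 2 (A - flat 0 t) * flat 2 t.

(** A descending step at 1 and its mirror image at -1: constant on [-1, 1] and zero where |t| >=
    3/2. *)
Definition bump (t : R) : R := smooth_step (t - 1) * smooth_step (- t - 1).
Definition bump' (t : R) : R :=
  smooth_step' (t - 1) * smooth_step (- t - 1) - smooth_step (t - 1) * smooth_step' (- t - 1).

Lemma is_derive_flat0 (x : R) : is_derive x (1 : R) (flat 0) (flat 2 x).
Proof. by apply: is_derive_eq (is_derive_flat 0 x) _; rewrite oppr0 mul0r add0r. Qed.

Lemma flat0_le1 (x : R) : flat 0 x <= 1.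
Proof.
rewrite /flat; case: ifPn => // x0; rewrite expr0 mul1r -expR0 ler_expR oppr_le0 invr_ge0.
exact: ltW.
Qed.

Lemma flat2_le2 (x : R) : flat 2 x <= 2.
Proof.
rewrite /flat; case: ifPn => // x0; have y0 : 0 < x^-1 by rewrite invr_gt0.
rewrite expRN ler_pdivrMr ?expR_gt0//.
by have := expR_ge1Dxn 1 (ltW y0); rewrite (_ : 2`! = 2)//; lra.
Qed.

Lemma flat0_homo (x y : R) : x <= y -> flat 0 x <= flat 0 y.
Proof.
move=> xy; have [x0|x0] := leP x 0; first by rewrite (flat_npos _ x0) flat_ge0.
have y0 := lt_le_trans x0 xy.
by rewrite !flat_pos// !expr0 !mul1r ler_expR lerN2 lef_pV2.
Qed.

Lemma A_gt0 : 0 < A.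
Proof. by rewrite /A flat_pos ?invr_gt0// expr0 mul1r expR_gt0. Qed.

Lemma is_derive_smooth_step (t : R) : is_derive t (1 : R) smooth_step (smooth_step' t).
Proof.
have d1 : is_derive t (1 : R) (fun t => A - flat 0 t) (- flat 2 t).
  have := is_deriveB (is_derive_cst A t 1) (is_derive_flat0 t).
  by rewrite sub0r.
have := @is_derive1_comp _ (flat 0) (fun t => A - flat 0 t) t _ _ (is_derive_flat0 _) d1.
by rewrite /smooth_step' mulrN -mulNr.
Qed.

Lemma is_derive_bump (t : R) : is_derive t (1 : R) bump (bump' t).
Proof.
have dl : is_derive t (1 : R) (fun t : R => t - 1) 1.
  by have := is_deriveB (is_derive_id t 1) (is_derive_cst (1 : R) t 1); rewrite subr0.
have dr : is_derive t (1 : R) (fun t : R => - t - 1) (-1).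
  by have := is_deriveB (is_deriveNid t 1) (is_derive_cst (1 : R) t 1); rewrite subr0.
have d1 := @is_derive1_comp _ smooth_step _ t _ _ (is_derive_smooth_step _) dl.
have d2 := @is_derive1_comp _ smooth_step _ t _ _ (is_derive_smooth_step _) dr.
apply: is_derive_eq (is_deriveM d1 d2) _.
transitivity (smooth_step (t - 1) * (smooth_step' (- t - 1) * -1) +
  smooth_step (- t - 1) * (smooth_step' (t - 1) * 1)); first by [].
by rewrite mulr1 mulrN1 mulrN addrC [_ * smooth_step' (t - 1)]mulrC.
Qed.

Lemma smooth_step_left (t : R) : t <= 0 -> smooth_step t = flat 0 A /\ smooth_step' t = 0.
Proof. by move=> t0; rewrite /smooth_step /smooth_step' !(flat_npos _ t0) subr0 mulr0. Qed.

Lemma smooth_step_right (t : R) : 2^-1 <= t -> smooth_step t = 0 /\ smooth_step' t = 0.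
Proof.
move=> t0; have tA : A - flat 0 t <= 0 by rewrite subr_le0 flat0_homo.
by rewrite /smooth_step /smooth_step' !(flat_npos _ tA) oppr0 mul0r.
Qed.

Lemma smooth_step_bounds (t : R) : 0 <= smooth_step t <= 1 /\ `|smooth_step' t| <= 4.
Proof.
split; first by rewrite flat_ge0 flat0_le1.
rewrite /smooth_step' normrM normrN !ger0_norm ?flat_ge0//.
rewrite (_ : 4 = 2 * 2 :> R); last ring.
by rewrite ler_pM ?flat_ge0// flat2_le2.
Qed.

Lemma bump_plateau (t : R) : -1 <= t <= 1 -> bump t = flat 0 A ^+ 2 /\ bump' t = 0.
Proof.
move=> /andP[t1 t2]; rewrite /bump /bump'.
have [-> ->] : smooth_step (t - 1) = flat 0 A /\ smooth_step' (t - 1) = 0.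
  by apply: smooth_step_left; lra.
have [-> ->] : smooth_step (- t - 1) = flat 0 A /\ smooth_step' (- t - 1) = 0.
  by apply: smooth_step_left; lra.
by rewrite mul0r mulr0 subr0 expr2.
Qed.

Lemma bump_outside (t : R) : 3 / 2 <= `|t| -> bump t = 0 /\ bump' t = 0.
Proof.
rewrite /bump /bump' ler_normr => /orP[|] t32.
  have [-> ->] : smooth_step (t - 1) = 0 /\ smooth_step' (t - 1) = 0.
    by apply: smooth_step_right; lra.
  by rewrite !mul0r subr0.
have [-> ->] : smooth_step (- t - 1) = 0 /\ smooth_step' (- t - 1) = 0.
  by apply: smooth_step_right; lra.
by rewrite !mulr0 subr0.
Qed.

Lemma bump_bounds (t : R) : 0 <= bump t <= 1 /\ `|bump' t| <= 8.
Proof.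
have bounds (u u' w w' : R) : 0 <= u <= 1 -> `|u'| <= 4 -> 0 <= w <= 1 -> `|w'| <= 4 ->
    0 <= u * w <= 1 /\ `|u' * w - u * w'| <= 8.
  move=> /andP[u0 u1] u'4 /andP[w0 w1] w'4.
  split; first by rewrite mulr_ge0//= mulr_ile1.
  rewrite (le_trans (ler_normB _ _))// !normrM (ger0_norm u0) (ger0_norm w0).
  have h1 : `|u'| * w <= 4 * 1 by rewrite ler_pM.
  have h2 : u * `|w'| <= 1 * 4 by rewrite ler_pM.
  lra.
have [a a'] := smooth_step_bounds (t - 1); have [b b'] := smooth_step_bounds (- t - 1).
exact: bounds.
Qed.

Lemma plateau_gt0 : 0 < flat 0 A ^+ 2.
Proof. by rewrite exprn_gt0// flat_pos ?A_gt0// expr0 mul1r expR_gt0. Qed.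

Lemma elementary_bump (f : R * R -> R) : elementary f -> elementary (fun x => bump (f x)).
Proof.
move=> ef; have step (g : R * R -> R) : elementary g -> elementary (fun x => smooth_step (g x)).
  move=> eg; apply: elementary_flat.
  have -> : (fun x => A - flat 0 (g x)) = fun x => A + (-1) * flat 0 (g x).
    by apply/funext => x; rewrite mulN1r.
  apply: elementary_add; first exact: elementary_cst.
  by apply: elementary_mul; [exact: elementary_cst|exact: elementary_flat].
apply: elementary_mul; apply: step.
  by apply: elementary_add => //; exact: elementary_cst.
have -> : (fun x => - f x - 1) = fun x => (-1) * f x + (-1).
  by apply/funext => x; rewrite mulN1r.
apply: elementary_add; last exact: elementary_cst.
by apply: elementary_mul => //; exact: elementary_cst.
Qed.

End Bump.

(** * Test functions as competitors in H^1 *)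

Section BoundedIntegrals.
Context {R : realType}.
Implicit Types (D S : set (R * R)) (f : R * R -> R).
Local Notation mu := (@lebesgue_measure R).

Lemma integral_le_const D S (f : R * R -> \bar R) (C : R) : measurable D -> measurable S ->
  measurable_fun D f -> (forall x, D x -> 0 <= f x)%E -> 0 <= C ->
  (forall x, D x -> S x -> f x <= C%:E)%E -> (forall x, D x -> ~ S x -> f x = 0)%E ->
  (\int[area]_(x in D) f x <= C%:E * area S)%E.
Proof.
move=> mD mS mf f0 C0 fC fS.
have mDS : measurable (D `&` S) by exact: measurableI.
rewrite (_ : (\int[area]_(x in D) f x)%E = (\int[area]_(x in D `&` S) f x)%E); last first.
  rewrite integral_mkcondr; apply: eq_integral => x; rewrite inE => Dx.
  by rewrite patchE; case: ifPn => //; rewrite notin_setE => /fS ->.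
apply: (@le_trans _ _ (\int[area]_(x in D `&` S) C%:E)%E).
  apply: ge0_le_integral => //.
  - by move=> x [Dx _]; exact: f0.
  - by apply: measurable_funS mf.
  - by move=> x [Dx Sx]; exact: fC.
rewrite integral_cst//; apply: lee_wpmul2l; first by rewrite lee_fin.
by apply: le_measure; rewrite ?inE.
Qed.

Lemma integral_ge_const D S (f : R * R -> \bar R) (C : R) : measurable D -> measurable S ->
  S `<=` D -> measurable_fun D f -> (forall x, D x -> 0 <= f x)%E -> 0 <= C ->
  (forall x, S x -> C%:E <= f x)%E -> (C%:E * area S <= \int[area]_(x in D) f x)%E.
Proof.
move=> mD mS SD mf f0 C0 fC; rewrite -integral_cst//.
apply: (@le_trans _ _ (\int[area]_(x in S) f x)%E).
  apply: ge0_le_integral => //.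
  - exact: measurable_funS mf.
by apply: ge0_subset_integral.
Qed.

(** Rotation invariance of the area, from the linear change of variables with |e1 x e2| = 1. *)
Lemma area_orthonormal_box (e1 e2 : R * R) (I J : set R) : orthonormal e1 e2 ->
  measurable I -> measurable J ->
  measurable [set x | I (dot x e1) /\ J (dot x e2)] /\
  area [set x | I (dot x e1) /\ J (dot x e2)] = (mu I * mu J)%E.
Proof.
move=> oe mI mJ; set B := [set x | _].
have mB : measurable B.
  have md (e : R * R) : measurable_fun [set: R * R] (fun x => dot x e).
    by apply: plane_continuous_measurable; exact: continuous_dot.
  rewrite (_ : B = (setT `&` (fun x => dot x e1) @^-1` I) `&` (setT `&` (fun x => dot x e2) @^-1` J)).
    by apply: measurableI; exact: md.
  by apply/seteqP; split => x; [move=> [? ?]|move=> [[_ ?] [_ ?]]].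
split => //.
have dn : cross e1 e2 != 0 by rewrite -normr_eq0 (orthonormal_cross oe) oner_neq0.
have mind : measurable_fun [set: R * R] (fun x : R * R => (\1_B x)%:E : \bar R).
  by apply/measurable_EFinP.
have ind0 (x : R * R) : (0 <= (\1_B x)%:E :> \bar R)%E by rewrite lee_fin.
have -> : (area B = \int[area]_x (\1_B x)%:E)%E by rewrite integral_indic// setIT.
rewrite ge0_integral_areaE// (ge0_integral_linear_change dn mind ind0).
rewrite (orthonormal_cross oe) !mul1e.
have BE s t : \1_B (s *: e1 + t *: e2) = \1_I s * \1_J t :> R.
  have [d1 d2] := dot_combE s t oe.
  rewrite !indicE -natrM mulnb; congr (_ %:R); congr nat_of_bool.
  by apply/idP/andP; rewrite !inE /B/= d1 d2.
under eq_integral do under eq_integral do rewrite BE EFinM.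
have inner s : (\int[mu]_t ((\1_I s)%:E * (\1_J t)%:E) = (\1_I s)%:E * mu J)%E.
  rewrite ge0_integralZl//; last by apply/measurable_EFinP.
  by rewrite integral_indic// setIT.
under eq_integral do rewrite inner.
rewrite ge0_integralZr//; last by apply/measurable_EFinP.
by rewrite integral_indic// setIT.
Qed.

Definition compactly_vanishing f :=
  exists2 M : R, 0 < M & forall x : R * R, M <= `|x.1| \/ M <= `|x.2| -> f x = 0.

Definition square (M : R) : set (R * R) := `[- M, M]%classic `*` `[- M, M]%classic.

Lemma vanishing_bounded f : continuous f -> compactly_vanishing f ->
  exists2 C : R, 0 <= C & forall x, `|f x| <= C.
Proof.
move=> cf [M M0 fM].
have cK : compact (square M).
  by apply: compact_setX; exact: segment_compact.
have cfK : {within square M, continuous f}.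
  exact: continuous_subspaceT.
have /compact_bounded[B [Breal BB]] := continuous_compact cfK cK.
exists (`|B| + 1); first by rewrite addr_ge0.
move=> x; have [x1|x1] := leP M `|x.1|; first by rewrite fM ?normr0 ?addr_ge0//; left.
have [x2|x2] := leP M `|x.2|; first by rewrite fM ?normr0 ?addr_ge0//; right.
apply: BB; first by rewrite (le_lt_trans (ler_norm _))// ltrDl.
by exists x => //; split; rewrite /= in_itv/= -ler_norml ltW.
Qed.

Lemma area_square_finite (M : R) : measurable (square M) /\ (area (square M) < +oo)%E.
Proof.
split; first by apply: measurableX.
have fin : (mu `[(- M)%R, M] < +oo)%E.
  by rewrite lebesgue_measure_itv/=; case: ifPn => // _; rewrite -EFinB ltry.
have -> : area (square M) = (mu `[(- M)%R, M] * mu `[(- M)%R, M])%E.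
  by apply: product_measure1E.
by apply: lte_mul_pinfty => //; rewrite ge0_fin_numE.
Qed.

Lemma vanishing_sqint f D : measurable D -> continuous f -> compactly_vanishing f ->
  L2 area D f.
Proof.
move=> mD cf vf; have [C C0 fC] := vanishing_bounded cf vf; have [M M0 fM] := vf.
have mf : measurable_fun D f by apply: measurable_funTS; exact: plane_continuous_measurable.
split => //; have [mS areaS] := area_square_finite M.
have sqC (x : R * R) : f x ^+ 2 <= C ^+ 2.
  by rewrite -real_normK ?num_real// ler_pXn2r ?nnegrE.
apply: (@le_lt_trans _ _ ((C ^+ 2)%:E * area (square M))%E).
  apply: integral_le_const => //.
  - by apply/measurable_EFinP; exact: measurable_funX.
  - by move=> x _; rewrite lee_fin sqr_ge0.
  - exact: sqr_ge0.
  - by move=> x _ _; rewrite lee_fin.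
  - move=> x _ xS; rewrite fM ?expr0n//; apply: contrapT => /not_orP[/negP + /negP].
    by rewrite -!ltNge => x1 x2; apply: xS; split; rewrite /= in_itv/= -ler_norml ltW.
by rewrite lte_mul_pinfty// lee_fin sqr_ge0.
Qed.

Lemma vanishing_integrable f : continuous f -> compactly_vanishing f ->
  (mu \x mu)%E.-integrable setT (EFin \o f).
Proof.
move=> cf vf; have [C C0 fC] := vanishing_bounded cf vf; have [M M0 fM] := vf.
have mf := plane_continuous_measurable cf.
apply/integrableP; split; first exact/measurable_EFinP.
have [mS areaS] := area_square_finite M.
rewrite -ge0_integral_areaE//; last first.
  by apply: measurableT_comp => //; exact/measurable_EFinP.
apply: (@le_lt_trans _ _ (C%:E * area (square M))%E).
  apply: integral_le_const => //.
  - by apply: measurableT_comp => //; exact/measurable_EFinP.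
  - by move=> x _ _; rewrite /= lee_fin.
  - move=> x _ xS; rewrite /= fM ?normr0//; apply: contrapT => /not_orP[/negP + /negP].
    by rewrite -!ltNge => x1 x2; apply: xS; split; rewrite /= in_itv/= -ler_norml ltW.
by rewrite lte_mul_pinfty// lee_fin.
Qed.

Lemma integral_derivative_eq0 (F f : R -> R) (M : R) : 0 < M ->
  (forall t, is_derive t (1 : R) F (f t)) -> continuous f ->
  (forall t, M <= `|t| -> F t = 0 /\ f t = 0) -> (\int[mu]_t (f t)%:E = 0)%E.
Proof.
move=> M0 dF cf FM.
have cF : continuous F.
  by move=> t; apply: differentiable_continuous; apply/derivable1_diffP; case: (dF t).
transitivity (\int[mu]_(t in `[(- M)%R, M]) (f t)%:E)%E.
  rewrite [RHS]integral_mkcond; apply: eq_integral => t _; rewrite patchE; case: ifPn => //.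
  rewrite notin_setE /= in_itv/= => /negP; rewrite -ler_norml -ltNge => /ltW /FM[_ ->].
  by [].
rewrite (@continuous_FTC2 _ f F)//.
- have [-> _] := FM M ltac:(by rewrite gtr0_norm).
  have [-> _] := FM (- M) ltac:(by rewrite normrN gtr0_norm).
  by rewrite subee.
- by rewrite (lt_trans _ M0)// oppr_lt0.
- exact: continuous_subspaceT.
- split; first by move=> t _; case: (dF t).
    by apply: cvg_at_right_filter; exact: cF.
  by apply: cvg_at_left_filter; exact: cF.
- by move=> t _; rewrite derive1E; case: (dF t).
Qed.

End BoundedIntegrals.

Section TestFunctionsInH1.
Context {R : realType}.
Implicit Types (D : set (R * R)) (phi psi : R * R -> R).
Local Notation mu := (@lebesgue_measure R).

Lemma test_vanishing D phi : test_function D phi ->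
  compactly_vanishing phi /\ forall e, compactly_vanishing ('D_e phi).
Proof.
move=> /test_bound[M M0 phiM]; split; first by exists M => // x /phiM[].
by move=> e; exists M => // x /phiM[].
Qed.

Lemma continuous_mul (f g : R * R -> R) : continuous f -> continuous g ->
  continuous (fun x => f x * g x).
Proof. by move=> cf cg x; exact: (cvgM (cf x) (cg x)). Qed.

Lemma vanishing_mull (f g : R * R -> R) : compactly_vanishing f ->
  compactly_vanishing (fun x => f x * g x).
Proof. by move=> [M M0 fM]; exists M => // x /fM ->; rewrite mul0r. Qed.

(* The product phi * psi has compact support, so its derivative in the direction e
   integrates to 0 along the lines parallel to e, here a coordinate axis. *)
Lemma integration_by_parts_axis phi psi (e e' : R * R) :
  test_function setT phi -> test_function setT psi ->
  (e = (1, 0) /\ e' = (0, 1)) \/ (e = (0, 1) /\ e' = (1, 0)) ->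
  (\int[(mu \x mu)%E]_x (phi x * 'D_e psi x + 'D_e phi x * psi x)%:E = 0)%E.
Proof.
move=> tphi tpsi ee.
have cphi := test_continuous tphi; have cpsi := test_continuous tpsi.
pose dphi : R * R -> R := 'D_e phi; pose dpsi : R * R -> R := 'D_e psi.
have cdphi : continuous dphi := test_derive_continuous tphi.
have cdpsi : continuous dpsi := test_derive_continuous tpsi.
have [M M0 phiM] := test_bound tphi.
pose f (x : R * R) : R := phi x * dpsi x + dphi x * psi x.
have cf : continuous f.
  move=> x; apply: cvgD; [exact: (continuous_mul cphi cdpsi)|exact: (continuous_mul cdphi cpsi)].
have vf : compactly_vanishing f.
  by exists M => // x /phiM[p0 dp0]; rewrite /f p0 /dphi dp0 !mul0r addr0.
have intf := vanishing_integrable cf vf.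
have line s : (\int[mu]_t (f (s *: e' + t *: e))%:E = 0)%E.
  apply: (@integral_derivative_eq0 _ (fun t => phi (s *: e' + t *: e) * psi (s *: e' + t *: e)) _ M M0).
  - move=> t.
    have d1 := @is_derive_along _ phi e' e s t (test_differentiable _ tphi).
    have d2 := @is_derive_along _ psi e' e s t (test_differentiable _ tpsi).
    apply: is_derive_eq (is_deriveM d1 d2) _.
    by rewrite /f /GRing.scale/= [_ * 'D_e phi _]mulrC.
  - exact: continuous_line.
  - move=> t Mt.
    have [p0 dp0] : phi (s *: e' + t *: e) = 0 /\ forall v, 'D_v phi (s *: e' + t *: e) = 0.
      by apply: phiM; rewrite fst_comb snd_comb; case: ee => -[-> ->] /=; [left|right];
        rewrite !mulr0 !mulr1 add0r.
    by rewrite /f p0 /dphi dp0 !mul0r addr0.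
transitivity (\int[(mu \x mu)%E]_x (f x)%:E)%E; first by [].
(* The order of integration is chosen so that the inner variable runs along e. *)
case: ee => -[eE e'E].
  rewrite -(integral21_prod_meas1 intf)/=; apply: integral0_eq => y _.
  rewrite -(line y); apply: eq_integral => x _; congr (f _)%:E.
  by rewrite eE e'E [RHS]surjective_pairing fst_comb snd_comb /= !mulr0 !mulr1 add0r addr0.
rewrite -(integral12_prod_meas1 intf)/=; apply: integral0_eq => x _.
rewrite -(line x); apply: eq_integral => y _; congr (f _)%:E.
by rewrite eE e'E [RHS]surjective_pairing fst_comb snd_comb /= !mulr0 !mulr1 add0r addr0.
Qed.

Lemma test_function_sub D D' phi : D `<=` D' -> test_function D phi -> test_function D' phi.
Proof.
move=> DD' [sphi [K [cK KD K0]]]; split => //; exists K; split => //.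
exact: subset_trans DD'.
Qed.

(** [psi] and its derivatives vanish outside D, so both integrals extend to the whole plane, where
    integration by parts has no boundary term. *)
Lemma test_weak_derivative D phi psi (e e' : R * R) :
  test_function setT phi -> test_function D psi ->
  (e = (1, 0) /\ e' = (0, 1)) \/ (e = (0, 1) /\ e' = (1, 0)) ->
  area_integral D (fun x => phi x * 'D_e psi x) = - area_integral D (fun x => 'D_e phi x * psi x).
Proof.
move=> tphi tpsi ee; have [K [cK KD K0]] := test_support tpsi.
have tpsi' := test_function_sub (@subsetT _ D) tpsi.
have out x : ~ D x -> psi x = 0 /\ forall e, 'D_e psi x = 0.
  by move=> Dx; apply: K0 => /KD.
have full (g : R * R -> R) : (forall x, ~ D x -> g x = 0) ->
    (\int[(mu \x mu)%E]_(x in D) (g x)%:E = \int[(mu \x mu)%E]_x (g x)%:E)%E.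
  move=> g0; rewrite integral_mkcond; apply: eq_integral => x _; rewrite patchE.
  by case: ifPn => //; rewrite notin_setE => /g0 ->.
rewrite /area_integral /Rintegral !full; first last.
- by move=> x /out[_ ->]; rewrite mulr0.
- by move=> x /out[-> _]; rewrite mulr0.
have cphi := test_continuous tphi; have cpsi := test_continuous tpsi.
have cdphi : continuous ('D_e phi : R * R -> R) := test_derive_continuous tphi.
have cdpsi : continuous ('D_e psi : R * R -> R) := test_derive_continuous tpsi.
have [vphi vdphi] := test_vanishing tphi.
have i1 := vanishing_integrable (continuous_mul cphi cdpsi) (vanishing_mull _ vphi).
have i2 := vanishing_integrable (continuous_mul cdphi cpsi) (vanishing_mull _ (vdphi e)).
have f1 := integrable_fin_num measurableT i1; have f2 := integrable_fin_num measurableT i2.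
have := integration_by_parts_axis tphi tpsi' ee.
under eq_integral do rewrite EFinD.
rewrite (integralD measurableT i1 i2) -(fineK f1) -(fineK f2) -EFinD => -[] /eqP.
by rewrite addr_eq0 => /eqP.
Qed.

Lemma test_H1 D phi : measurable D -> test_function setT phi ->
  H1 D phi (partial1 phi, partial2 phi).
Proof.
move=> mD tphi; have [vphi vdphi] := test_vanishing tphi.
split => /=.
- by apply: vanishing_sqint => //; exact: test_continuous tphi.
- by apply: vanishing_sqint; [|exact: test_derive_continuous tphi|exact: vdphi].
- by apply: vanishing_sqint; [|exact: test_derive_continuous tphi|exact: vdphi].
- move=> psi tpsi; split.
    by apply: (test_weak_derivative tphi tpsi); left; split; reflexivity.
  by apply: (test_weak_derivative tphi tpsi); right; split; reflexivity.
Qed.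

Lemma sqint_sub_self (m : {measure set (R * R) -> \bar R}) D phi :
  sqint m D (phi \- phi) = 0%E.
Proof. by apply: integral0_eq => x _; rewrite /= subrr expr0n. Qed.

Lemma test_trace D phi (nu : {measure set (R * R) -> \bar R}) :
  measurable (frontier D) -> test_function setT phi ->
  (forall f : R * R -> \bar R,
    \int[hausdorff1]_(x in frontier D) f x = \int[nu]_(x in frontier D) f x)%E ->
  (sqint hausdorff1 (frontier D) phi < +oo)%E ->
  trace D phi (partial1 phi, partial2 phi) phi.
Proof.
move=> mF tphi Hnu Hphi; split.
  split => //; apply: measurable_funTS; apply: plane_continuous_measurable.
  exact: test_continuous tphi.
have H0 : sqint hausdorff1 (frontier D) (phi \- phi) = 0%E.
  by rewrite /sqint Hnu; exact: sqint_sub_self.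
by exists (fun=> phi); split => //=; rewrite ?H0 ?sqint_sub_self; exact: cvg_cst.
Qed.

(** [phi] is its own trace, through the constant sequence. Division by its squared L^2 norm turns
    the slack [rho] in the energy inequality into a slack in the quotient. *)
Lemma Lambda_le_test D phi (c rho : R) (nu : {measure set (R * R) -> \bar R}) :
  measurable D -> measurable (frontier D) -> test_function setT phi ->
  (forall f : R * R -> \bar R,
    \int[hausdorff1]_(x in frontier D) f x = \int[nu]_(x in frontier D) f x)%E ->
  (sqint hausdorff1 (frontier D) phi < +oo)%E -> (0 < sqint area D phi)%E ->
  (energy c D phi <= sqint hausdorff1 (frontier D) phi + rho%:E * sqint area D phi)%E ->
  (Lambda D 1 <= (- c ^+ 2 + rho)%:E)%E.
Proof.
move=> mD mF tphi Hnu Hphi Vphi Ephi.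
have [[mv v2] [_ p1] [_ p2] _] := test_H1 mD tphi.
apply: (@le_trans _ _ (robin_quotient D 1 phi (partial1 phi, partial2 phi) phi)%:E).
  apply: ereal_inf_lbound; exists phi, (partial1 phi, partial2 phi), phi; split => //.
  - exact: test_H1.
  - exact: test_trace Hnu Hphi.
  - move=> ae0; move: Vphi; suff -> : sqint area D phi = 0%E by rewrite ltxx.
    have msq : measurable_fun D (fun x => ((phi x) ^+ 2)%:E).
      by apply/measurable_EFinP; exact: measurable_funX.
    rewrite /sqint ge0_integral_areaE//; last by move=> x _; rewrite lee_fin sqr_ge0.
    transitivity (\int[(mu \x mu)%E]_(x in D) (cst 0 x))%E; last exact: integral0.
    apply: ae_eq_integral => //.
    case: ae0 => A [mA A0 AN]; exists A; split => // x /= h; apply: AN => /= h'.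
    by apply: h => Dx; rewrite h'// expr0n.
have fin (z : \bar R) : (0 <= z)%E -> (z < +oo)%E -> exists2 r : R, 0 <= r & z = r%:E.
  by move=> z0 zy; exists (fine z); [exact: fine_ge0|rewrite fineK// ge0_fin_numE].
have sq_ge0 (m : {measure set (R * R) -> \bar R}) A f : (0 <= sqint m A f)%E.
  by apply: integral_ge0 => x _; rewrite lee_fin sqr_ge0.
have [V V0 VE] := fin _ (sq_ge0 area D phi) v2.
have [P1 P10 P1E] := fin _ (sq_ge0 area D (partial1 phi)) p1.
have [P2 P20 P2E] := fin _ (sq_ge0 area D (partial2 phi)) p2.
have [B B0 BE] : exists2 B : R, 0 <= B & sqint hausdorff1 (frontier D) phi = B%:E.
  by apply: fin => //; rewrite /sqint Hnu; exact: sq_ge0.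
move: Ephi Vphi; rewrite energyE// /robin_quotient/= VE P1E P2E BE/= !lte_fin -!EFinM -!EFinD !lee_fin.
by move=> h V_gt0; rewrite ler_pdivrMr// mul1r mulrDl mulNr; lra.
Qed.

End TestFunctionsInH1.

(** * Upper bound *)

Section TrialFunctions.
Context {R : realType}.
Implicit Types (x e q u v : R * R).
Local Notation mu := (@lebesgue_measure R).

Lemma elementary_dot e : elementary (fun x => dot x e).
Proof.
by apply: elementary_add; apply: elementary_mul => //;
  do ?[exact: elementary_fst|exact: elementary_snd|exact: elementary_cst].
Qed.

Lemma derive_dot e v x : 'D_v (fun x => dot x e) x = dot v e.
Proof.
have df y : differentiable (fun x => dot x e) y by case: (elementary_derive (elementary_dot e)).
have := @is_derive_along _ (fun x => dot x e) x v 1 0 (df _).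
rewrite (_ : 1 *: x + 0 *: v = x); last by rewrite scale1r scale0r addr0.
move=> d1.
have d2 : is_derive (0 : R) (1 : R) (fun t : R => dot (1 *: x + t *: v) e) (dot v e).
  rewrite (_ : (fun t : R => _) = fun t => dot x e + t * dot v e).
    apply: is_derive_eq (is_deriveD (is_derive_cst _ _ _) (is_deriveM (is_derive_id _ _) (is_derive_cst _ _ _))) _.
    by rewrite /GRing.scale/= mulr1 mulr0 !add0r.
  by apply/funext => t; rewrite scale1r -[x in LHS]scale1r dot_combl mul1r.
by case: d1 => _ <-; case: d2 => _ <-.
Qed.

Lemma derive_of_dot (g g' : R -> R) e v x : (forall t, is_derive t (1 : R) g (g' t)) ->
  differentiable (fun x => g (dot x e)) x /\
  'D_v (fun x => g (dot x e)) x = g' (dot x e) * dot v e.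
Proof.
move=> dg; have [df _] := elementary_derive (elementary_dot e).
by have [? ->] := derive_outer v dg (df x); rewrite derive_dot.
Qed.

Lemma is_derive_affine (g g' : R -> R) (r s t : R) : (forall t, is_derive t (1 : R) g (g' t)) ->
  is_derive t (1 : R) (fun t => g (t * r + s)) (g' (t * r + s) * r).
Proof.
move=> dg; have dl : is_derive t (1 : R) (fun t : R => t * r + s) r.
  apply: is_derive_eq (is_deriveD (is_deriveM (is_derive_id t _) (is_derive_cst r t _)) (is_derive_cst s t _)) _.
  by rewrite /GRing.scale/= mulr1 mulr0 add0r addr0.
exact: (@is_derive1_comp _ g _ t _ _ (dg _) dl).
Qed.

(* The function exp(-c q.x), for which the remainder in cone_identity vanishes,
   cut off at distance N. The arguments have the shape t * r + s of
   is_derive_affine. *)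
Definition trial (c : R) q u1 u2 (m k N : R) x : R :=
  expR (dot x q * - c + 0) *
    (bump (dot x u1 * N^-1 + - m) * bump (dot x u2 * (k / N) + 0)).

(** The first summand comes from the exponential. In the remainder of [cone_identity] it cancels
    against c phi for v = q and vanishes for v orthogonal to q, so only the derivatives of the
    cut-off are left. *)
Lemma trial_derive (c : R) q u1 u2 (m k N : R) v x :
  'D_v (trial c q u1 u2 m k N) x =
    - c * dot v q * trial c q u1 u2 m k N x +
    expR (dot x q * - c + 0) *
      (N^-1 * dot v u1 * bump' (dot x u1 * N^-1 + - m) * bump (dot x u2 * (k / N) + 0) +
       k / N * dot v u2 * bump (dot x u1 * N^-1 + - m) * bump' (dot x u2 * (k / N) + 0)).
Proof.
pose f0 x := expR (dot x q * - c + 0).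
pose f1 x := bump (dot x u1 * N^-1 + - m); pose f2 x := bump (dot x u2 * (k / N) + 0).
have [d0 D0] := derive_of_dot q v x (fun t => is_derive_affine (- c) 0 t (@is_derive_expR R)).
have [d1 D1] := derive_of_dot u1 v x (fun t => is_derive_affine N^-1 (- m) t is_derive_bump).
have [d2 D2] := derive_of_dot u2 v x (fun t => is_derive_affine (k / N) 0 t is_derive_bump).
have -> : trial c q u1 u2 m k N = f0 * (f1 * f2) by [].
have d12 : differentiable (f1 * f2) x by exact: differentiableM.
have dv (f : R * R -> R) : differentiable f x -> derivable f x v by exact: diff_derivable.
rewrite (deriveM (dv _ d0) (dv _ d12)) (deriveM (dv _ d1) (dv _ d2)).
rewrite [X in X = _](_ : _ = f0 x * (f1 x * 'D_v f2 x + f2 x * 'D_v f1 x) + (f1 x * f2 x) * 'D_v f0 x)//.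
rewrite [_ x in RHS](_ : _ = f0 x * (f1 x * f2 x))//.
rewrite /f0 /f1 /f2 D0 D1 D2.
move: (expR _) (bump' _) (bump' _) (bump _) (bump _) => E b1' b2' b1 b2; ring.
Qed.

Lemma trial_outside (c : R) q u1 u2 (m k N : R) x :
  3 / 2 <= `|dot x u1 * N^-1 + - m| \/ 3 / 2 <= `|dot x u2 * (k / N) + 0| ->
  trial c q u1 u2 m k N x = 0 /\ forall v, 'D_v (trial c q u1 u2 m k N) x = 0.
Proof.
move=> out; suff t0 : trial c q u1 u2 m k N x = 0.
  split => // v; rewrite trial_derive t0.
  by case: out => /bump_outside[-> ->]; rewrite !(mulr0, mul0r, addr0).
by rewrite /trial; case: out => /bump_outside[-> _]; rewrite !(mulr0, mul0r).
Qed.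

Lemma trial_test (c : R) q u1 u2 (m k N : R) : orthonormal u1 u2 -> 0 < k -> 0 < N ->
  test_function setT (trial c q u1 u2 m k N).
Proof.
move=> ou k0 N0; split.
  apply: elementary_smooth.
  have lin e r s : elementary (fun x => dot x e * r + s).
    apply: elementary_add; last exact: elementary_cst.
    by apply: elementary_mul; [exact: elementary_dot|exact: elementary_cst].
  apply: elementary_mul; first exact/elementary_expR/lin.
  by apply: elementary_mul; apply: elementary_bump; exact: lin.
(* On the support |x.u1| <= N (3/2 + |m|) and |x.u2| <= (N / k) 3/2; the coordinates of the unit
   vectors u1 and u2 are at most 1 in absolute value. *)
pose M := N * (3 / 2 + `|m|) + N / k * (3 / 2).
exists (square M); split => //; first by apply: compact_setX; exact: segment_compact.
move=> x xM; apply: (proj1 (@trial_outside c q u1 u2 m k N x _)).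
apply: contrapT => /not_orP[/negP + /negP]; rewrite -!ltNge addr0 => h1 h2.
have b1 : `|dot x u1| <= N * (3 / 2 + `|m|).
  rewrite mulrC -ler_pdivrMr//.
  have -> : `|dot x u1| / N = `|dot x u1 * N^-1| by rewrite normrM [`|N^-1|]gtr0_norm// invr_gt0.
  rewrite -[dot x u1 * N^-1](subrK m) (le_trans (ler_normD _ _))// lerD2r.
  exact: ltW.
have b2 : `|dot x u2| <= N / k * (3 / 2).
  rewrite mulrC -ler_pdivrMr ?divr_gt0// invf_div.
  by move: h2; rewrite normrM [`|k / N|]gtr0_norm ?divr_gt0// => /ltW.
have [u11 u22 _] := ou.
have le1 e : dot e e = 1 -> `|e.1| <= 1 /\ `|e.2| <= 1.
  move=> ee; have := sqr_ge0 e.1; have := sqr_ge0 e.2; move: ee; rewrite /dot -!expr2 => ee s1 s2.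
  by split; rewrite -(@ler_pXn2r _ 2) ?nnegrE// expr1n real_normK ?num_real//; lra.
have [u1a u1b] := le1 _ u11; have [u2a u2b] := le1 _ u22.
apply: xM; rewrite (orthonormal_decomposition x ou).
have coord (a b : R) : `|a| <= 1 -> `|b| <= 1 -> `|dot x u1 * a + dot x u2 * b| <= M.
  move=> a1 b1'; rewrite (le_trans (ler_normD _ _))// !normrM /M.
  by apply: lerD; rewrite -[leRHS]mulr1 ler_pM.
by split; rewrite /= in_itv/= -ler_norml; exact: coord.
Qed.

(** 8 bounds the derivative of [bump], and 1/N and k/N are the scales of its two arguments. *)
Lemma trial_derive_le (c : R) q u1 u2 (m k N : R) v x : orthonormal u1 u2 -> dot v v = 1 ->
  0 < k -> 0 < N ->
  `|'D_v (trial c q u1 u2 m k N) x + c * dot v q * trial c q u1 u2 m k N x| <=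
    expR (dot x q * - c + 0) * (8 * (1 + k) / N).
Proof.
move=> ou vv k0 N0; rewrite trial_derive !mulNr addrAC addNr add0r.
have E0 := expR_gt0 (dot x q * - c + 0).
rewrite normrM gtr0_norm// ler_pM2l//.
have v1 : `|dot v u1| <= 1 /\ `|dot v u2| <= 1.
  have := orthonormal_dotE v ou; rewrite vv => v2.
  have := sqr_ge0 (dot v u1); have := sqr_ge0 (dot v u2) => s1 s2.
  by split; rewrite -(@ler_pXn2r _ 2) ?nnegrE// expr1n real_normK ?num_real//; lra.
have [b1 b1'] := bump_bounds (dot x u1 * N^-1 + - m).
have [b2 b2'] := bump_bounds (dot x u2 * (k / N) + 0).
rewrite (le_trans (ler_normD _ _))//.
rewrite (_ : 8 * (1 + k) / N = N^-1 * 1 * 8 * 1 + k / N * 1 * 1 * 8); last ring.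
have bn (b : R) : 0 <= b <= 1 -> `|b| <= 1 by move=> /andP[b0 ?]; rewrite ger0_norm.
have Ni : `|N^-1| <= N^-1 by rewrite gtr0_norm ?invr_gt0.
have ki : `|k / N| <= k / N by rewrite gtr0_norm ?divr_gt0.
have mul (y z Y Z : R) : `|y| <= Y -> `|z| <= Z -> `|y * z| <= Y * Z.
  by move=> yY zZ; rewrite normrM ler_pM.
by case: v1 => v1 v2; apply: lerD; apply: (mul _ _ _ _ (mul _ _ _ _ (mul _ _ _ _ _ _) _) _) => //; exact: bn.
Qed.

(** L bounds the squared exponential where the cut-off is not constant. There each of the two
    squares of the remainder is at most (8 (1 + k) / N)^2 L, on a box of sides 3 N and 3 N / k; the
    powers of N cancel, so the error is independent of N except through L. *)
Lemma trial_energy_cone (c : R) J a q u1 u2 (m k N L : R) : orthonormal u1 u2 ->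
  measurable J -> dot q q = 1 -> 0 < c -> c = `|cross a q|^-1 -> 0 < k -> 0 < N -> 0 <= L ->
  (forall x, cone J a q x -> `|dot x u1 * N^-1 + - m| <= 3 / 2 ->
    `|dot x u2 * (k / N) + 0| <= 3 / 2 ->
    1 < `|dot x u1 * N^-1 + - m| \/ 1 < `|dot x u2 * (k / N) + 0| ->
    expR (dot x q * - c + 0) ^+ 2 <= L) ->
  (energy c (cone J a q) (trial c q u1 u2 m k N) <=
    \int[mu]_(s in J) ((trial c q u1 u2 m k N (s *: a)) ^+ 2)%:E +
    (2 * (8 * (1 + k)) ^+ 2 * (9 / k) * L)%:E)%E.
Proof.
move=> ou mJ qq c0 cE k0 N0 L0 decay; set T := trial _ _ _ _ _ _ _.
have tT : test_function setT T by exact: trial_test.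
have d0 : cross a q != 0 by rewrite -normr_eq0 -invr_eq0 -cE gt_eqF.
pose q' : R * R := (- q.2, q.1).
have q'q' : dot q' q' = 1 by rewrite -[RHS]qq /q' /dot/=; ring.
have qq' : dot q q' = 0 by rewrite /q' /dot/=; ring.
have mC : measurable (cone J a q) by exact: cone_measurable.
rewrite /energy ge0_integral_areaE//; last 2 first.
- by apply: measurable_funTS; exact: energy_measurable.
- by move=> x _; exact: energy_density_ge0.
rewrite (@cone_identity _ setT T J a q q' c)//.
rewrite leeD2l//.
pose r (x : R * R) : R := ('D_q T x + c * T x) ^+ 2 + ('D_q' T x) ^+ 2.
have mr : measurable_fun [set: R * R] (fun x => (r x)%:E).
  apply/measurable_EFinP; apply: plane_continuous_measurable => x.
  have cT := test_continuous tT.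
  have cq : continuous ('D_q T : R * R -> R) := test_derive_continuous tT.
  have cq' : continuous ('D_q' T : R * R -> R) := test_derive_continuous tT.
  have h y : {for y, continuous (fun x => 'D_q T x + c * T x : R)}.
    by apply: cvgD; [exact: cq|apply: cvgM; [exact: cvg_cst|exact: cT]].
  by apply: cvgD; [exact: (continuous_mul h h)|exact: (continuous_mul cq' cq')].
have r0 x : 0 <= r x by rewrite addr_ge0 ?sqr_ge0.
have r_out x : 3 / 2 <= `|dot x u1 * N^-1 + - m| \/ 3 / 2 <= `|dot x u2 * (k / N) + 0| ->
    r x = 0.
  by move=> /trial_outside out; have [T0 DT0] := out c q; rewrite /r !DT0 /T T0 mulr0 addr0 expr0n/= addr0.
rewrite -[leLHS](_ : (\int[area]_(x in cone J a q) (r x)%:E = _)%E); last first.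
  rewrite ge0_integral_areaE//; first exact: measurable_funTS.
  by move=> x _; rewrite lee_fin.
pose I1 : set R := `[(m - 3 / 2) * N, (m + 3 / 2) * N]%classic.
pose I2 : set R := `[- (3 / 2) * (N / k), 3 / 2 * (N / k)]%classic.
have [mB aB] := @area_orthonormal_box _ u1 u2 I1 I2 ou ltac:(exact: measurable_itv) ltac:(exact: measurable_itv).
set B := [set x | _] in mB aB.
have NE : N * N^-1 = 1 by rewrite mulfV// gt_eqF.
have inB x : ~ B x -> 3 / 2 <= `|dot x u1 * N^-1 + - m| \/ 3 / 2 <= `|dot x u2 * (k / N) + 0|.
  move=> nB; apply: contrapT => /not_orP[/negP + /negP]; rewrite -!ltNge addr0 !ltr_norml.
  move=> /andP[h1 h2] /andP[h3 h4]; apply: nB; split; rewrite /I1 /I2 /= in_itv/=.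
    by apply/andP; split; [rewrite -ler_pdivlMr//|rewrite -ler_pdivrMr//]; lra.
  have Nk0 : 0 < N / k by rewrite divr_gt0.
  by apply/andP; split; [rewrite -ler_pdivlMr//|rewrite -ler_pdivrMr//]; rewrite invf_div; lra.
apply: (@le_trans _ _ ((2 * (8 * (1 + k) / N) ^+ 2 * L)%:E * area B)%E).
  apply: integral_le_const => //.
  - exact: measurable_funTS.
  - by move=> x _; rewrite lee_fin.
  - by rewrite mulr_ge0// mulr_ge0// sqr_ge0.
  - move=> x Cx _; rewrite lee_fin.
    have bound0 : 0 <= 2 * (8 * (1 + k) / N) ^+ 2 * L by rewrite mulr_ge0// mulr_ge0// sqr_ge0.
    have [far1|far1] := ltP (3 / 2) `|dot x u1 * N^-1 + - m|.
      by rewrite (r_out _ (or_introl (ltW far1))).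
    have [far2|far2] := ltP (3 / 2) `|dot x u2 * (k / N) + 0|.
      by rewrite (r_out _ (or_intror (ltW far2))).
    have D1 := trial_derive_le c q m x ou qq k0 N0.
    have D2 := trial_derive_le c q m x ou q'q' k0 N0.
    rewrite qq mulr1 in D1; rewrite dotC qq' mulr0 mul0r addr0 in D2.
    have final : expR (dot x q * - c + 0) ^+ 2 <= L -> r x <= 2 * (8 * (1 + k) / N) ^+ 2 * L.
      move=> EL; have S0 : 0 <= expR (dot x q * - c + 0) * (8 * (1 + k) / N).
        by rewrite (le_trans _ D1).
      have sq (z : R) : `|z| <= expR (dot x q * - c + 0) * (8 * (1 + k) / N) ->
          z ^+ 2 <= (8 * (1 + k) / N) ^+ 2 * L.
        move=> zS; rewrite -real_normK ?num_real//.
        rewrite (@le_trans _ _ ((expR (dot x q * - c + 0) * (8 * (1 + k) / N)) ^+ 2))//.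
          by rewrite ler_pXn2r ?nnegrE.
        by rewrite exprMn mulrC ler_wpM2l// sqr_ge0.
      by rewrite -mulrA mulr_natl mulr2n; apply: lerD; exact: sq.
    have [p1|p1] := ltP 1 `|dot x u1 * N^-1 + - m|; first by apply/final/decay => //; left.
    have [p2|p2] := ltP 1 `|dot x u2 * (k / N) + 0|; first by apply/final/decay => //; right.
    have -> : r x = 0; last by [].
    have [_ b1'] := @bump_plateau _ (dot x u1 * N^-1 + - m) ltac:(by rewrite -ler_norml).
    have [_ b2'] := @bump_plateau _ (dot x u2 * (k / N) + 0) ltac:(by rewrite -ler_norml).
    rewrite /r !trial_derive b1' b2' qq [dot q' q]dotC qq' /T; ring.
  - move=> x _ /inB /r_out ->; reflexivity.
rewrite aB /I1 /I2 !lebesgue_measure_itv/= !lte_fin.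
rewrite ifT; last by rewrite ltr_pM2r//; lra.
rewrite ifT; last by rewrite ltr_pM2r ?divr_gt0//; lra.
rewrite -!EFinB -!EFinM lee_fin le_eqVlt; apply/orP; left; apply/eqP.
by field; rewrite !gt_eqF.
Qed.

(** The order of quantifiers matters: P does not depend on N, so the mass bound V can be fixed
    before N is chosen. *)
Lemma trial_plateau : exists2 P : R, 0 < P & forall (c : R) q u1 u2 (m k N : R) x,
  -1 <= dot x u1 * N^-1 + - m <= 1 -> -1 <= dot x u2 * (k / N) + 0 <= 1 ->
  trial c q u1 u2 m k N x = expR (dot x q * - c + 0) * P.
Proof.
have p0 := @plateau_gt0 R; set p := _ ^+ 2 in p0; exists (p * p); first exact: mulr_gt0.
by move=> c q u1 u2 m k N x /bump_plateau[b1 _] /bump_plateau[b2 _]; rewrite /trial b1 b2.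
Qed.

End TrialFunctions.

(** * The value of Lambda on an angle *)

Section LambdaOfAngle.
Context {R : realType}.
Implicit Types (x e q : R * R) (D : set (R * R)) (phi : R * R -> R).
Local Notation mu := (@lebesgue_measure R).

Lemma Lambda_extremal D (c : R) (nu : {measure set (R * R) -> \bar R}) :
  measurable D -> measurable (frontier D) ->
  (forall f : R * R -> \bar R,
    \int[hausdorff1]_(x in frontier D) f x = \int[nu]_(x in frontier D) f x)%E ->
  (forall phi, test_function setT phi ->
    sqint hausdorff1 (frontier D) phi <= energy c D phi)%E ->
  (forall rho : R, 0 < rho -> exists phi, [/\ test_function setT phi, (0 < sqint area D phi)%E &
    (energy c D phi <= sqint hausdorff1 (frontier D) phi + rho%:E * sqint area D phi)%E]) ->
  Lambda D 1 = (- c ^+ 2)%:E.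
Proof.
move=> mD mF Hnu lower upper; apply/eqP; rewrite eq_le; apply/andP; split.
  apply/lee_addgt0Pr => rho rho0; have [phi [tphi V0 Ephi]] := upper _ rho0.
  rewrite -EFinD; apply: (Lambda_le_test mD mF tphi Hnu _ V0 Ephi).
  (* The lower bound also yields that the boundary integral of the test function is finite, because
     its energy is. *)
  apply: (le_lt_trans (lower _ tphi)).
  have [[_ v2] [_ p1] [_ p2] _] := test_H1 mD tphi.
  have lt3 (A B C : \bar R) : (A < +oo -> B < +oo -> C < +oo -> A + B + C < +oo)%E.
    by move=> A1 B1 C1; apply: lte_add_pinfty => //; exact: lte_add_pinfty.
  rewrite energyE//; apply: (lt3 _ _ _ p1 p2).
  by apply: lte_mul_pinfty => //; rewrite lee_fin sqr_ge0.
apply: le_ereal_inf_tmp => _ [v [p [g [Hv tr v_n0 ->]]]]; rewrite lee_fin.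
have lower' phi : test_function setT phi -> (sqint nu (frontier D) phi <= energy c D phi)%E.
  by move=> tphi; rewrite /sqint -Hnu; exact: lower.
have E := trace_energy mD mF Hnu lower' Hv tr.
have [[mv v2] _ _ _] := Hv.
have V_ge0 : (0 <= sqint area D v)%E by apply: integral_ge0 => x _; rewrite lee_fin sqr_ge0.
have V0 : 0 < fine (sqint area D v).
  rewrite fine_gt0// v2 andbT lt_neqAle V_ge0 andbT eq_sym; apply/eqP => V0; apply: v_n0.
  have msq : measurable_fun D (fun x => ((v x) ^+ 2)%:E).
    by apply/measurable_EFinP; exact: measurable_funX.
  rewrite /sqint ge0_integral_areaE// in V0; last by move=> x _; rewrite lee_fin sqr_ge0.
  have /(ae_eq_integral_abs (mu \x mu)%E mD msq) : (\int[(mu \x mu)%E]_(x in D) `|((v x) ^+ 2)%:E| = 0)%E.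
    by rewrite -[RHS]V0; apply: eq_integral => x _; rewrite gee0_abs// lee_fin sqr_ge0.
  apply: filterS => x h Dx; have /= [] := h Dx.
  by move=> /eqP; rewrite sqrf_eq0 => /eqP.
rewrite /robin_quotient ler_pdivlMr// mul1r mulNr; lra.
Qed.

Lemma wedge_boundary (alpha : R) e1 e2 : 0 < alpha -> alpha < pi -> orthonormal e1 e2 ->
  [/\ measurable (wedge alpha e1), measurable (frontier (wedge alpha e1)) &
  exists nu : {measure set (R * R) -> \bar R},
    (forall f : R * R -> \bar R,
    \int[hausdorff1]_(x in frontier (wedge alpha e1)) f x =
    \int[nu]_(x in frontier (wedge alpha e1)) f x)%E /\
    forall phi, test_function setT phi ->
    (sqint hausdorff1 (frontier (wedge alpha e1)) phi =
     \int[mu]_(s in `[0%R, +oo[) ((phi (s *: ray alpha e1 e2)) ^+ 2)%:E +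
     \int[mu]_(s in `[0%R, +oo[) ((phi (s *: ray_neg alpha e1 e2)) ^+ 2)%:E)%E].
Proof.
move=> a0 api oe; have s0 : 0 < sin alpha by apply: sin_gt0_pi; rewrite a0 api.
have [oD FE] := frontier_angle a0 api oe.
have mD : measurable (wedge alpha e1) by exact: plane_open_measurable.
have mF : measurable (frontier (wedge alpha e1)).
  apply: measurableD; last by apply: plane_open_measurable; exact: open_interior.
  by rewrite -[closure _]setCK; apply: measurableC; apply: plane_open_measurable;
    apply: closed_openC; exact: closed_closure.
have ab : dot (ray alpha e1 e2) (ray_neg alpha e1 e2) < 1.
  have [d1 d2] := dot_combE (cos alpha) (- sin alpha) oe.
  rewrite /ray dot_combl ray_negE [dot e1 _]dotC [dot e2 _]dotC d1 d2 mulrN -!expr2 cos2sin2.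
  by have := exprn_gt0 2 s0; lra.
split => //; rewrite FE in mF *.
have [nu [nuE nuI]] := hausdorff1_two_rays_measure (ray_unit alpha oe) (ray_neg_unit alpha oe) ab mF.
exists nu; split => // phi tphi; rewrite /sqint nuE nuI//.
  apply: measurable_funTS; apply/measurable_EFinP; apply: measurable_funX.
  by apply: plane_continuous_measurable; exact: test_continuous tphi.
by move=> x; rewrite lee_fin sqr_ge0.
Qed.

Lemma Lambda_sharp_wedge (alpha : R) e1 e2 : 0 < alpha -> alpha < pi -> orthonormal e1 e2 ->
  0 < cos alpha -> Lambda (wedge alpha e1) 1 = (- (sin alpha)^-1 ^+ 2)%:E.
Proof.
move=> a0 api oe c0; have s0 : 0 < sin alpha by apply: sin_gt0_pi; rewrite a0 api.
have [mD mF [nu [Hnu BE]]] := wedge_boundary a0 api oe.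
have [DE disj cr1 cr2] := sharp_wedge_cones oe s0 (ltW c0).
have [e11 e22 e12] := oe.
set D := wedge alpha e1 in mD mF Hnu BE DE *; set c := (sin alpha)^-1.
have c_gt0 : 0 < c by rewrite invr_gt0.
have c1 : c = `|cross (ray alpha e1 e2) e1|^-1 by rewrite cr1.
have c2 : c = `|cross (ray_neg alpha e1 e2) e1|^-1 by rewrite cr2.
apply: (Lambda_extremal mD mF Hnu).
  by move=> phi tphi; rewrite BE//; apply: (energy_two_cones tphi mD e11 e11 c_gt0 c1 c2 _ disj); rewrite -DE.
move=> rho rho0.
have [P P0 plateau] := @trial_plateau R.
have cos1 : cos alpha < 1.
  by have := cos_abs_lt1 a0 api; rewrite ltr_norml => /andP[].
(* For X > 1/2 and |Y| < h one has cos alpha (X + |Y|) < X, so the box 1/2 < X < 1, |Y| < h lies in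
   the angle. *)
pose h := (1 - cos alpha) / 2.
have h0 : 0 < h by rewrite divr_gt0// subr_gt0.
(* A lower bound for the mass that is uniform in N >= 1: the box has area h, lies in the plateau,
   and the exponential is at least exp(-c) on it. *)
pose V := (expR (- c) * P) ^+ 2 * h.
have V0 : 0 < V by rewrite mulr_gt0// exprn_gt0// mulr_gt0// expR_gt0.
pose C : R := 2 * (8 * (1 + 1)) ^+ 2 * (9 / 1).
have C0 : 0 < C by rewrite /C; lra.
(* The two cones leave an error 2 C L with L <= 1 / (N c cos alpha); this N makes it at most rho
   V. *)
pose N := 1 + 2 * C / (rho * V * (c * cos alpha)).
have K0 : 0 < c * cos alpha by rewrite mulr_gt0.
have C2 : 0 < 2 * C by rewrite mulr_gt0.
have N1 : 1 <= N by rewrite lerDl ltW// (divr_gt0 C2)// (mulr_gt0 _ K0)// mulr_gt0.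
have N0 : 0 < N by rewrite (lt_le_trans _ N1).
pose L := expR (- (N * cos alpha * c)) ^+ 2.
have tT := trial_test c e1 0 oe ltr01 N0.
have decay x : D x -> `|dot x e1 * N^-1 + - 0| <= 3 / 2 ->
    `|dot x e2 * (1 / N) + 0| <= 3 / 2 ->
    1 < `|dot x e1 * N^-1 + - 0| \/ 1 < `|dot x e2 * (1 / N) + 0| ->
    expR (dot x e1 * - c + 0) ^+ 2 <= L.
  (* The cut-off is only felt where |x| > N, and there x.e1 > N cos alpha. *)
  rewrite /D /wedge/= oppr0 !addr0 mul1r !normrM normfV (gtr0_norm N0) => Dx _ _ far.
  have Nx : N < enorm x.
    case: far; rewrite ltr_pdivlMr// mul1r => far; apply: (lt_le_trans far).
      exact: abs_dot_le_enorm oe.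
    by apply: (@abs_dot_le_enorm _ e2 e1); split => //; rewrite dotC.
  rewrite /L ler_pXn2r ?nnegrE ?expR_ge0// ler_expR mulrN lerN2 ler_pM2r//.
  by rewrite (le_trans _ (ltW Dx))// mulrC ler_pM2l// ltW.
exists (trial c e1 e1 e2 0 1 N).
have VT : (V%:E <= sqint area D (trial c e1 e1 e2 0 1 N))%E.
  have [mB aB] := @area_orthonormal_box _ e1 e2 `]2^-1, 1[%classic `]- h, h[%classic oe
    ltac:(exact: measurable_itv) ltac:(exact: measurable_itv).
  set B := [set x | _] in mB aB.
  have -> : V%:E = (((expR (- c) * P) ^+ 2)%:E * area B)%E.
    rewrite aB !lebesgue_measure_itv/= !lte_fin ifT; last lra.
    rewrite ifT; last lra.
    by rewrite -!EFinB -!EFinM; congr EFin; rewrite /V; field.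
  apply: integral_ge_const => //.
  - move=> x []; rewrite /= !in_itv/= => /andP[X1 X2]; rewrite -ltr_norml => Y.
    have nx : enorm x <= dot x e1 + `|dot x e2|.
      have S0 : 0 <= dot x e1 + `|dot x e2| by rewrite addr_ge0//; lra.
      rewrite -[leRHS]ger0_norm// -sqrtr_sqr /enorm ler_sqrt ?sqr_ge0//.
      have : 0 <= dot x e1 * `|dot x e2| by rewrite mulr_ge0//; lra.
      have : `|dot x e2| ^+ 2 = dot x e2 ^+ 2 by rewrite real_normK ?num_real.
      rewrite (orthonormal_dotE x oe); lra.
    rewrite /D /wedge/= (@le_lt_trans _ _ (cos alpha * (dot x e1 + `|dot x e2|)))//.
      by rewrite ler_pM2l.
    have : cos alpha * `|dot x e2| < 1 * h.
      by rewrite ltr_pM// ltW.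
    have : 0 < (dot x e1 - 2^-1) * (1 - cos alpha) by rewrite mulr_gt0// subr_gt0.
    rewrite /h; lra.
  - apply/measurable_EFinP; apply: measurable_funX; apply: measurable_funTS.
    by apply: plane_continuous_measurable; exact: test_continuous tT.
  - by move=> x _; rewrite lee_fin sqr_ge0.
  - exact: sqr_ge0.
  - move=> x []; rewrite /= !in_itv/= => /andP[X1 X2] /andP[Y1 Y2]; rewrite lee_fin.
    have NV : N^-1 <= 1 by rewrite invf_le1.
    have NV0 : 0 < N^-1 by rewrite invr_gt0.
    have small (z : R) : `|z| <= 1 -> -1 <= z * N^-1 <= 1.
      by move=> z1; rewrite -ler_norml normrM (gtr0_norm NV0) mulr_ile1// ltW.
    rewrite plateau; last 2 first.
    + by rewrite oppr0 addr0; apply: small; rewrite ler_norml; lra.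
    + by rewrite mul1r addr0; apply: small; rewrite ler_norml; move: Y1 Y2; rewrite /h; lra.
    have PE (z : R) : expR z * P \is Num.nneg by rewrite nnegrE mulr_ge0 ?expR_ge0// ltW.
    rewrite ler_pXn2r ?PE// ler_pM2r// ler_expR addr0 mulrN lerN2 -[leRHS]mul1r ler_pM2r//; exact: ltW.
split => //; first by rewrite (lt_le_trans _ VT)// lte_fin.
rewrite BE//.
have E1 := @trial_energy_cone _ c `[0, +oo[ (ray alpha e1 e2) e1 e1 e2 0 1 N L oe
  (measurable_itv _) e11 c_gt0 c1 ltr01 N0 (sqr_ge0 _).
have E2 := @trial_energy_cone _ c `]0, +oo[ (ray_neg alpha e1 e2) e1 e1 e2 0 1 N L oe
  (measurable_itv _) e11 c_gt0 c2 ltr01 N0 (sqr_ge0 _).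
have {}E1 := E1 (fun x Cx => decay x ltac:(by rewrite DE; left)).
have {}E2 := E2 (fun x Cx => decay x ltac:(by rewrite DE; right)).
rewrite integral_ray_open in E2; last exact: test_continuous tT.
rewrite /energy {1}DE ge0_integral_setU//; first last.
- exact/disj_set2P.
- by move=> x _; exact: energy_density_ge0.
- by apply: measurable_funTS; exact: energy_measurable.
- exact: cone_measurable.
- exact: cone_measurable.
apply: (le_trans (leeD E1 E2)).
rewrite addeACA; apply: leeD => //.
apply: (@le_trans _ _ (rho * V)%:E); last first.
  by rewrite EFinM; apply: lee_wpmul2l => //; rewrite lee_fin ltW.
rewrite -EFinD lee_fin -/C -mulrDr -mulr2n -mulr_natl mulrA [C * 2]mulrC.
have y0 : 0 < N * cos alpha * c by rewrite !mulr_gt0.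
(* The crude bound exp(-y)^2 <= exp(-y) <= 1/y suffices and allows N to be given explicitly. *)
have L1 : L <= (N * cos alpha * c)^-1.
  apply: (@le_trans _ _ (expR (- (N * cos alpha * c)))).
    rewrite /L expr2 -[leRHS]mulr1 ler_pM2l ?expR_gt0//.
    by rewrite -expR0 ler_expR oppr_le0 ltW.
  by have := @expRN_le R 0 _ y0; rewrite expr0 mul1r div1r.
apply: (@le_trans _ _ (2 * C * (N * cos alpha * c)^-1)).
  by rewrite ler_pM2l// mulr_gt0.
have rV0 : 0 < rho * V by rewrite mulr_gt0.
rewrite ler_pdivrMr// -ler_pdivrMl//.
rewrite [leRHS](_ : _ = N * (c * cos alpha)); last ring.
rewrite -ler_pdivrMr// /N -[leLHS]add0r; apply: lerD => //.
rewrite le_eqVlt; apply/orP; left; apply/eqP.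
move: V V0 C C0 {N N1 N0 L L1 tT decay VT E1 E2 y0 C2 rV0} => V V0 C C0.
by field; rewrite !gt_eqF.
Qed.

Lemma Lambda_blunt_wedge (alpha : R) e1 e2 : 0 < alpha -> alpha < pi -> orthonormal e1 e2 ->
  cos alpha <= 0 -> Lambda (wedge alpha e1) 1 = (- 1 ^+ 2)%:E.
Proof.
move=> a0 api oe c0; have s0 : 0 < sin alpha by apply: sin_gt0_pi; rewrite a0 api.
have [mD mF [nu [Hnu BE]]] := wedge_boundary a0 api oe.
have [sub disj cr1 cr2] := blunt_wedge_cones oe s0 c0.
have [e11 e22 e12] := oe; have cs := cos2Dsin2 alpha.
set a := ray alpha e1 e2 in sub disj cr1 BE; set b := ray_neg alpha e1 e2 in sub disj cr2 BE.
set q1 := sin alpha *: e1 - cos alpha *: e2 in sub disj cr1.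
set q2 := sin alpha *: e1 + cos alpha *: e2 in sub disj cr2.
set D := wedge alpha e1 in mD mF Hnu BE sub *.
have q1E : q1 = sin alpha *: e1 + (- cos alpha) *: e2 by rewrite /q1 scaleNr.
have q11 : dot q1 q1 = 1 by rewrite q1E; apply: unit_comb => //; rewrite sqrrN addrC.
have q22 : dot q2 q2 = 1 by apply: unit_comb => //; rewrite addrC.
have aa : dot a a = 1 by exact: ray_unit.
have aq : dot a q1 = 0.
  have [d1 d2] := dot_combE (sin alpha) (- cos alpha) oe.
  by rewrite /a /ray dot_combl q1E [dot e1 _]dotC [dot e2 _]dotC d1 d2; ring.
have oa : orthonormal a q1 by [].
have c1 : 1 = `|cross a q1|^-1 by rewrite cr1 invr1.
have c2 : 1 = `|cross b q2|^-1 by rewrite cr2 invr1.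
apply: (Lambda_extremal mD mF Hnu).
  by move=> phi tphi; rewrite BE//; exact: (energy_two_cones tphi mD q11 q22 ltr01 c1 c2 sub disj).
move=> rho rho0; have [P P0 plateau] := @trial_plateau R.
(* The factor k narrows the cut-off in the direction q1 to |x.q1| < (3/8) N sin alpha, below (N/2)
   sin alpha < (x.a) sin alpha. The part of the support beyond the side a is then thin enough not to
   reach the angle again around the vertex. *)
pose k := 4 / sin alpha; have k0 : 0 < k by rewrite divr_gt0.
pose V := (expR (- 1) * P) ^+ 2 * 2.
have V0 : 0 < V by rewrite mulr_gt0// exprn_gt0// mulr_gt0// expR_gt0.
pose C : R := 2 * (8 * (1 + k)) ^+ 2 * (9 / k) * 1.
have C0 : 0 < C by rewrite /C mulr1 mulr_gt0 ?divr_gt0// mulr_gt0// exprn_gt0// mulr_gt0// addr_gt0.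
have rV : 0 < rho * V by rewrite mulr_gt0.
(* The error C does not tend to 0, but the mass is at least V N, and C <= rho V N. The summand k
   ensures k <= N, so that 0 < x.q1 < 1 lies in the plateau. *)
pose N := k + C / (rho * V).
have kN : k <= N by rewrite lerDl ltW// divr_gt0.
have N0 : 0 < N by rewrite (lt_le_trans k0).
have tT := trial_test 1 q1 2 oa k0 N0.
have cone1P x : cone `[0, +oo[ a q1 x <-> 0 <= dot x a /\ 0 < dot x q1.
  have d0 : cross a q1 != 0 by rewrite -normr_eq0 cr1 oner_neq0.
  rewrite {1}(orthonormal_decomposition x oa) (cone_comb _ _ _ d0)/= in_itv/= andbT.
  by [].
(* The centre m = 2 gives a plateau N <= x.a <= 3 N and a support in N / 2 <= x.a, away from the
   vertex; the box used for the mass has area 2 N. *)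
exists (trial 1 q1 a q1 2 k N).
have VT : ((V * N)%:E <= sqint area D (trial 1 q1 a q1 2 k N))%E.
  have [mB aB] := @area_orthonormal_box _ a q1 `]N, (3 * N)[%classic `]0, 1[%classic oa
    ltac:(exact: measurable_itv) ltac:(exact: measurable_itv).
  set B := [set x | _] in mB aB.
  have -> : (V * N)%:E = (((expR (- 1) * P) ^+ 2)%:E * area B)%E.
    rewrite aB !lebesgue_measure_itv/= !lte_fin ifT; last lra.
    rewrite ltr01.
    by rewrite -!EFinB -!EFinM; congr EFin; rewrite /V; ring.
  apply: integral_ge_const => //.
  - move=> x []; rewrite /= !in_itv/= => /andP[X1 X2] /andP[Y1 Y2].
    by apply: sub; left; apply/cone1P; split => //; rewrite (le_trans (ltW N0))// ltW.
  - apply/measurable_EFinP; apply: measurable_funX; apply: measurable_funTS.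
    by apply: plane_continuous_measurable; exact: test_continuous tT.
  - by move=> x _; rewrite lee_fin sqr_ge0.
  - exact: sqr_ge0.
  - move=> x []; rewrite /= !in_itv/= => /andP[X1 X2] /andP[Y1 Y2]; rewrite lee_fin.
    rewrite plateau; last 2 first.
    + have h1 : 1 < dot x a * N^-1 by rewrite ltr_pdivlMr// mul1r.
      have h2 : dot x a * N^-1 < 3 by rewrite ltr_pdivrMr.
      lra.
    + have kN1 : k / N <= 1 by rewrite ler_pdivrMr// mul1r.
      have kN0 : 0 < k / N by rewrite divr_gt0.
      have h1 : 0 < dot x q1 * (k / N) by rewrite mulr_gt0.
      have h2 : dot x q1 * (k / N) <= 1 * 1 by rewrite ler_pM// ltW.
      lra.
    have PE (z : R) : expR z * P \is Num.nneg by rewrite nnegrE mulr_ge0 ?expR_ge0// ltW.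
    by rewrite ler_pXn2r ?PE// ler_pM2r// ler_expR; lra.
split => //; first by rewrite (lt_le_trans _ VT)// lte_fin mulr_gt0.
rewrite BE//.
have E1 := @trial_energy_cone _ 1 `[0, +oo[ a q1 a q1 2 k N 1 oa
  (measurable_itv _) q11 ltr01 c1 k0 N0 ler01.
have decay x : cone `[0, +oo[ a q1 x -> expR (dot x q1 * - 1 + 0) ^+ 2 <= 1.
  move=> /cone1P[_ xq]; rewrite -[leRHS](expr1n _ 2) ler_pXn2r ?nnegrE ?expR_ge0//.
  by rewrite -[leRHS]expR0 ler_expR; lra.
have {decay}E1 := E1 (fun x Cx _ _ _ => decay x Cx).
(* The cut-off confines the trial function to the cone over one side of the angle. *)
have DE : energy 1 D (trial 1 q1 a q1 2 k N) = energy 1 (cone `[0, +oo[ a q1) (trial 1 q1 a q1 2 k N).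
  rewrite /energy [LHS]integral_mkcond [RHS]integral_mkcond; apply: eq_integral => x _.
  rewrite !patchE; have [Cx|Cx] := pselect (cone `[0, +oo[ a q1 x).
    by rewrite (mem_set Cx) mem_set//; apply: sub; left.
  rewrite [x \in cone _ _ _]memNset//; case: ifPn => //; rewrite inE => Dx.
  have out : 3 / 2 <= `|dot x a * N^-1 + - 2| \/ 3 / 2 <= `|dot x q1 * (k / N) + 0|.
    apply: contrapT => /not_orP[/negP + /negP]; rewrite -!ltNge addr0.
    rewrite ltr_norml => /andP[h1 _] h2.
    have aN : N / 2 < dot x a by rewrite mulrC -ltr_pdivlMr//; lra.
    have qN : dot x q1 <= 0.
      by rewrite leNgt; apply/negP => q0; apply/Cx/cone1P; split => //; lra.
    have tN : - dot x q1 <= dot x a * sin alpha.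
      move: h2; rewrite -normrN ger0_norm; last by rewrite oppr_ge0 mulr_le0_ge0// divr_ge0// ltW.
      rewrite -mulNr /k !mulrA ltr_pdivrMr// ltr_pdivrMr// => h2.
      have : N / 2 * sin alpha < dot x a * sin alpha by rewrite ltr_pM2r.
      lra.
    move: Dx; rewrite /D /wedge/= ltNge => /negP; apply.
    have ae1 : dot a e1 = cos alpha by have [] := dot_combE (cos alpha) (sin alpha) oe.
    have qe1 : dot q1 e1 = sin alpha by rewrite q1E; have [] := dot_combE (sin alpha) (- cos alpha) oe.
    rewrite {1}(orthonormal_decomposition x oa) dot_combl ae1 qe1 /enorm (orthonormal_dotE x oa).
    move: (dot x a) (dot x q1) aN qN tN => s t aN qN tN.
    have cos1 : - cos alpha <= 1 by have := cos_abs_lt1 a0 api; rewrite ltr_norml => /andP[]; lra.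
    have s_ge0 : 0 <= s by lra.
    have nc0 : 0 <= - cos alpha by rewrite oppr_ge0.
    have nt0 : 0 <= - t by rewrite oppr_ge0.
    (* After the change of sign both sides are nonnegative. Squared, the claim is t^2 cos^2 alpha <=
       2 s t sin alpha cos alpha + t^2 sin^2 alpha, which follows from - t <= s sin alpha and - cos
       alpha <= 1. *)
    rewrite -lerN2 -mulNr -(@ler_pXn2r _ 2) ?nnegrE//; last 2 first.
    - by rewrite mulr_ge0// sqrtr_ge0.
    - have : 0 <= s * - cos alpha by rewrite mulr_ge0.
      have : 0 <= - t * sin alpha by rewrite mulr_ge0// ltW.
      lra.
    rewrite exprMn sqr_sqrtr ?addr_ge0 ?sqr_ge0//.
    have : - cos alpha * (- t * - t) * - cos alpha <= - cos alpha * (- t * - t) * 1.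
      by rewrite ler_wpM2l// mulr_ge0// mulr_ge0.
    have : - cos alpha * - t * - t <= - cos alpha * - t * (s * sin alpha).
      by rewrite ler_wpM2l// mulr_ge0.
    have := sqr_ge0 (t * sin alpha).
    have : 0 <= - cos alpha * - t * (s * sin alpha).
      by rewrite mulr_ge0 ?mulr_ge0// ltW.
    nra.
  have [T0 DT0] := trial_outside 1 q1 out.
  by rewrite /partial1 /partial2 !DT0 T0 !expr0n/= mulr0 !addr0.
(* The boundary integral over the other side is nonnegative and can be added for free. *)
rewrite DE; apply: (le_trans E1); apply: leeD.
  by rewrite leeDl// integral_ge0// => s _; rewrite lee_fin sqr_ge0.
apply: (@le_trans _ _ (rho * (V * N))%:E); last first.
  by rewrite EFinM; apply: lee_wpmul2l => //; rewrite lee_fin ltW.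
rewrite lee_fin -/C mulrA -ler_pdivrMl// /N mulrC lerDr; exact: ltW.
Qed.

End LambdaOfAngle.

(** * From Lambda to the constant of a boundary point *)

Section ConeConstant.
Context {R : realType}.
Implicit Types (K : set (R * R)).

Lemma cos_gt0E (alpha : R) : 0 < alpha -> alpha < pi -> (0 < cos alpha) = (alpha < pi / 2).
Proof.
move=> a0 api; have p0 := @pi_gt0 R.
by rewrite -cos_pihalf ltr_cos// in_itv/= !ltW//; lra.
Qed.

Lemma cone_constant_angle K (alpha : R) : 0 < alpha -> alpha < pi ->
  in_cartesian_coordinates K (angle alpha) ->
  cone_constant K = (if alpha < pi / 2 then sin alpha ^- 2 else 1)%:E.
Proof.
move=> a0 api [e1 [e2 [e11 e22 e12 KE]]].
have oe : orthonormal e1 e2 by [].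
rewrite /cone_constant (angle_in_coordinatesP a0 api oe KE) -/(wedge alpha e1) -cos_gt0E//.
case: ltP => c0; first by rewrite (Lambda_sharp_wedge a0 api oe c0) -EFinN opprK exprVn.
by rewrite (Lambda_blunt_wedge a0 api oe c0) -EFinN opprK expr1n.
Qed.

Lemma angle_in_cartesian_coordinates (A : set (R * R)) : in_cartesian_coordinates A A.
Proof.
exists (1, 0), (0, 1); rewrite /dot/=; split; do ?ring.
by apply/seteqP; split => -[x y]/=; rewrite !mulr1 !mulr0 addr0 add0r.
Qed.

End ConeConstant.

Theorem theorem3p6 (R : realType) (Omega : set (R * R))
    (K : R * R -> set (R * R)) (alpha : R) (y : R * R)
    (Omega_open : open Omega) (Omega_bounded : bounded_set Omega)
    (Omega_smooth : piecewise_smooth Omega K)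
    (alpha_gt0 : 0 < alpha) (alpha_ltpi : alpha < pi)
    (y_bdry : frontier Omega y)
    (Ky_angle : in_cartesian_coordinates (K y) (angle alpha)) :
  [/\ cone_constant (K y) = (- Lambda (angle alpha) 1)%E,
      pi / 2 <= alpha -> cone_constant (K y) = 1%E &
      alpha <= pi / 2 -> cone_constant (K y) = ((sin alpha) ^- 2)%:E].
Proof.
have KyE := cone_constant_angle alpha_gt0 alpha_ltpi Ky_angle.
split.
(* The angle itself is the case of the standard basis, so the same formula computes its Lambda. *)
- rewrite KyE; apply/esym/(cone_constant_angle alpha_gt0 alpha_ltpi).
  exact: angle_in_cartesian_coordinates.
- by rewrite leNgt KyE => /negbTE ->.
(* At alpha = pi/2 the computed value is 1, which agrees with the inverse square of sin (pi/2). *)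
- rewrite le_eqVlt KyE => /predU1P[->|->//].
  by rewrite ltxx sin_pihalf expr1n invr1.
Qed.
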